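(* Let $\varepsilon\in(0,1]$, $\mathrm{bo}>0$ and $0<\mu<1$ with $\tfrac{\sqrt\mu}{\mathrm{bo}}-\tfrac{\mu}{3}>0$, and let $\zeta_0\in\mathbb{A}^0_0$ be a real-valued zero-mean function with $$|\zeta_0|_{0,0}<\frac{\frac{\sqrt\mu}{\mathrm{bo}}-\frac{\mu}{3}}{128\varepsilon\left(\frac{\sqrt\mu}{\mathrm{bo}}+\frac{55}{6}\mu+1\right)}.$$ Then there exists a global weak solution $\zeta$ (on $[0,T]$ for every $T>0$) of the stable refined thin film equation $$\partial_t\zeta+\partial_x\left((1+\varepsilon\zeta)(-\partial_x\zeta+\tfrac{\sqrt\mu}{\mathrm{bo}}\partial_x^3\zeta)\right)-\tfrac{\mu}{3}\partial_x^2\left((1+\varepsilon\zeta)^3\partial_x^2\zeta\right)=0$$ with initial datum $\zeta_0$, which becomes instantaneously analytic in a growing strip of the complex plane. More precisely, for every $\nu\in\left[0,\tfrac12(\tfrac{\sqrt\mu}{\mathrm{bo}}-\tfrac{\mu}{3})\right)$ and $T>0$, $\zeta\in L^\infty([0,T];\mathbb{A}^0_{\nu t})\cap L^1([0,T];\mathbb{A}^4_{\nu t})$ and for all $t\in[0,T]$ $$|\zeta(t)|_{0,\nu t}+\tfrac{1}{64}\left(\tfrac{\sqrt\mu}{\mathrm{bo}}-\tfrac{\mu}{3}\right)\int_0^t|\zeta(t')|_{4,\nu t'}dt'\leq|\zeta_0|_{0,0},\qquad|\zeta(t)|_{0,\nu t}\leq|\zeta_0|_{0,0}\,e^{-\f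rac{t}{64}\left(\frac{\sqrt\mu}{\mathrm{bo}}-\frac{\mu}{3}\right)}.$$
   Context: $\mathbb{T}=\mathbb{R}/2\pi\mathbb{Z}$; $\widehat g(n)=\frac1{2\pi}\int_{\mathbb{T}}ge^{-inx}dx$; $|g|_{s,\lambda}=\sum_n(1+|n|)^se^{\lambda|n|}|\widehat g(n)|$, $\mathbb{A}^s_\lambda$ the space of $g$ with finite norm. The membership $\zeta\in L^\infty([0,T];\mathbb{A}^0_{\nu t})\cap L^1([0,T];\mathbb{A}^4_{\nu t})$ means $\sup_{t\in[0,T]}|\zeta(t)|_{0,\nu t}<\infty$ and $\int_0^T|\zeta(t)|_{4,\nu t}dt<\infty$. Weak solution: $\zeta\in L^\infty([0,T],L^\infty(\mathbb{T}))\cap L^1([0,T],W^{3,\infty}(\mathbb{T}))$ such that for every $\varphi\in C^\infty([0,T]\times\mathbb{T})$ and $t\in[0,T]$: $\int\zeta(t)\varphi(t)-\int\zeta_0\varphi(0)-\int_0^t\!\int\zeta\partial_t\varphi=-\int_0^t\!\int(1+\varepsilon\zeta)\partial_x\zeta\partial_x\varphi+\frac{\sqrt\mu}{\mathrm{bo}}\int_0^t\!\int(1+\varepsilon\zeta)\partial_x^3\zeta\partial_x\varphi+\frac\mu3\int_0^t\!\int(1+\varepsilon\zeta)^3\partial_x^2\zeta\partial_x^2\varphi$. *)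

(* Defs.v *)
From HB Require Import structures.
From mathcomp Require Import all_boot all_order all_algebra.
From mathcomp Require Import all_classical all_reals all_analysis.
Set Implicit Arguments. Unset Strict Implicit. Unset Printing Implicit Defensive.
Import Order.TTheory GRing.Theory Num.Theory.
Import numFieldNormedType.Exports.
Local Open Scope classical_set_scope.
Local Open Scope ring_scope.

Section Defs.
Variable R : realType.
Local Notation mu := (@lebesgue_measure R).

(** the circle T = R / 2 pi Z, functions on T = 2pi-periodic functions *)
Definition periodic2pi (g : R -> R) : Prop := forall x, g (x + 2 * pi) = g x.

Definition intT (g : R -> R) : R := Rintegral mu `[0, 2 * pi] g.

(** real and imaginary parts of hat g (n) = 1/(2pi) int g e^{-inx} dx *)
Definition fcoef_re (g : R -> R) (n : int) : R :=
  (2 * pi)^-1 * intT (fun x => g x * cos (n%:~R * x)).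
Definition fcoef_im (g : R -> R) (n : int) : R :=
  - ((2 * pi)^-1 * intT (fun x => g x * sin (n%:~R * x))).
Definition fcoef_abs (g : R -> R) (n : int) : R :=
  Num.sqrt (fcoef_re g n ^+ 2 + fcoef_im g n ^+ 2).

Definition wnorm (s : nat) (lam : R) (g : R -> R) : \bar R :=
  \esum_(n in [set: int])
    ((1 + `|n|%:~R) ^+ s * expR (lam * `|n|%:~R) * fcoef_abs g n)%:E.

Definition inA (s : nat) (lam : R) (g : R -> R) : Prop :=
  periodic2pi g /\ mu.-integrable `[0, 2 * pi] (EFin \o g) /\
  (wnorm s lam g < +oo)%E.

Definition smooth1 (f : R -> R) : Prop :=
  forall n : nat, continuous (iter n (fun g : R -> R => derive1 g) f) /\
    forall x, derivable (iter n (fun g : R -> R => derive1 g) f) x 1.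

Definition pdt (f : R -> R -> R) : R -> R -> R :=
  fun t x => derive1 (fun s => f s x) t.
Definition pdx (f : R -> R -> R) : R -> R -> R :=
  fun t x => derive1 (fun y => f t y) x.
Definition partials (s : seq bool) (f : R -> R -> R) : R -> R -> R :=
  foldr (fun b g => if b then pdt g else pdx g) f s.

Definition smooth2 (f : R -> R -> R) : Prop :=
  forall s : seq bool,
    continuous (fun p : R * R => partials s f p.1 p.2) /\
    forall t x, derivable (fun u => partials s f u x) t 1 /\
                derivable (fun y => partials s f t y) x 1.

Definition weak_deriv (g h : R -> R) : Prop :=
  forall phi : R -> R, smooth1 phi -> periodic2pi phi ->
    intT (fun x => g x * derive1 phi x) = - intT (fun x => h x * phi x).

Definition dblint (t : R) (F : R -> R -> R) : R :=
  Rintegral mu `[0, t] (fun s => intT (F s)).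

(** weak solution on [0,T] of the stable refined thin film equation,
    with zeta in L^oo([0,T],L^oo(T)) /\ L^1([0,T],W^{3,oo}(T)).
    D k is the k-th (weak) x-derivative of zeta. *)
Definition weak_solution (eps mu0 bo : R) (zeta0 : R -> R) (T : R)
    (zeta : R -> R -> R) : Prop :=
  exists (D : nat -> R -> R -> R) (M : R) (B : R -> R),
  D 0%N = zeta /\
      (forall k, (k <= 3)%N ->
         measurable_fun setT (fun p : R * R => D k p.1 p.2)) /\
      {ae mu, forall t, t \in `[0, T] ->
         {ae mu, forall x, x \in `[0, 2 * pi] -> `|zeta t x| <= M}} /\
      mu.-integrable `[0, T] (EFin \o B) /\
      {ae mu, forall t, t \in `[0, T] ->
         (forall k, (k <= 3)%N ->
           {ae mu, forall x, x \in `[0, 2 * pi] -> `|D k t x| <= B t}) /\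
         (forall k, (k < 3)%N -> weak_deriv (D k t) (D k.+1 t))} /\
      forall phi : R -> R -> R, smooth2 phi ->
      (forall t x, phi t (x + 2 * pi) = phi t x) ->
      forall t, t \in `[0, T] ->
        intT (fun x => zeta t x * phi t x) - intT (fun x => zeta0 x * phi 0 x)
        - dblint t (fun s x => zeta s x * pdt phi s x)
        = - dblint t (fun s x => (1 + eps * zeta s x) * D 1%N s x * pdx phi s x)
          + Num.sqrt mu0 / bo *
            dblint t (fun s x => (1 + eps * zeta s x) * D 3%N s x * pdx phi s x)
          + mu0 / 3 *
            dblint t (fun s x => (1 + eps * zeta s x) ^+ 3 * D 2%N s x
                                  * pdx (pdx phi) s x).

End Defs.

(* Main.v *)
Require Import Defs.
From HB Require Import structures.
From mathcomp Require Import all_boot all_order all_algebra.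
From mathcomp Require Import all_classical all_reals all_analysis.
From mathcomp Require Import measurable_realfun.
From mathcomp Require Import ring lra.
Import Order.TTheory GRing.Theory Num.Theory.
Import numFieldNormedType.Exports.
Local Open Scope classical_set_scope.
Local Open Scope ring_scope.
Set Implicit Arguments.
Unset Strict Implicit.
Unset Printing Implicit Defensive.

(** Expand the solution into Fourier modes and iterate the Duhamel formula: the
    solution becomes a series over trees, whose leaves are modes of the datum and
    whose nodes are the two-, three- and four-wave interactions of the equation.
    Replacing each factor of a tree by its absolute value gives majorants that
    absorb the weight [e^{nu t |n|}] at the cost of half of the dissipation
    [(sqrt mu/bo - mu/3) n^4]; they satisfy an energy identity in which the
    nonlinear terms are, for small data, dominated by the remaining dissipation.
    Summing over trees therefore bounds the [A^0] norm uniformly in time and the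
    [A^4] norm in [L^1], which gives both the convergence of the series and the
    dominations needed to pass to the limit in the weak formulation.  The datum
    enters only through its Fourier coefficients, which determine it weakly by
    convolution with the kernel [(1 + cos z)^N]. *)

(** * Time integrals and the Duhamel operator *)

(** The constants form a budget for gam = sqrt mu/bo - mu/3, counted in 64ths. Weight and
    exponential decay take 32 + 1, which leaves 31 to the majorants; the nonlinearity is allowed 15;
    the remaining 16 become 1 after [(1 + |n|)^4 <= 16 n^4], whence the factor 1/64 of the theorem.
    The decay and this last inequality need [|n| >= 1]: the interactions are in divergence form and
    no leaf has frequency zero, so the zero mode stays empty. No compactness is used. Iterate k + 1
    is forced by iterate k alone, so bounds pass from k to k + 1 without a bootstrap in time; the
    forests are nested, so the majorants increase with k and dominate the increments of the
    iterates. The [A^4] bound is only integrable in time, so the series of derivatives may diverge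
    on a null set of times. The weak form tolerates this because each of its products has at most
    one differentiated copy of the solution. Cosines with phases replace complex exponentials and
    keep everything real. *)

Section Toolkit.
Variable R : realType.
Local Notation mu := (@lebesgue_measure R).
Implicit Types (f g F : R -> R) (a b t lam : R).

Lemma cont_integrable f a b : continuous f -> mu.-integrable `[a, b] (EFin \o f).
Proof.
move=> cf; apply: continuous_compact_integrable; first exact: segment_compact.
exact: continuous_subspaceT.
Qed.

Lemma Rint_FTC F f a b : a <= b -> continuous f -> continuous F ->
  (forall x, a < x -> x < b -> is_derive x 1 F (f x)) ->
  \int[mu]_(x in `[a, b]) f x = F b - F a.
Proof.
rewrite le_eqVlt => /predU1P[<- cf cF dF|ab cf cF dF].
  by rewrite set_itv1 Rintegral_set1 subrr.
rewrite /Rintegral (@continuous_FTC2 R f F a b)//.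
- exact: continuous_subspaceT.
- split.
  + move=> x; rewrite in_itv/= => /andP[ax xb].
    by have [] := dF _ ax xb.
  + exact/cvg_at_right_filter/cF.
  + exact/cvg_at_left_filter/cF.
- move=> x; rewrite in_itv/= => /andP[ax xb].
  by rewrite derive1E; have [_ ->] := dF _ ax xb.
Qed.

Lemma cont_mul f g : continuous f -> continuous g -> continuous (fun s => f s * g s).
Proof. by move=> cf cg s; apply: cvgM; [exact: cf|exact: cg]. Qed.

Lemma cont_add f g : continuous f -> continuous g -> continuous (fun s => f s + g s).
Proof. by move=> cf cg s; apply: cvgD; [exact: cf|exact: cg]. Qed.

Lemma cont_scale (c : R) f : continuous f -> continuous (fun s => c * f s).
Proof. by move=> cf; apply: cont_mul => // s; exact: cvg_cst. Qed.

Lemma cont_norm f : continuous f -> continuous (fun s => `|f s|).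
Proof. by move=> cf s; apply: cvg_norm; exact: cf. Qed.

(** The interval is empty for negative t, where the primitive vanishes; primitives are thus
    continuous on the whole line. *)
Definition prim f t : R := \int[mu]_(s in `[0, t]) f s.

Lemma prim_le0 f t : t <= 0 -> prim f t = 0.
Proof.
rewrite /prim le_eqVlt => /predU1P[->|t0]; first by rewrite set_itv1 Rintegral_set1.
by rewrite set_itv_ge ?Rintegral_set0// bnd_simp -ltNge.
Qed.

Lemma prim_cont f : continuous f -> continuous (prim f).
Proof.
move=> cf t.
pose a := Num.min t 0 - 1; pose b := `|t| + 1.
have at_ : a < t by rewrite /a ltrBlDr (le_lt_trans (y := t)) ?ge_min ?lexx// ltrDl.
have a0 : a < 0 by rewrite /a ltrBlDr add0r (le_lt_trans (y := 0)) ?ge_min ?lexx ?orbT.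
have tb : t < b by rewrite /b (le_lt_trans (ler_norm t))// ltrDl.
have ab : a < b by apply: lt_trans tb.
(* Cutting f off on the negative axis turns [prim f] into an integral from the fixed point [a < 0],
   so that t = 0 becomes an interior point. *)
pose fp := f \_ `[0, +oo[.
have ifp : mu.-integrable `[a, b] (EFin \o fp).
  rewrite /fp -restrict_EFin; apply/integrable_restrict => //=.
  by apply: integrableS (cont_integrable a b cf) => //; apply: measurableI.
have E s : parameterized_integral mu a s fp = prim f s.
  rewrite /parameterized_integral /fp -Rintegral_mkcondr; congr Rintegral.
  by apply/seteqP; split => x /=; rewrite !in_itv/= andbT; lra.
have := parameterized_integral_continuous (ltW ab) ifp.
move=> /(continuous_within_itvP _ ab)[+ _ _] => /(_ t).
rewrite in_itv/= at_ tb => /(_ isT).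
rewrite (_ : (fun x => parameterized_integral mu a x fp) = prim f)//.
by apply/funext.
Qed.

Lemma prim_derive f t : continuous f -> 0 < t -> is_derive t 1 (prim f) (f t).
Proof.
move=> cf t0.
have tt : t < t + 1 by rewrite ltrDl.
have [d e] := @continuous_FTC1_closed R f 0 t (t + 1) tt (cont_integrable _ _ cf) t0 (cf t).
by split; [exact: d|rewrite -derive1E e].
Qed.

Lemma prim_ge0 f t : (forall s, 0 <= s -> 0 <= f s) -> 0 <= prim f t.
Proof.
by move=> f0; apply: Rintegral_ge0 => x /=; rewrite in_itv/= => /andP[? _]; exact: f0.
Qed.

Lemma prim_le f g t : continuous f -> continuous g ->
  (forall s, 0 <= s -> s <= t -> f s <= g s) -> prim f t <= prim g t.
Proof.
move=> cf cg fg; apply: le_Rintegral => //; [exact: cont_integrable..|].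
by move=> x /=; rewrite in_itv/= => /andP[? ?]; exact: fg.
Qed.

Lemma primD f g t : continuous f -> continuous g ->
  prim (fun s => f s + g s) t = prim f t + prim g t.
Proof. by move=> cf cg; apply: RintegralD => //; exact: cont_integrable. Qed.

Lemma primZ (c : R) f t : continuous f -> prim (fun s => c * f s) t = c * prim f t.
Proof. by move=> cf; apply: RintegralZl => //; exact: cont_integrable. Qed.

Lemma prim0 t : prim (fun=> 0) t = 0.
Proof. by rewrite /prim Rintegral_cst//= mul0r. Qed.

Lemma continuous_bigsum (I : Type) (r : seq I) (G : I -> R -> R) :
  (forall i, continuous (G i)) -> continuous (fun s => \sum_(i <- r) G i s).
Proof.
move=> cG s; elim: r => [|i r IH].
  under eq_fun do rewrite big_nil; exact: cvg_cst.
by under eq_fun do rewrite big_cons; apply: continuousD => //; exact: cG.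
Qed.

Lemma prim_sum (I : Type) (r : seq I) (G : I -> R -> R) t :
  (forall i, continuous (G i)) ->
  prim (fun s => \sum_(i <- r) G i s) t = \sum_(i <- r) prim (G i) t.
Proof.
move=> cG; elim: r => [|i r IH].
  by under eq_fun do rewrite big_nil; rewrite big_nil prim0.
under eq_fun do rewrite big_cons.
by rewrite big_cons primD ?IH//; exact: continuous_bigsum.
Qed.

Lemma prim_norm f t : continuous f -> `|prim f t| <= prim (fun s => `|f s|) t.
Proof. by move=> cf; apply: le_normr_Rintegral => //; exact: cont_integrable. Qed.

Lemma expRM_cont lam : continuous (fun s : R => expR (lam * s)).
Proof.
move=> s; apply: (@continuous_comp _ _ _ (fun s => lam * s) expR); last exact: continuous_expR.
exact: mulrl_continuous.
Qed.

Lemma expRM_derive lam (t : R) : is_derive t 1 (fun s : R => expR (lam * s)) (lam * expR (lam * t)).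
Proof.
apply: (@is_derive_eq _ _ _ _ _ _ _ _ (@is_derive1_comp _ expR (fun s => lam * s) t _ _ _ _)).
rewrite /= mulrC; congr (_ * _); rewrite /GRing.scale/= mulr1//.
Qed.

(** For t >= 0, the solution of [y' = - lam y + f] with [y 0 = 0]. *)
Definition duhamel lam f t : R :=
  expR (- lam * t) * prim (fun s => expR (lam * s) * f s) t.

Lemma duhamel_int_cont lam f : continuous f -> continuous (fun s => expR (lam * s) * f s).
Proof. by move=> cf; apply: cont_mul => //; exact: expRM_cont. Qed.

Lemma duhamel_cont lam f : continuous f -> continuous (duhamel lam f).
Proof.
move=> cf; apply: cont_mul; first exact: expRM_cont.
by apply: prim_cont; exact: duhamel_int_cont.
Qed.

Lemma duhamel_derive lam f t : continuous f -> 0 < t ->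
  is_derive t 1 (duhamel lam f) (- lam * duhamel lam f t + f t).
Proof.
move=> cf t0.
have d1 := expRM_derive (- lam) t.
have d2 := prim_derive (duhamel_int_cont (lam := lam) cf) t0.
apply: (is_derive_eq (is_deriveM d1 d2)).
rewrite /GRing.scale/= /duhamel mulrA -expRD mulNr addNr expR0 mul1r mulNr; ring.
Qed.

Lemma duhamel_ge0 lam f t : (forall s, 0 <= s -> 0 <= f s) -> 0 <= duhamel lam f t.
Proof.
move=> f0; rewrite mulr_ge0 ?expR_ge0// prim_ge0// => s s0.
by rewrite mulr_ge0 ?expR_ge0 ?f0.
Qed.

Lemma duhamel_eq0 lam f t : (forall s, f s = 0) -> duhamel lam f t = 0.
Proof.
move=> f0; rewrite /duhamel; under eq_fun do rewrite f0 mulr0.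
by rewrite prim0 mulr0.
Qed.

Lemma duhamel_at0 lam f : duhamel lam f 0 = 0.
Proof. by rewrite /duhamel prim_le0// mulr0. Qed.

(** Integrating the differential equation over [[0, t]] gives an equality; the energy identity of
    the majorants is a sum of such equalities. *)
Lemma duhamel_balance lam f t : continuous f -> 0 <= t ->
  duhamel lam f t + lam * prim (duhamel lam f) t = prim f t.
Proof.
move=> cf t0.
have cD := duhamel_cont (lam := lam) cf.
have E : prim (fun s => - lam * duhamel lam f s + f s) t = duhamel lam f t - duhamel lam f 0.
  apply: Rint_FTC => //.
  - by apply: cont_add => //; exact: cont_scale.
  - by move=> s s0 _; exact: duhamel_derive.
move: E; rewrite primD//; last exact: cont_scale.
by rewrite primZ// duhamel_at0; lra.
Qed.

(* The weight [expR (w * t)] is absorbed by lowering the decay rate from [lam] to [lam - w]. *)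
Lemma duhamel_le lam kap w f g t : continuous f -> continuous g -> 0 <= t ->
  kap <= lam - w -> (forall s, 0 <= s -> `|f s| * expR (w * s) <= g s) ->
  `|duhamel lam f t| * expR (w * t) <= duhamel kap g t.
Proof.
move=> cf cg t0 kl fg.
rewrite /duhamel normrM (ger0_norm (expR_ge0 _)).
have c1 : continuous (fun s => expR (lam * s) * f s) by exact: duhamel_int_cont.
have c2 : continuous (fun s => `|expR (lam * s) * f s|).
  exact: cont_norm.
apply: (@le_trans _ _ (prim (fun s => (expR (- lam * t) * expR (w * t)) * `|expR (lam * s) * f s|) t)).
  rewrite primZ// mulrAC ler_pM2l ?mulr_gt0 ?expR_gt0//; exact: prim_norm.
rewrite -primZ; last exact: duhamel_int_cont.
apply: prim_le.
- exact: cont_scale.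
- by apply: cont_scale; exact: duhamel_int_cont.
move=> s s0 st; rewrite normrM (ger0_norm (expR_ge0 _)).
have -> : expR (- lam * t) * expR (w * t) * (expR (lam * s) * `|f s|) =
  expR (- (lam - w) * (t - s)) * (`|f s| * expR (w * s)).
  rewrite [RHS]mulrCA [LHS]mulrCA [in LHS]mulrA [in LHS]mulrC; congr (_ * _).
  rewrite -!expRD; congr expR; ring.
rewrite mulrA -expRD.
apply: ler_pM; rewrite ?expR_ge0 ?mulr_ge0 ?expR_ge0//; last exact: fg.
rewrite ler_expR.
have -> : - kap * t + kap * s = - kap * (t - s) by ring.
by apply: ler_wpM2r; [rewrite subr_ge0|rewrite lerN2].
Qed.

End Toolkit.

(** * Integrals over the circle *)

Section TwoVariables.
Variable R : realType.
Local Notation mu := (@lebesgue_measure R).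
Implicit Types (H : R -> R -> R) (f g : R -> R).

Definition cont2 H := continuous (fun p : R * R => H p.1 p.2).

Lemma cont2_row H s : cont2 H -> continuous (H s).
Proof.
move=> cH x; have /= := cH (s, x).
apply: (@continuous_comp _ _ _ (fun y => (s, y)) (fun p : R * R => H p.1 p.2)).
exact: (@cvg_pair R R R (nbhs x) (nbhs s) (nbhs x) _ _ _ (fun=> s) id (cvg_cst s) cvg_id).
Qed.

Lemma cont2_col H x : cont2 H -> continuous (H ^~ x).
Proof.
move=> cH s; have /= := cH (s, x).
apply: (@continuous_comp _ _ _ (fun y => (y, x)) (fun p : R * R => H p.1 p.2)).
exact: (@cvg_pair R R R (nbhs s) (nbhs s) (nbhs x) _ _ _ id (fun=> x) cvg_id (cvg_cst x)).
Qed.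

Lemma cont2_mul H K : cont2 H -> cont2 K -> cont2 (fun s x => H s x * K s x).
Proof. by move=> cH cK p; apply: cvgM; [exact: cH|exact: cK]. Qed.

Lemma cont2_fst f : continuous f -> cont2 (fun s _ => f s).
Proof. by move=> cf p; apply: (@continuous_comp _ _ _ fst f); [exact: cvg_fst|exact: cf]. Qed.

Lemma cont2_snd f : continuous f -> cont2 (fun _ x => f x).
Proof. by move=> cf p; apply: (@continuous_comp _ _ _ snd f); [exact: cvg_snd|exact: cf]. Qed.

Lemma cont2_bounded H a b : cont2 H -> exists2 M, 0 <= M &
  forall s x, a <= s <= b -> 0 <= x <= 2 * pi -> `|H s x| <= M.
Proof.
move=> cH.
have cK : compact (`[a, b] `*` `[0, 2 * pi] : set (R * R)).
  by apply: compact_setX; exact: segment_compact.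
have := compact_bounded (continuous_compact (continuous_subspaceT cH) cK).
case=> M [_ MP]; exists (`|M| + 1) => [|s x sab x02]; first by rewrite addr_ge0.
apply: (MP (`|M| + 1)); first by rewrite (le_lt_trans (ler_norm M))// ltrDl.
by exists (s, x) => //; split; rewrite /= in_itv.
Qed.

Lemma intT_prim g : intT g = prim g (2 * pi).
Proof. by []. Qed.

Lemma intT_cont H : cont2 H -> continuous (fun s => intT (H s)).
Proof.
move=> cH s.
have [M M0 MP] := cont2_bounded (s - 1) (s + 1) cH.
have st : s \in `]s - 1, s + 1[%classic.
  by rewrite inE /= in_itv/= ltrBlDr ltrDl ltr01.
apply: (@continuity_under_integral R _ _ mu H `[0, 2 * pi] _ (s - 1) (s + 1) _ _ (fun=> M) _ _ s st) => //.
- by move=> x _; apply: cont_integrable; exact: cont2_row.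
- by apply: aeW => y _ x _; exact: cont2_col.
- by apply: cont_integrable => x; exact: cvg_cst.
- move=> x; rewrite /= in_itv /= => /andP[x1 x2]; apply: aeW => y; rewrite /= in_itv => yI.
  by apply: MP => //; rewrite !ltW.
Qed.

Lemma intT_derive H K (s : R) : cont2 H -> cont2 K ->
  (forall s x : R, is_derive s 1 (H ^~ x) (K s x)) ->
  is_derive s 1 (fun s => intT (H s)) (intT (K s)).
Proof.
move=> cH cK dH.
have [M M0 MP] := cont2_bounded (s - 1) (s + 1) cK.
have st : `]s - 1, s + 1[%classic s.
  by rewrite /= in_itv/= ltrBlDr ltrDl ltr01.
have pK t x : partial1of2 H t x = K t x.
  by rewrite partial1of2E; have [_ ->] := dH t x.
have h1 (x : R) : `]s - 1, s + 1[%classic x -> mu.-integrable `[0, 2 * pi] (EFin \o H x).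
  by move=> _; apply: cont_integrable; exact: cont2_row.
have h2 (x y : R) : `]s - 1, s + 1[%classic x -> `[0, 2 * pi]%classic y -> derivable (H ^~ y) x 1.
  by move=> _ _; have [] := dH x y.
have h3 : mu.-integrable `[0, 2 * pi] (EFin \o (fun=> M)).
  by apply: cont_integrable => x; exact: cvg_cst.
have h4 (x y : R) : `]s - 1, s + 1[%classic x -> `[0, 2 * pi]%classic y -> `|partial1of2 H x y| <= M.
  rewrite /= !in_itv /= => /andP[x1 x2] yI; rewrite pK.
  by apply: MP => //; rewrite !ltW.
have mI : measurable (`[0, 2 * pi]%classic : set (measurableTypeR R)) by [].
split; first exact: (derivable_under_integral mI st h1 h2 (fun=> M0) h3 h4).
rewrite -derive1E (differentiation_under_integral mI st h1 h2 (fun=> M0) h3 h4).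
by apply: eq_Rintegral => x _; exact: pK.
Qed.

Lemma derive_cont f g : (forall x : R, is_derive x 1 f (g x)) -> continuous f.
Proof.
move=> df x; apply: differentiable_continuous; apply/derivable1_diffP.
by have [] := df x.
Qed.

Lemma twopi_ge0 : 0 <= 2 * pi :> R.
Proof. by rewrite mulr_ge0// pi_ge0. Qed.

Lemma intT_ibp f f' g g' :
  (forall x : R, is_derive x 1 f (f' x)) -> (forall x : R, is_derive x 1 g (g' x)) ->
  continuous f' -> continuous g' -> periodic2pi f -> periodic2pi g ->
  intT (fun x => f x * g' x) = - intT (fun x => f' x * g x).
Proof.
move=> df dg cf' cg' pf pg.
have cf := derive_cont df; have cg := derive_cont dg.
have : intT (fun x => f x * g' x + f' x * g x) = 0.
  rewrite /intT.
  rewrite [RHS](_ : 0 = f (2 * pi) * g (2 * pi) - f 0 * g 0); last first.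
    by have := pf 0; have := pg 0; rewrite !add0r => -> ->; rewrite subrr.
  apply: (@Rint_FTC _ (fun x => f x * g x)); first exact: twopi_ge0.
  - by apply: cont_add; exact: cont_mul.
  - exact: cont_mul.
  - move=> x _ _; have d := is_deriveM (df x) (dg x).
    by apply: (is_derive_eq d); rewrite /GRing.scale /=; ring.
rewrite !intT_prim primD; [|exact: cont_mul..].
by move=> /eqP; rewrite addr_eq0 => /eqP.
Qed.

Lemma cosD_int2pi (z : int) (y : R) : cos (y + z%:~R * (2 * pi)) = cos y.
Proof.
have cn (n : nat) u : cos (u + n%:R * (2 * pi)) = cos u :> R.
  elim: n u => [|n IH] u; first by rewrite mul0r addr0.
  rewrite -natr1 mulrDl mul1r addrA.
  by rewrite [X in _ + X]mulr_natl cosD2pi.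
case: z => n; first by rewrite -pmulrn; exact: cn.
rewrite NegzE intrN mulNr -(cn n.+1 (y - _)) -pmulrn subrK//.
Qed.

Lemma sinD_int2pi (z : int) (y : R) : sin (y + z%:~R * (2 * pi)) = sin y.
Proof. by rewrite -!cosBpihalf addrAC cosD_int2pi. Qed.

Lemma cont_bounded f : continuous f ->
  exists2 M, 0 <= M & forall x, 0 <= x <= 2 * pi -> `|f x| <= M.
Proof.
move=> cf; have [M M0 MP] := cont2_bounded 0 0 (cont2_snd cf).
by exists M => // x; apply: (MP 0); rewrite lexx.
Qed.

Lemma mode_cont (z : int) (h : R) : continuous (fun x : R => cos (z%:~R * x + h)).
Proof.
move=> x; apply: continuous_comp; last exact: continuous_cos.
by apply: cvgD; [exact: mulrl_continuous|exact: cvg_cst].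
Qed.

Lemma smode_cont (z : int) (h : R) : continuous (fun x : R => sin (z%:~R * x + h)).
Proof.
move=> x; apply: continuous_comp; last exact: continuous_sin.
by apply: cvgD; [exact: mulrl_continuous|exact: cvg_cst].
Qed.

Lemma intT_cos_mode (z : int) (h : R) :
  intT (fun x => cos (z%:~R * x + h)) = (z == 0)%:R * (2 * pi) * cos h.
Proof.
have [->|z0] := eqVneq z 0.
  rewrite mul1r; under eq_fun do rewrite mulr0z mul0r add0r.
  rewrite /intT Rintegral_cst//= lebesgue_measure_itv/= lte_fin mulr_gt0 ?pi_gt0//=.
  by rewrite subr0 mulrC.
rewrite !mul0r; have zn : z%:~R != 0 :> R by rewrite intr_eq0.
have d (x : R) : is_derive x 1 (fun x => z%:~R^-1 * sin (z%:~R * x + h)) (cos (z%:~R * x + h)).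
  have d1 := is_deriveD (is_deriveZ (z%:~R : R) (is_derive_id x 1)) (is_derive_cst h x 1).
  have d2 := is_deriveZ (z%:~R^-1 : R) (@is_derive1_comp _ sin _ x _ _ (is_derive_sin _) d1).
  by apply: (is_derive_eq d2); rewrite addr0 /GRing.scale /= mulr1 mulrCA mulVf// mulr1.
rewrite /intT [RHS](_ : 0 = z%:~R^-1 * sin (z%:~R * (2 * pi) + h) - z%:~R^-1 * sin (z%:~R * 0 + h)).
  apply: (@Rint_FTC _ (fun x => z%:~R^-1 * sin (z%:~R * x + h))) => //.
  - exact: twopi_ge0.
  - exact: mode_cont.
  - exact: derive_cont d.
by rewrite (_ : z%:~R * (2 * pi) + h = h + z%:~R * (2 * pi)) ?sinD_int2pi ?mulr0 ?add0r ?subrr// addrC.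
Qed.

Lemma intT_sin_mode (z : int) (h : R) :
  intT (fun x => sin (z%:~R * x + h)) = (z == 0)%:R * (2 * pi) * sin h.
Proof.
under eq_fun do rewrite -cosBpihalf -addrA.
by rewrite intT_cos_mode cosBpihalf.
Qed.

Lemma cosn_cont (n : int) : continuous (fun x : R => cos (n%:~R * x)).
Proof.
rewrite (_ : (fun x => _) = fun x => cos (n%:~R * x + 0)); first exact: mode_cont.
by apply/funext => x; rewrite addr0.
Qed.

Lemma sinn_cont (n : int) : continuous (fun x : R => sin (n%:~R * x)).
Proof.
rewrite (_ : (fun x => _) = fun x => sin (n%:~R * x + 0)); first exact: smode_cont.
by apply/funext => x; rewrite addr0.
Qed.

End TwoVariables.

(** * Limits under the integral sign *)

Section Convergence.
Variable R : realType.
Local Notation mu := (@lebesgue_measure R).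

Lemma Rint_cvg (D : set R) (fn : nat -> R -> R) (f g : R -> R) : measurable D ->
  (forall n, measurable_fun D (fn n)) ->
  (forall x, D x -> fn n x @[n --> \oo] --> f x) ->
  mu.-integrable D (EFin \o g) ->
  (forall n x, D x -> `|fn n x| <= g x) ->
  Rintegral mu D (fn n) @[n --> \oo] --> Rintegral mu D f.
Proof.
move=> mD mf cf ig fg.
have mf' n : measurable_fun D (EFin \o fn n) by apply/measurable_EFinP.
have cf' x : D x -> (EFin \o fn n) x @[n --> \oo] --> (EFin \o f) x.
  by move=> Dx; apply: cvg_EFin; [exact: nearW|exact: cf].
have mfl : measurable_fun D (EFin \o f) by apply: emeasurable_fun_cvg mf' cf'.
have a1 : {ae mu, forall x, D x -> (fun n => (EFin \o fn n) x) @ \oo --> (EFin \o f) x}.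
  exact: aeW.
have a2 : {ae mu, forall x n, D x -> (`|(EFin \o fn n) x| <= (EFin \o g) x)%E}.
  by apply: aeW => x n Dx; exact: fg.
have [i1 _ c1] := @dominated_convergence _ _ _ mu D mD (fun n => EFin \o fn n) (EFin \o f) (EFin \o g)
  mf' mfl a1 ig a2.
apply: fine_cvg; rewrite fineK//.
exact: integrable_fin_num.
Qed.

Lemma intT_cvg (fn : nat -> R -> R) (f : R -> R) (M : R) :
  (forall n, continuous (fn n)) ->
  (forall x, fn n x @[n --> \oo] --> f x) ->
  (forall n x, 0 <= x <= 2 * pi -> `|fn n x| <= M) ->
  intT (fn n) @[n --> \oo] --> intT f.
Proof.
move=> cf cv b; apply: (@Rint_cvg _ _ _ (fun=> M)) => //.
- by move=> n; apply: measurable_funTS; exact: continuous_measurable_fun.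
- by apply: cont_integrable => x; exact: cvg_cst.
Qed.

Lemma le_intT (f : R -> R) (M : R) : continuous f ->
  (forall x, 0 <= x <= 2 * pi -> `|f x| <= M) -> `|intT f| <= 2 * pi * M.
Proof.
move=> cf fM; rewrite intT_prim (le_trans (prim_norm _ cf))//.
apply: (@le_trans _ _ (prim (fun=> M) (2 * pi))).
  apply: prim_le; [exact: cont_norm|by move=> x; exact: cvg_cst|].
  by move=> s s0 s1; apply: fM; rewrite s0.
rewrite /prim Rintegral_cst//= lebesgue_measure_itv/= lte_fin.
by rewrite mulr_gt0 ?pi_gt0//= subr0 mulrC.
Qed.

Lemma dblint_cvg (t : R) (fn : nat -> R -> R -> R) (F : R -> R -> R) (G : R -> R) :
  (forall n s, continuous (fn n s)) ->
  (forall n, measurable_fun setT (fun s => intT (fn n s))) ->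
  (forall s x, fn n s x @[n --> \oo] --> F s x) ->
  mu.-integrable `[0, t] (EFin \o G) ->
  (forall n s x, 0 <= s <= t -> 0 <= x <= 2 * pi -> `|fn n s x| <= G s) ->
  dblint t (fn n) @[n --> \oo] --> dblint t F.
Proof.
move=> cf mf cv iG b; apply: (@Rint_cvg _ _ _ (fun s => 2 * pi * G s)) => //.
- by move=> n; exact: measurable_funTS.
- move=> s /=; rewrite in_itv => st.
  by apply: (@intT_cvg _ _ (G s)) => // n x; exact: b.
- rewrite (_ : EFin \o _ = fun s => ((2 * pi)%:E * (EFin \o G) s)%E); last by apply/funext => s; rewrite /= EFinM.
  exact: integrableZl.
- by move=> n s /=; rewrite in_itv => st; apply: le_intT => // x; exact: b.
Qed.

Lemma prim_ae (f g : R -> R) (t : R) : measurable_fun setT f -> measurable_fun setT g ->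
  {ae mu, forall s, s \in `[0, t] -> f s = g s} -> prim f t = prim g t.
Proof.
move=> mf mg fg; congr fine; apply: ae_eq_integral => //.
- by apply/measurable_EFinP; exact: measurable_funTS.
- by apply/measurable_EFinP; exact: measurable_funTS.
- apply: (@filterS _ _ (ae_filter_ringOfSetsType mu) _ _ _ fg) => s fgs /= st; by rewrite fgs.
Qed.

(** No measurability is asked: the integral of a nonnegative function is a supremum over the simple
    functions below it, hence monotone. It is applied to the norms of the solution as functions of
    time. *)
Lemma ge0_le_integral_nm (D : set R) (f g : R -> \bar R) :
  (forall x, D x -> (0 <= f x)%E) -> (forall x, D x -> (f x <= g x)%E) ->
  (\int[mu]_(x in D) f x <= \int[mu]_(x in D) g x)%E.
Proof.
move=> f0 fg; rewrite !ge0_integralE//; last by move=> x Dx; apply: le_trans (f0 x Dx) (fg x Dx).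
apply: le_ereal_sup => _ [h hf <-]; exists h => // x.
apply: le_trans (hf x) _; rewrite /patch; case: ifPn => // /set_mem; exact: fg.
Qed.

(** The increments of u + v are nonnegative, so u + v is nondecreasing and bounded, and u is a
    difference of two convergent sequences. *)
Lemma cvgn_dist (u v : R ^nat) :
  (forall k l, (k <= l)%N -> `|u l - u k| <= v l - v k) -> cvgn v -> cvgn u.
Proof.
move=> uv cv.
have nv : {homo v : n m / (n <= m)%N >-> n <= m}.
  by move=> k l kl; rewrite -subr_ge0 (le_trans _ (uv _ _ kl)).
have vl n : v n <= limn v by apply: nondecreasing_cvgn_le.
have -> : u = (fun n => (u n + v n) - v n) by apply/funext => n; rewrite addrK.
apply: is_cvgB => //; apply: nondecreasing_is_cvgn.
  move=> k l kl; have := uv _ _ kl; rewrite ler_norml => /andP[]; lra.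
exists (u 0 - v 0 + limn v + limn v) => _ [n _ <-].
by have := uv 0 n (leq0n n); rewrite ler_norml => /andP[]; have := vl n; lra.
Qed.

End Convergence.

(** * Uniqueness of Fourier coefficients *)

Section FourierUniqueness.
Variable R : realType.
Local Notation mu := (@lebesgue_measure R).
Implicit Types (f g F : R -> R) (n : int).

Lemma integrable_mul_cont g f : mu.-integrable `[0, 2 * pi] (EFin \o g) -> continuous f ->
  mu.-integrable `[0, 2 * pi] (EFin \o (fun x => g x * f x)).
Proof.
move=> ig cf.
have mf : measurable_fun `[0, 2 * pi] f.
  by apply: measurable_funTS; exact: continuous_measurable_fun.
have -> : EFin \o (fun x => g x * f x) = ((EFin \o g) \* (EFin \o f))%E by [].
apply: integrableMl => //.
have [M M0 MP] := cont_bounded cf; exists M; split; first exact: num_real.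
by move=> y My x /=; rewrite in_itv/= => xI; apply: le_trans (ltW My); exact: MP.
Qed.

Lemma expr_cont f N : continuous f -> continuous (fun x => f x ^+ N).
Proof. move=> cf; elim: N => [|N IH]; first by move=> x; exact: cvg_cst.
by under eq_fun do rewrite exprS; exact: cont_mul. Qed.

(* Convolution with the trigonometric kernel [(1 + cos z) ^ N cos (n z + h)]; as [N] grows the
   kernel [(1 + cos z) ^ N] concentrates at [0]. *)
Definition conv f N n h x : R :=
  intT (fun y => f y * (1 + cos (x - y)) ^+ N * cos (n%:~R * (x - y) + h)).

Lemma cosB_cont n h (x : R) : continuous (fun y => cos (n%:~R * (x - y) + h)).
Proof.
have -> : (fun y => cos (n%:~R * (x - y) + h)) =
    (fun y => cos ((- n)%:~R * y + (n%:~R * x + h))).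
  by apply/funext => y; congr cos; rewrite intrN; ring.
exact: mode_cont.
Qed.

Lemma cosB1_cont (x : R) : continuous (fun y => 1 + cos (x - y)).
Proof.
have -> : (fun y => 1 + cos (x - y)) = (fun y => 1 + cos (1%:~R * (x - y) + 0)).
  by apply/funext => y; rewrite mul1r addr0.
by apply: cont_add; [move=> y; exact: cvg_cst|exact: cosB_cont].
Qed.

Lemma conv_int_cont f N n h x : continuous f ->
  continuous (fun y => f y * (1 + cos (x - y)) ^+ N * cos (n%:~R * (x - y) + h)).
Proof.
move=> cf; apply: cont_mul; last exact: cosB_cont.
by apply: cont_mul => //; apply: expr_cont; exact: cosB1_cont.
Qed.

(** Product to sum: [cos z cos (n z + h)] is half the sum of the modes n + 1 and n - 1. *)
Lemma conv_rec f N n h x : continuous f -> conv f N.+1 n h x =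
  conv f N n h x + (2^-1 * conv f N (n + 1) h x + 2^-1 * conv f N (n - 1) h x).
Proof.
move=> cf; rewrite /conv !intT_prim -!primZ; [|exact: conv_int_cont..].
have c m := @conv_int_cont f N m h x cf.
have c' m := @cont_scale _ 2^-1 _ (c m).
rewrite -(primD _ (c' _) (c' _)) -primD//; last exact: cont_add.
congr prim; apply/funext => y; rewrite exprS.
have -> : (n + 1)%:~R * (x - y) + h = (n%:~R * (x - y) + h) + (x - y) :> R by rewrite intrD; ring.
have -> : (n - 1)%:~R * (x - y) + h = (n%:~R * (x - y) + h) - (x - y) :> R by rewrite intrB; ring.
rewrite (cosD (_ + h)) (cosB (_ + h)); by field.
Qed.

(** By the recursion in N, convolution with the kernel lies in the span of the convolutions with
    single modes (N = 0), so linear properties need checking only there. *)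
Lemma conv_ind f (P : (R -> R) -> Prop) : continuous f ->
  (forall n h, P (conv f 0 n h)) ->
  (forall F G, P F -> P G -> P (fun x => F x + G x)) ->
  (forall c F, P F -> P (fun x => c * F x)) ->
  forall N n h, P (conv f N n h).
Proof.
move=> cf P0 PD PZ; elim => [|N IH] n h; first exact: P0.
have -> : conv f N.+1 n h = fun x =>
  conv f N n h x + (2^-1 * conv f N (n + 1) h x + 2^-1 * conv f N (n - 1) h x).
  by apply/funext => x; exact: conv_rec.
by apply: (PD) => //; apply: (PD); exact: PZ.
Qed.

Lemma conv0E f n h x : continuous f -> conv f 0 n h x =
  intT (fun y => f y * cos ((- n)%:~R * y + h)) * cos (n%:~R * x) +
  (- intT (fun y => f y * sin ((- n)%:~R * y + h))) * sin (n%:~R * x).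
Proof.
move=> cf; rewrite mulNr ![intT _ * _]mulrC -mulNr.
have c1 : continuous (fun y => f y * cos ((- n)%:~R * y + h)).
  by apply: cont_mul => //; exact: mode_cont.
have c2 : continuous (fun y => f y * sin ((- n)%:~R * y + h)).
  by apply: cont_mul => //; exact: smode_cont.
rewrite /conv !intT_prim -!primZ// -primD; [|exact: cont_scale..].
congr prim; apply/funext => y; rewrite expr0 mulr1.
have -> : n%:~R * (x - y) + h = n%:~R * x + ((- n)%:~R * y + h) :> R by rewrite intrN; ring.
by rewrite cosD; ring.
Qed.

Definition ker N (x : R) : R := intT (fun y => (1 + cos (x - y)) ^+ N).

(** Translation invariance over a period, obtained from the convolution of f = 1: for N = 0 nonzero
    modes integrate to zero and the mode zero is constant. *)
Lemma ker_cst N x : ker N x = ker N 0.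
Proof.
have c1 : continuous (fun _ : R => 1 : R) by move=> y; exact: cvg_cst.
have E z : ker N z = conv (fun _ : R => 1) N 0 0 z.
  by congr intT; apply/funext => y; rewrite mul0r addr0 cos0 mulr1 mul1r.
rewrite !E; apply: (@conv_ind (fun _ : R => 1) (fun F => forall x, F x = F 0) c1) => {x}.
- move=> n h x; rewrite !conv0E//.
  have [->|n0] := eqVneq n 0; first by rewrite !mul0r.
  under eq_fun do rewrite mul1r; rewrite intT_cos_mode oppr_eq0 (negbTE n0) !mul0r.
  under [in LHS]eq_fun do rewrite mul1r.
  under [in RHS]eq_fun do rewrite mul1r.
  by rewrite intT_sin_mode oppr_eq0 (negbTE n0) !(mul0r, oppr0).
- by move=> F G hF hG x; rewrite hF hG.
- by move=> c F hF x; rewrite hF.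
Qed.

Lemma ker0E N : ker N 0 = intT (fun y => (1 + cos y) ^+ N).
Proof. by congr intT; apply/funext => y; rewrite sub0r cosN. Qed.

Lemma cos1_cont : continuous (fun y : R => 1 + cos y).
Proof. by apply: cont_add; [move=> y; exact: cvg_cst|exact: continuous_cos]. Qed.

(** Wallis-type recursion: integrate [cos y (1 + cos y)^N] by parts, then use
    [sin^2 = (1 - cos) (1 + cos)]. *)
Lemma ker_rec N : N.+1%:R * ker N.+1 0 = (2 * N%:R + 1) * ker N 0.
Proof.
rewrite !ker0E.
have cc := cos1_cont.
have cp k := @expr_cont _ k cc.
have csin : continuous (@sin R) by exact: continuous_sin.
have ccos : continuous (@cos R) by exact: continuous_cos.
have d (x : R) : is_derive x 1 (fun y => (1 + cos y) ^+ N) (- (N%:R * (1 + cos x) ^+ N.-1 * sin x)).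
  have d1 : is_derive x 1 (fun y : R => 1 + cos y) (- sin x).
    by apply: (is_derive_eq (is_deriveD (is_derive_cst (1 : R) x 1) (is_derive_cos x))); rewrite add0r.
  have -> : (fun y : R => (1 + cos y) ^+ N) = (fun y : R => 1 + cos y) ^+ N.
    by apply/funext => y; rewrite exprfctE.
  apply: (is_derive_eq (is_deriveX N d1)).
  by rewrite /GRing.scale /=; ring.
have c1 : continuous (fun x : R => - (N%:R * (1 + cos x) ^+ N.-1 * sin x)).
  move=> x; apply: cvgN; apply: (cont_mul (f := fun x => N%:R * (1 + cos x) ^+ N.-1)) => //.
  by apply: cont_scale.
have ps : periodic2pi (@sin R) by move=> x; rewrite mulr_natl sinD2pi.
have pc : periodic2pi (fun y : R => (1 + cos y) ^+ N) by move=> x; rewrite mulr_natl cosD2pi.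
have := intT_ibp (@is_derive_sin R) d ccos c1 ps pc.
have -> : intT (fun x : R => sin x * - (N%:R * (1 + cos x) ^+ N.-1 * sin x)) =
    intT (fun x => N%:R * (1 + cos x) ^+ N.+1 + (- (2 * N%:R)) * (1 + cos x) ^+ N).
  (* For N = 0 the truncated predecessor [N.-1] is harmless because of the factor N. *)
  congr intT; apply/funext => x; case: N {d c1 pc} => [|N] /=; first by ring.
  rewrite [LHS](_ : _ = - (N.+1%:R * (1 + cos x) ^+ N) * sin x ^+ 2); last by ring.
  by rewrite sin2cos2 !exprS; ring.
have -> : intT (fun x : R => cos x * (1 + cos x) ^+ N) =
    intT (fun x => (1 + cos x) ^+ N.+1 + (-1) * (1 + cos x) ^+ N).
  by congr intT; apply/funext => x; rewrite exprS; ring.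
rewrite !intT_prim !primD ?primZ//; [|by apply: cont_scale..].
rewrite -natr1; lra.
Qed.

Lemma ker_gt0 N : 0 < ker N 0.
Proof.
elim: N => [|N IH].
  rewrite ker0E; under eq_fun do rewrite expr0.
  have p2 : 0 < 2 * pi :> R by rewrite mulr_gt0 ?pi_gt0.
  by rewrite /intT Rintegral_cst//= lebesgue_measure_itv/= lte_fin p2/= subr0 mul1r.
have h := ker_rec N.
by rewrite -(pmulr_rgt0 _ (ltr0Sn R N)) h mulr_gt0// ltr_wpDl// mulr_ge0.
Qed.

(** Since [1 - cos = 2 - (1 + cos)], the recursion evaluates this moment exactly; [1 / (N + 1)] is
    the rate at which the kernel concentrates. *)
Lemma ker_tail N x :
  intT (fun y => (1 - cos (x - y)) * (1 + cos (x - y)) ^+ N) = ker N 0 / N.+1%:R.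
Proof.
transitivity (2 * ker N x + (-1) * ker N.+1 x).
  rewrite /ker !intT_prim -!primZ; [|by apply: expr_cont; exact: cosB1_cont..].
  rewrite -primD; [|by apply: cont_scale; apply: expr_cont; exact: cosB1_cont..].
  by congr prim; apply/funext => y; rewrite exprS; ring.
rewrite !(ker_cst _ x); have h := ker_rec N; have n0 : N.+1%:R != 0 :> R by rewrite pnatr_eq0.
apply: (mulfI n0); rewrite [RHS]mulrCA divff// mulr1 mulrDr.
rewrite [X in _ + X]mulrCA h -natr1; ring.
Qed.

(** A modulus of continuity in terms of [1 - cos (x - y)], the quantity whose kernel mean is known.
    Lipschitz continuity handles points closer than d on the circle; for the others [1 - cos d] is a
    lower bound and C absorbs the largest value [L pi]. *)
Lemma periodic_modulus f f1 : (forall x : R, is_derive x 1 f (f1 x)) -> continuous f1 ->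
  periodic2pi f -> forall e, 0 < e -> exists2 C, 0 <= C &
  forall x y, 0 <= x <= 2 * pi -> 0 <= y <= 2 * pi -> `|f y - f x| <= e + C * (1 - cos (x - y)).
Proof.
move=> df cf1 pf e e0; have cf := derive_cont df.
have p0 := pi_gt0 R.
have [L L0 LP] : exists2 L, 0 < L & forall x, - (2 * pi) <= x <= 2 * pi -> `|f1 x| <= L.
  have cK : compact (`[- (2 * pi), 2 * pi] : set R) by exact: segment_compact.
  have := compact_bounded (continuous_compact (continuous_subspaceT cf1) cK).
  case=> M [_ MP]; exists (`|M| + 1) => [|x xI]; first by rewrite ltr_wpDl.
  apply: (MP (`|M| + 1)); first by rewrite (le_lt_trans (ler_norm M))// ltrDl.
  by exists x => //; rewrite /= in_itv.
have lip a b : - (2 * pi) <= a -> a <= b -> b <= 2 * pi -> `|f b - f a| <= L * (b - a).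
  move=> a1 ab b1; have [|c] := MVT_segment ab (fun x _ => df x).
    exact: continuous_subspaceT.
  rewrite in_itv/= => /andP[ac cb] ->.
  rewrite normrM (ger0_norm (x := b - a)) ?subr_ge0// ler_wpM2r ?subr_ge0//.
  by apply: LP; rewrite (le_trans a1 ac) (le_trans cb b1).
pose d := Num.min (e / L) pi.
have d0 : 0 < d by rewrite lt_min divr_gt0.
have dpi : d <= pi by rewrite ge_min lexx orbT.
have cd : 0 < 1 - cos d.
  rewrite subr_gt0 -[ltRHS](@cos0 R) ltr_cos// in_itv/= ?lexx ?(ltW p0)//.
  by rewrite (ltW d0).
pose C := L * pi / (1 - cos d).
have C0 : 0 <= C by rewrite divr_ge0 ?mulr_ge0 ?(ltW L0) ?(ltW p0) ?(ltW cd).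
have near0 u : 0 <= u <= pi -> L * u <= e + C * (1 - cos u).
  move=> /andP[u0 upi]; have [ud|du] := leP u d.
    apply: (@le_trans _ _ e).
      rewrite mulrC -ler_pdivlMr// (le_trans ud)// ge_min lexx//.
    by rewrite lerDl mulr_ge0// subr_ge0 cos_le1.
  apply: (@le_trans _ _ (C * (1 - cos d))).
    by rewrite /C divfK ?lt0r_neq0// ler_pM2l.
  apply: (@le_trans _ _ (C * (1 - cos u))); last by rewrite lerDr ltW.
  rewrite ler_wpM2l// lerD2l lerN2 ltW// ltr_cos// in_itv/=.
  - by rewrite (ltW d0).
  - by rewrite u0.
exists C => // x y.
wlog xy : x y / x <= y => [th|] x2 y2.
  have [|/ltW] := leP x y; first by move=> h; exact: th.
  by move=> h; rewrite distrC -cosN opprB; exact: th.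
rewrite -cosN opprB; move: x2 y2 => /andP[x0 x2] /andP[y0 y2].
have [h|h] := leP (y - x) pi.
  apply: (@le_trans _ _ (L * (y - x))); first by apply: lip => //; lra.
  by apply: near0; rewrite subr_ge0 xy.
(* Points more than pi apart on the line are closer than pi on the circle: y is moved back by one
   period, which is why the Lipschitz bound starts at [- 2 pi]. *)
have -> : f y = f (y - 2 * pi) by rewrite -[in LHS](subrK (2 * pi) y) pf.
have -> : cos (y - x) = cos (x - (y - 2 * pi)).
  by rewrite -cosN -(cosD_int2pi 1 (- _)); congr cos; rewrite mul1r; ring.
rewrite distrC.
apply: (@le_trans _ _ (L * (x - (y - 2 * pi)))); first by apply: lip; lra.
by apply: near0; apply/andP; split; lra.
Qed.

(** Average the modulus of continuity against the kernel: e keeps the full mass, the [1 - cos] part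
    only the fraction [1 / (N + 1)] of it. *)
Lemma conv_approx f e C N x : continuous f -> 0 <= x <= 2 * pi ->
  (forall x y, 0 <= x <= 2 * pi -> 0 <= y <= 2 * pi -> `|f y - f x| <= e + C * (1 - cos (x - y))) ->
  `|conv f N 0 0 x - ker N 0 * f x| <= ker N 0 * (e + C / N.+1%:R).
Proof.
move=> cf xI fe.
have ck := @expr_cont _ N (@cosB1_cont x).
have c1 : continuous (fun y => 1 - cos (x - y)).
  have -> : (fun y => 1 - cos (x - y)) = (fun y => 2 + (-1) * (1 + cos (x - y))).
    by apply/funext => y; ring.
  by apply: cont_add; [move=> y; exact: cvg_cst|apply: cont_scale; exact: cosB1_cont].
have c2 := cont_mul c1 ck.
have c3 := cont_mul cf ck.
have -> : conv f N 0 0 x - ker N 0 * f x = prim (fun y => (f y - f x) * (1 + cos (x - y)) ^+ N) (2 * pi).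
  rewrite -(ker_cst N x) mulrC -mulNr /ker /conv !intT_prim -primZ//.
  rewrite -primD; [|exact: conv_int_cont|exact: cont_scale].
  by congr prim; apply/funext => y; rewrite mul0r add0r cos0; ring.
have -> : ker N 0 * (e + C / N.+1%:R) =
    prim (fun y => e * (1 + cos (x - y)) ^+ N + C * ((1 - cos (x - y)) * (1 + cos (x - y)) ^+ N)) (2 * pi).
  rewrite primD ?primZ//; [|exact: cont_scale..].
  by rewrite -!intT_prim ker_tail -/(ker N x) ker_cst; ring.
have cd : continuous (fun y => (f y - f x) * (1 + cos (x - y)) ^+ N).
  apply: cont_mul => //; apply: cont_add => // y; exact: cvg_cst.
apply: le_trans (prim_norm _ cd) _; apply: prim_le.
- exact: cont_norm.
- by apply: cont_add; exact: cont_scale.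
move=> y y0 y2.
have k0 : 0 <= 1 + cos (x - y) by have := cos_geN1 (x - y); lra.
rewrite normrM (ger0_norm (exprn_ge0 N k0)) mulrA -mulrDl ler_wpM2r ?exprn_ge0//.
by apply: fe => //; rewrite y0.
Qed.

(** As g annihilates all modes, it annihilates the trigonometric polynomials [conv f N 0 0]. Divided
    by the mass of the kernel, these approach f uniformly, which suffices for a merely integrable
    g. *)
Lemma fourier_uniq g f f1 : mu.-integrable `[0, 2 * pi] (EFin \o g) ->
  (forall n, intT (fun x => g x * cos (n%:~R * x)) = 0) ->
  (forall n, intT (fun x => g x * sin (n%:~R * x)) = 0) ->
  (forall x : R, is_derive x 1 f (f1 x)) -> continuous f1 -> periodic2pi f ->
  intT (fun x => g x * f x) = 0.
Proof.
move=> ig gc gs df cf1 pf; have cf := derive_cont df.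
have IM := integrable_mul_cont ig.
have [cvc gcv] : (forall N, continuous (conv f N 0 0)) /\
    (forall N, intT (fun x => g x * conv f N 0 0 x) = 0).
  suff H : forall N n h, continuous (conv f N n h) /\ intT (fun x => g x * conv f N n h x) = 0.
    by split => N; have [] := H N 0 0.
  apply: (@conv_ind f (fun F => continuous F /\ intT (fun x => g x * F x) = 0)) => //.
  - move=> n h; set A := intT (fun y => f y * cos ((- n)%:~R * y + h)).
    set B := - intT (fun y => f y * sin ((- n)%:~R * y + h)).
    have cc : continuous (fun x : R => cos (n%:~R * x)).
      exact: cosn_cont.
    have cs : continuous (fun x : R => sin (n%:~R * x)).
      exact: sinn_cont.
    have -> : conv f 0 n h = fun x => A * cos (n%:~R * x) + B * sin (n%:~R * x).
      by apply/funext => x; exact: conv0E.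
    split; first by apply: cont_add; exact: cont_scale.
    transitivity (intT (fun x => A * (g x * cos (n%:~R * x)) + B * (g x * sin (n%:~R * x)))).
      by congr intT; apply/funext => x; ring.
    have iZ (c : R) F : continuous F ->
      mu.-integrable `[0, 2 * pi] (EFin \o (fun x => c * (g x * F x))).
      move=> cF; have -> : (fun x => c * (g x * F x)) = (fun x => g x * (c * F x)).
        by apply/funext => x; ring.
      by apply: IM; exact: cont_scale.
    rewrite /intT RintegralD//; [|exact: iZ..].
    rewrite !RintegralZl//; [|exact: IM..].
    by have := gc n; have := gs n; rewrite /intT => -> ->; rewrite !mulr0 addr0.
  - move=> F G [cF gF] [cG gG]; split; first exact: cont_add.
    transitivity (intT (fun x => g x * F x + g x * G x)).
      by congr intT; apply/funext => x; ring.
    rewrite /intT RintegralD//; [|exact: IM..].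
    by move: gF gG; rewrite /intT => -> ->; rewrite addr0.
  - move=> c F [cF gF]; split; first exact: cont_scale.
    transitivity (intT (fun x => c * (g x * F x))).
      by congr intT; apply/funext => x; ring.
    rewrite /intT RintegralZl//; last exact: IM.
    by move: gF; rewrite /intT => ->; rewrite mulr0.
set I := intT _; pose G := intT (fun x => `|g x|).
have ign : mu.-integrable `[0, 2 * pi] (EFin \o (fun x => `|g x|)).
  exact: integrable_norm.
have G0 : 0 <= G by apply: Rintegral_ge0.
suff H e : 0 < e -> `|I| <= e * G + e.
  apply/eqP; rewrite -normr_le0; apply/ler_addgt0Pl => e e0; rewrite addr0.
  have G1 : 0 < G + 1 by rewrite ltr_wpDl.
  apply: le_trans (H (e / (G + 1)) (divr_gt0 e0 G1)) _.
  by rewrite -{2}(mulr1 (e / _)) -mulrDr divfK// lt0r_neq0.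
move=> e0; have [C C0 fe] := periodic_modulus df cf1 pf e0.
(* N is so large that the concentration error, integrated against [|g|], is at most e. *)
have [N NP] : exists N : nat, C / N.+1%:R * G <= e.
  exists (Num.truncn (C * G / e)); rewrite mulrAC ler_pdivrMr// [leRHS]mulrC -ler_pdivrMr//.
  by rewrite ltW// truncnS_gt.
have J0 := ker_gt0 N.
have iJ : mu.-integrable `[0, 2 * pi] (EFin \o (fun x => g x * (ker N 0 * f x))).
  by apply: IM; exact: cont_scale.
have E : ker N 0 * I = - intT (fun x => g x * (conv f N 0 0 x - ker N 0 * f x)).
  have -> : intT (fun x => g x * (conv f N 0 0 x - ker N 0 * f x)) =
      intT (fun x => g x * conv f N 0 0 x + (- ker N 0) * (g x * f x)).
    by congr intT; apply/funext => x; ring.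
  rewrite /intT RintegralD//; [|exact: IM|].
    rewrite RintegralZl//; last exact: IM.
    by have := gcv N; rewrite /intT => ->; rewrite add0r mulNr opprK.
  have -> : (fun x => - ker N 0 * (g x * f x)) = (fun x => g x * (- ker N 0 * f x)).
    by apply/funext => x; ring.
  by apply: IM; exact: cont_scale.
rewrite -(ler_pM2l J0) -{1}(gtr0_norm J0) -normrM E normrN.
have cd : continuous (fun x => conv f N 0 0 x - ker N 0 * f x).
  have -> : (fun x => conv f N 0 0 x - ker N 0 * f x) = (fun x => conv f N 0 0 x + (- ker N 0) * f x).
    by apply/funext => x; rewrite mulNr.
  by apply: cont_add => //; exact: cont_scale.
apply: le_trans (le_normr_Rintegral _ (IM _ cd)) _ => //.
apply: (@le_trans _ _ (Rintegral mu `[0, 2 * pi] (fun x => ker N 0 * (e + C / N.+1%:R) * `|g x|))).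
  apply: le_Rintegral => //.
  - exact: integrable_norm (IM _ cd).
  - have -> : (fun x => ker N 0 * (e + C / N.+1%:R) * `|g x|) = (fun x => `|g x| * (ker N 0 * (e + C / N.+1%:R))).
      by apply/funext => x; rewrite mulrC.
    by apply: integrable_mul_cont => // x; exact: cvg_cst.
  move=> x /=; rewrite in_itv => xI; rewrite normrM mulrC ler_wpM2r//.
  exact: conv_approx.
rewrite RintegralZl// -/(intT _) -/G -mulrA ler_wpM2l ?(ltW J0)//.
by rewrite mulrDl lerD2l.
Qed.

End FourierUniqueness.

(** * Fourier coefficients of a real function *)

Section FourierCoefficients.
Variable R : realType.
Local Notation mu := (@lebesgue_measure R).
Implicit Types g h f : R -> R.

(** The arc cosine fixes the angle up to sign, and the sign of y chooses it. *)
Lemma polar_form (x y : R) : exists a,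
  x = Num.sqrt (x ^+ 2 + y ^+ 2) * cos a /\ y = Num.sqrt (x ^+ 2 + y ^+ 2) * sin a.
Proof.
set r := Num.sqrt _; have r2 : r ^+ 2 = x ^+ 2 + y ^+ 2.
  by rewrite sqr_sqrtr// addr_ge0 ?sqr_ge0.
have [r0|r0] := eqVneq r 0.
  exists 0; rewrite r0 !mul0r; move: r2; rewrite r0 expr0n /=.
  move=> /esym/eqP; rewrite paddr_eq0 ?sqr_ge0// !sqrf_eq0.
  by move=> /andP[/eqP -> /eqP ->].
have rp : 0 < r by rewrite lt_def r0 sqrtr_ge0.
have xr : x = r * (x / r) by rewrite mulrCA divff// mulr1.
have d1 : (x / r) ^+ 2 + (y / r) ^+ 2 = 1.
  by rewrite !expr_div_n -mulrDl -r2 divff// sqrf_eq0.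
have c1 : -1 <= x / r <= 1.
  rewrite -ler_norml -(@ler_pXn2r _ 2) ?nnegrE// expr1n -normrX ger0_norm ?sqr_ge0//.
  by rewrite -d1 lerDl sqr_ge0.
have sE : sin (acos (x / r)) = `|y / r|.
  by rewrite sin_acos// -d1 addrAC subrr add0r sqrtr_sqr.
have cE : cos (acos (x / r)) = x / r by rewrite acosK// in_itv.
have yr : y = r * (y / r) by rewrite mulrCA divff// mulr1.
have [y0|y0] := leP 0 (y / r).
  by exists (acos (x / r)); rewrite cE sE ger0_norm// -xr -yr.
by exists (- acos (x / r)); rewrite cosN sinN cE sE ltr0_norm// opprK -xr -yr.
Qed.

Lemma fcoef_reN g n : fcoef_re g (- n) = fcoef_re g n.
Proof.
by congr (_ * _); congr intT; apply/funext => x; rewrite intrN mulNr cosN.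
Qed.

Lemma intT_sinN g n : mu.-integrable `[0, 2 * pi] (EFin \o g) ->
  intT (fun x => g x * sin ((- n)%:~R * x)) = - intT (fun x => g x * sin (n%:~R * x)).
Proof.
move=> ig; transitivity (intT (fun x => (-1) * (g x * sin (n%:~R * x)))).
  by congr intT; apply/funext => x; rewrite mulN1r intrN mulNr sinN mulrN.
rewrite /intT RintegralZl ?mulN1r//.
by apply: integrable_mul_cont => //; exact: sinn_cont.
Qed.

Lemma fcoef_absN g n : mu.-integrable `[0, 2 * pi] (EFin \o g) ->
  fcoef_abs g (- n) = fcoef_abs g n.
Proof.
by move=> ig; rewrite /fcoef_abs fcoef_reN /fcoef_im intT_sinN// mulrN !sqrrN.
Qed.

(** The function is real, so the coefficients at m + 1 and - (m + 1) have the same modulus; these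
    frequencies are distinct, and the left side is a finite partial sum of the norm. *)
Lemma sum_fcoef_abs_le g (Z : R) k : mu.-integrable `[0, 2 * pi] (EFin \o g) ->
  (wnorm 0 0 g <= Z%:E)%E ->
  \sum_(0 <= m < k) (fcoef_abs g m.+1%:Z + fcoef_abs g m.+1%:Z) <= Z.
Proof.
move=> ig; rewrite -lee_fin; apply: le_trans.
pose s := [seq m.+1%:Z | m <- index_iota 0 k] ++ [seq - m.+1%:Z | m <- index_iota 0 k].
have us : uniq s.
  rewrite cat_uniq !map_inj_uniq ?iota_uniq ?andbT /=.
  - by apply/hasPn => _ /mapP[m _ ->]; apply/negP => /mapP[].
  - by move=> a b /oppr_inj [].
  - by move=> a b [].
apply: esum_ge; exists [set` s]; first by split => //; exact: finite_seq.
rewrite big_split/= EFinD -!sumEFin -fsbig_seq// big_cat/= !big_map.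
by apply: leeD; apply: lee_sum => m _; rewrite expr0 mul0r expR0 !mul1r ?fcoef_absN.
Qed.

(** Uniqueness applied to g - h. For real functions the nonnegative frequencies determine the others
    by parity, and the sine coefficient at 0 vanishes. *)
Lemma intT_coef_eq g h f f1 :
  mu.-integrable `[0, 2 * pi] (EFin \o g) -> mu.-integrable `[0, 2 * pi] (EFin \o h) ->
  (forall n : nat, fcoef_re g n = fcoef_re h n) ->
  (forall n : nat, fcoef_im g n.+1 = fcoef_im h n.+1) ->
  (forall x : R, is_derive x 1 f (f1 x)) -> continuous f1 -> periodic2pi f ->
  intT (fun x => g x * f x) = intT (fun x => h x * f x).
Proof.
move=> ig ih re im df cf1 pf.
have p0 : (2 * pi)^-1 != 0 :> R by rewrite invr_eq0 mulf_neq0// lt0r_neq0 ?pi_gt0.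
have igh : mu.-integrable `[0, 2 * pi] (EFin \o (g \- h)).
  exact: (integrableB _ ig ih).
have E k : continuous k -> intT (fun x => (g x - h x) * k x) =
    intT (fun x => g x * k x) - intT (fun x => h x * k x).
  move=> ck; rewrite -RintegralB//; [|exact: integrable_mul_cont..].
  by congr Rintegral; apply/funext => x; rewrite mulrBl.
have cn (n : nat) : intT (fun x => g x * cos (n%:~R * x)) = intT (fun x => h x * cos (n%:~R * x)).
  exact: (mulfI p0 (re n)).
have sn (n : nat) : intT (fun x => g x * sin (n%:~R * x)) = intT (fun x => h x * sin (n%:~R * x)).
  case: n => [|n]; last exact: (mulfI p0 (oppr_inj (im n))).
  by congr intT; apply/funext => x; rewrite mul0r sin0 !mulr0.
apply/eqP; rewrite -subr_eq0 -E; last exact: derive_cont df.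
apply/eqP; apply: (@fourier_uniq _ (g \- h) f f1) => // -[n|n].
- by rewrite E ?cn ?subrr//; exact: cosn_cont.
- under eq_fun do rewrite NegzE intrN mulNr cosN.
  by rewrite E ?cn ?subrr//; exact: cosn_cont.
- by rewrite E ?sn ?subrr//; exact: sinn_cont.
- by rewrite E ?NegzE ?intT_sinN ?sn ?subrr//; exact: sinn_cont.
Qed.

End FourierCoefficients.

(** * Interaction trees *)

(* [Leaf s m] is the Fourier mode of the datum at frequency [m + 1] or [- (m + 1)];
   a node is an interaction of its children through the quadratic, cubic or
   quartic part of the equation, the derivatives falling on the last child. *)
Inductive tree : Type :=
| Leaf of bool & nat
| Node2 of tree & tree
| Node3 of tree & tree & tree
| Node4 of tree & tree & tree & tree.

HB.instance Definition _ := gen_eqMixin tree.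

Fixpoint freq (a : tree) : int :=
  match a with
  | Leaf s m => if s then m.+1%:Z else - m.+1%:Z
  | Node2 b c => freq b + freq c
  | Node3 b c d => freq b + freq c + freq d
  | Node4 b c d e => freq b + freq c + freq d + freq e
  end.

(* Complex conjugation of modes: it flips the sign of every frequency and phase. *)
Fixpoint conjt (a : tree) : tree :=
  match a with
  | Leaf s m => Leaf (~~ s) m
  | Node2 b c => Node2 (conjt b) (conjt c)
  | Node3 b c d => Node3 (conjt b) (conjt c) (conjt d)
  | Node4 b c d e => Node4 (conjt b) (conjt c) (conjt d) (conjt e)
  end.

Definition pairs (f : seq tree) : seq (tree * tree) := [seq (a, b) | a <- f, b <- f].

Definition leaves (k : nat) : seq tree :=
  [seq Leaf s m | s <- [:: true; false], m <- iota 0 k].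

(* The trees contributing to the [k]-th Duhamel iterate of the datum truncated at frequency [k]. *)
Fixpoint forest (k : nat) : seq tree :=
  if k is k'.+1 then
    leaves k ++ [seq Node2 a b | a <- forest k', b <- forest k']
    ++ [seq Node3 p.1 p.2 c | p <- pairs (forest k'), c <- forest k']
    ++ [seq Node4 p.1 p.2 q.1 q.2 | p <- pairs (forest k'), q <- pairs (forest k')]
  else [::].

Arguments forest : simpl never.
Arguments leaves : simpl never.
Arguments pairs : simpl never.

Lemma forestS k : forest k.+1 =
  leaves k.+1 ++ [seq Node2 a b | a <- forest k, b <- forest k]
  ++ [seq Node3 p.1 p.2 c | p <- pairs (forest k), c <- forest k]
  ++ [seq Node4 p.1 p.2 q.1 q.2 | p <- pairs (forest k), q <- pairs (forest k)].
Proof. by []. Qed.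

Lemma freq_conjt a : freq (conjt a) = - freq a.
Proof.
elim: a => [[] m|b IHb c IHc|b IHb c IHc d IHd|b IHb c IHc d IHd e IHe] /=;
  rewrite ?opprK ?IHb ?IHc ?IHd ?IHe ?opprD//.
Qed.

Lemma mem_pairs (f : seq tree) p : (p \in pairs f) = (p.1 \in f) && (p.2 \in f).
Proof.
apply/allpairsP/andP => [[q [q1 q2 ->]]|[p1 p2]] //.
by exists p; rewrite -surjective_pairing.
Qed.

Lemma mem_leaves k a : (a \in leaves k) = if a is Leaf s m then (m < k)%N else false.
Proof.
rewrite /leaves; apply/allpairsP/idP => [[[s m] [_ mk ->]]|]; first by move: mk; rewrite mem_iota.
case: a => // s m mk; exists (s, m); split => //=; first by case: s.
by rewrite mem_iota.
Qed.

Lemma sum_leaves (V : nmodType) (G : tree -> V) k :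
  \sum_(a <- leaves k) G a =
  \sum_(0 <= m < k) (G (Leaf true m) + G (Leaf false m)).
Proof.
rewrite /leaves big_allpairs_dep !big_cons big_nil big_split /=.
by rewrite addr0 /index_iota subn0.
Qed.

Lemma uniq_leaves k : uniq (leaves k).
Proof.
apply: allpairs_uniq => //; first exact: iota_uniq.
by move=> [a b] [c d] _ _ /= [-> ->].
Qed.

#[local] Opaque leaves forest.

(** Without repetitions, inclusion of forests as sets is enough to compare sums over them. *)
Lemma uniq_forest k : uniq (forest k).
Proof.
elim: k => // k IH.
have up : uniq (pairs (forest k)) by apply: allpairs_uniq => // -[a b] [c d] _ _ /= [-> ->].
have uN2 : uniq [seq Node2 a b | a <- forest k, b <- forest k].
  by apply: allpairs_uniq => // -[a b] [c d] _ _ /= [-> ->].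
have uN3 : uniq [seq Node3 p.1 p.2 c | p <- pairs (forest k), c <- forest k].
  by apply: allpairs_uniq => // -[[a b] c] [[a' b'] c'] _ _ /= [-> -> ->].
have uN4 : uniq [seq Node4 p.1 p.2 q.1 q.2 | p <- pairs (forest k), q <- pairs (forest k)].
  by apply: allpairs_uniq => // -[[a b] [c d]] [[a' b'] [c' d']] _ _ /= [-> -> -> ->].
rewrite forestS cat_uniq uniq_leaves cat_uniq uN2 cat_uniq uN3 uN4 !andbT !andTb.
apply/and3P; split; apply/hasPn => x.
- rewrite mem_leaves !mem_cat => /or3P[H|H|H]; by have /allpairsP[p [_ _ ->]] := H.
- rewrite mem_cat => /orP[H|H]; have /allpairsP[p [_ _ ->]] := H;
    by apply/negP => /allpairsP[q [_ _]].
- by move=> /allpairsP[p [_ _ ->]]; apply/negP => /allpairsP[q [_ _]].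
Qed.

Lemma mem_forestS k x : (x \in forest k.+1) =
  [|| x \in leaves k.+1, x \in [seq Node2 a b | a <- forest k, b <- forest k],
      x \in [seq Node3 p.1 p.2 c | p <- pairs (forest k), c <- forest k] |
      x \in [seq Node4 p.1 p.2 q.1 q.2 | p <- pairs (forest k), q <- pairs (forest k)]].
Proof.
rewrite forestS mem_cat; congr (_ || _).
by rewrite mem_cat; congr (_ || _); rewrite mem_cat.
Qed.

Lemma forest_subS k : {subset forest k <= forest k.+1}.
Proof.
elim: k => // k IH x.
have IHp p : p \in pairs (forest k) -> p \in pairs (forest k.+1).
  by rewrite !mem_pairs => /andP[/IH -> /IH ->].
rewrite !mem_forestS => /or4P[H|H|H|H]; apply/or4P.
- constructor 1; move: H; rewrite !mem_leaves.
  by case: x => // _ m /leq_trans; apply.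
- constructor 2; have /allpairsP[p [p1 p2 ->]] := H.
  by apply: allpairs_f; exact: IH.
- constructor 3; have /allpairsP[p [p1 p2 ->]] := H.
  by apply: (allpairs_f (fun p c => Node3 p.1 p.2 c)); [exact: IHp|exact: IH].
- constructor 4; have /allpairsP[p [p1 p2 ->]] := H.
  by apply: (allpairs_f (fun p q => Node4 p.1 p.2 q.1 q.2)); exact: IHp.
Qed.

Lemma forest_sub k l : (k <= l)%N -> {subset forest k <= forest l}.
Proof.
move=> kl; rewrite -(subnK kl); elim: (l - k)%N => // n IH x /IH.
by rewrite addSn; exact: forest_subS.
Qed.

(** Isolates the new trees of the larger forest: sums of nonnegative terms increase with the index,
    and differences of sums reduce to the new trees. *)
Lemma forest_perm k l : (k <= l)%N -> exists s, perm_eq (forest l) (forest k ++ s).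
Proof.
move=> kl; exists [seq x <- forest l | x \notin forest k].
rewrite perm_sym.
apply: (perm_trans (y := [seq x <- forest l | x \in forest k] ++ [seq x <- forest l | x \notin forest k])).
  rewrite perm_cat2r; apply: uniq_perm; rewrite ?filter_uniq ?uniq_forest// => x.
  by rewrite mem_filter andb_idr//; exact: forest_sub.
exact/permPl/perm_filterC.
Qed.

Lemma sum_forestS (V : nmodType) (G : tree -> V) k :
  \sum_(a <- forest k.+1) G a =
  \sum_(a <- leaves k.+1) G a
  + \sum_(a <- forest k) \sum_(b <- forest k) G (Node2 a b)
  + \sum_(a <- forest k) \sum_(b <- forest k) \sum_(c <- forest k) G (Node3 a b c)
  + \sum_(a <- forest k) \sum_(b <- forest k) \sum_(c <- forest k) \sum_(d <- forest k)
      G (Node4 a b c d).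
Proof.
rewrite forestS !big_cat /= !addrA; congr (_ + _ + _ + _).
- by rewrite big_allpairs_dep.
- by rewrite big_allpairs_dep big_allpairs.
- rewrite big_allpairs_dep big_allpairs.
  apply: eq_bigr => a _; apply: eq_bigr => b _.
  by rewrite big_allpairs.
Qed.

(** Conjugation exchanges the leaves in pairs and commutes with the nodes, so induction on the
    recursive form of the sum replaces an explicit permutation of the forest. *)
Lemma sum_forest_conjt (V : nmodType) (G : tree -> V) k :
  \sum_(a <- forest k) G (conjt a) = \sum_(a <- forest k) G a.
Proof.
elim: k G => [|k IH] G; first by rewrite !big_nil.
rewrite !sum_forestS /=; congr (_ + _ + _ + _).
- by rewrite !sum_leaves; apply: eq_bigr => m _; rewrite addrC.
- rewrite -[RHS]IH; apply: eq_bigr => a _.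
  by rewrite -[RHS]IH.
- rewrite -[RHS]IH; apply: eq_bigr => a _.
  rewrite -[RHS]IH; apply: eq_bigr => b _.
  by rewrite -[RHS]IH.
- rewrite -[RHS]IH; apply: eq_bigr => a _.
  rewrite -[RHS]IH; apply: eq_bigr => b _.
  rewrite -[RHS]IH; apply: eq_bigr => c _.
  by rewrite -[RHS]IH.
Qed.

Section ForestSums.
Variable R : realDomainType.
Implicit Types G H : tree -> R.

(** Only the new trees contribute to the difference, and there H dominates G. The Cauchy estimates
    for the iterates come from this. *)
Lemma sum_forest_dist G H k l : (forall a, `|G a| <= H a) -> (k <= l)%N ->
  `|\sum_(a <- forest l) G a - \sum_(a <- forest k) G a|
  <= \sum_(a <- forest l) H a - \sum_(a <- forest k) H a.
Proof.
move=> GH /forest_perm[s ps].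
rewrite !(perm_big _ ps) !big_cat /= ![_ + _ - _]addrAC !subrr !add0r.
by rewrite (le_trans (ler_norm_sum _ _ _)) ?ler_sum.
Qed.

End ForestSums.

(** * Fourier multipliers *)

Section IntegerPowers.
Variable R : realFieldType.
Implicit Types (z : int) (x a b c d : R).

Lemma intr_ge1 z : z != 0 -> 1 <= `|z%:~R : R|.
Proof. by move=> z0; rewrite -intr_norm ler1z -gtz0_ge1 normr_gt0. Qed.

(** A nonzero integer has modulus at least 1, so powers increase with the exponent; exponent 0 is
    excluded on account of z = 0. *)
Lemma intr_pow_le z (i j : nat) : (0 < i <= j)%N -> `|z%:~R : R| ^+ i <= `|z%:~R| ^+ j.
Proof.
move=> /andP[i0 ij]; have [->|z0] := eqVneq z 0.
  by rewrite mulr0z normr0 !expr0n !gtn_eqF// (leq_trans i0).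
by apply: ler_weXn2l => //; exact: intr_ge1.
Qed.

Lemma intr_norm_le4 z : `|z%:~R : R| <= z%:~R ^+ 4.
Proof.
have -> : (z%:~R : R) ^+ 4 = `|z%:~R| ^+ 4 by rewrite -normrX ger0_norm// exprn_even_ge0.
by rewrite -{1}(expr1 `|_|); exact: intr_pow_le.
Qed.

Lemma intr_sqr_le4 z : (z%:~R : R) ^+ 2 <= z%:~R ^+ 4.
Proof.
have -> : (z%:~R : R) ^+ 4 = `|z%:~R| ^+ 4 by rewrite -normrX ger0_norm// exprn_even_ge0.
have -> : (z%:~R : R) ^+ 2 = `|z%:~R| ^+ 2 by rewrite -normrX ger0_norm// exprn_even_ge0.
exact: intr_pow_le.
Qed.

Lemma sqr_mul_le4 a b : a ^+ 2 * b ^+ 2 <= (a ^+ 4 + b ^+ 4) / 2.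
Proof. by have := sqr_ge0 (a ^+ 2 - b ^+ 2); nra. Qed.

End IntegerPowers.

Section Symbols.
Variable R : realType.
Variables eps bet mw : R.
Hypotheses (eps0 : 0 < eps) (bet0 : 0 < bet) (mw0 : 0 < mw).

(* Fourier multipliers of the quadratic, cubic and quartic parts of the
   nonlinearity: [n] is the output frequency, [p] that of the differentiated factor. *)
Definition sym2 (n p : R) : R := eps * (- (n * p) - bet * (n * p ^+ 3) + mw * (n ^+ 2 * p ^+ 2)).
Definition sym3 (n p : R) : R := eps ^+ 2 * mw * (n ^+ 2 * p ^+ 2).
Definition sym4 (n p : R) : R := eps ^+ 3 * (mw / 3) * (n ^+ 2 * p ^+ 2).

(** The part [n p] has degree two and is raised to degree four because a and b are integers. A sum
    of separate fourth powers puts all derivatives on one factor, the form which the dissipation can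
    absorb. *)
Lemma sym2_le (y z : int) (a := y%:~R : R) (b := z%:~R : R) :
  `|sym2 (a + b) b| <= eps * (2 + 2 * bet + 4 * mw) * (a ^+ 4 + b ^+ 4).
Proof.
have a2 : a ^+ 2 <= a ^+ 4 by exact: intr_sqr_le4.
have b2 : b ^+ 2 <= b ^+ 4 by exact: intr_sqr_le4.
have ab2 := sqr_mul_le4 a b.
have b4 : 0 <= b ^+ 4 by rewrite exprn_even_ge0.
have a4 : 0 <= a ^+ 4 by rewrite exprn_even_ge0.
have h1 : `|(a + b) * b| <= 2 * (a ^+ 4 + b ^+ 4).
  rewrite ler_norml; apply/andP; split.
    by have := sqr_ge0 (a + b); nra.
  by have := sqr_ge0 (a - b); nra.
have h2 : `|(a + b) * b ^+ 3| <= 2 * (a ^+ 4 + b ^+ 4).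
  have e1 : 0 <= (a * b + b ^+ 2) ^+ 2 by exact: sqr_ge0.
  have e2 : 0 <= (a * b - b ^+ 2) ^+ 2 by exact: sqr_ge0.
  have e1' : (a * b + b ^+ 2) ^+ 2 = a ^+ 2 * b ^+ 2 + 2 * (a * b ^+ 3) + b ^+ 4 by ring.
  have e2' : (a * b - b ^+ 2) ^+ 2 = a ^+ 2 * b ^+ 2 - 2 * (a * b ^+ 3) + b ^+ 4 by ring.
  have -> : (a + b) * b ^+ 3 = a * b ^+ 3 + b ^+ 4 by ring.
  by rewrite ler_norml; apply/andP; split; lra.
have h3 : `|(a + b) ^+ 2 * b ^+ 2| <= 4 * (a ^+ 4 + b ^+ 4).
  rewrite ger0_norm; last by rewrite mulr_ge0 ?sqr_ge0.
  have : 0 <= (a - b) ^+ 2 * b ^+ 2 by rewrite mulr_ge0 ?sqr_ge0.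
  have -> : (a - b) ^+ 2 * b ^+ 2 = 2 * (a ^+ 2 * b ^+ 2) + 2 * b ^+ 4 - (a + b) ^+ 2 * b ^+ 2 by ring.
  by lra.
rewrite /sym2 normrM (gtr0_norm eps0) -mulrA ler_pM2l//.
apply: (le_trans (ler_normD _ _)).
rewrite -opprD normrN.
apply: (le_trans (lerD (ler_normD _ _) (lexx _))).
rewrite (normrM bet) (normrM mw) (gtr0_norm bet0) (gtr0_norm mw0).
have := ler_wpM2l (ltW bet0) h2; have := ler_wpM2l (ltW mw0) h3.
by nra.
Qed.

(** Homogeneous of degree four, hence valid for all reals: Cauchy-Schwarz on the three terms, then
    [x^2 c^2 <= (x^4 + c^4) / 2]. The 6 is the coefficient 3 (1/2 + 1/2 + 1) of [c^4]. *)
Lemma sym3_le (a b c : R) :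
  `|sym3 (a + b + c) c| <= 6 * eps ^+ 2 * mw * (a ^+ 4 + b ^+ 4 + c ^+ 4).
Proof.
have ac := sqr_mul_le4 a c; have bc := sqr_mul_le4 b c.
rewrite /sym3 normrM gtr0_norm; last by rewrite mulr_gt0 ?exprn_gt0.
rewrite ger0_norm; last by rewrite mulr_ge0 ?sqr_ge0.
have -> : 6 * eps ^+ 2 * mw = eps ^+ 2 * mw * 6 by ring.
rewrite -[leRHS]mulrA ler_pM2l ?mulr_gt0 ?exprn_gt0//.
have : (a + b + c) ^+ 2 * c ^+ 2 <= 3 * (a ^+ 2 * c ^+ 2 + b ^+ 2 * c ^+ 2 + c ^+ 4).
  have -> : 3 * (a ^+ 2 * c ^+ 2 + b ^+ 2 * c ^+ 2 + c ^+ 4) = 3 * (a ^+ 2 + b ^+ 2 + c ^+ 2) * c ^+ 2 by ring.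
  apply: ler_wpM2r; first exact: sqr_ge0.
  by have := sqr_ge0 (a - b); have := sqr_ge0 (b - c); have := sqr_ge0 (a - c); nra.
have b4 : 0 <= b ^+ 4 by rewrite exprn_even_ge0.
have a4 : 0 <= a ^+ 4 by rewrite exprn_even_ge0.
by lra.
Qed.

(** As for three waves; [d^4] gets the coefficient 4 (3/2 + 1) = 10, times the factor mw / 3 of the
    symbol. *)
Lemma sym4_le (a b c d : R) :
  `|sym4 (a + b + c + d) d| <= 10 / 3 * eps ^+ 3 * mw * (a ^+ 4 + b ^+ 4 + c ^+ 4 + d ^+ 4).
Proof.
have ad := sqr_mul_le4 a d; have bd := sqr_mul_le4 b d; have cd := sqr_mul_le4 c d.
rewrite /sym4 normrM gtr0_norm; last by rewrite !mulr_gt0 ?exprn_gt0 ?invr_gt0.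
rewrite ger0_norm; last by rewrite mulr_ge0 ?sqr_ge0.
have -> : 10 / 3 * eps ^+ 3 * mw = eps ^+ 3 * (mw / 3) * 10 by field.
rewrite -[leRHS]mulrA ler_pM2l ?mulr_gt0 ?exprn_gt0 ?invr_gt0//.
have : (a + b + c + d) ^+ 2 * d ^+ 2 <= 4 * (a ^+ 2 * d ^+ 2 + b ^+ 2 * d ^+ 2 + c ^+ 2 * d ^+ 2 + d ^+ 4).
  have -> : 4 * (a ^+ 2 * d ^+ 2 + b ^+ 2 * d ^+ 2 + c ^+ 2 * d ^+ 2 + d ^+ 4) = 4 * (a ^+ 2 + b ^+ 2 + c ^+ 2 + d ^+ 2) * d ^+ 2 by ring.
  apply: ler_wpM2r; first exact: sqr_ge0.
  have := sqr_ge0 (a - b); have := sqr_ge0 (b - c); have := sqr_ge0 (a - c).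
  by have := sqr_ge0 (a - d); have := sqr_ge0 (b - d); have := sqr_ge0 (c - d); nra.
have b4 : 0 <= b ^+ 4 by rewrite exprn_even_ge0.
have a4 : 0 <= a ^+ 4 by rewrite exprn_even_ge0.
have c4 : 0 <= c ^+ 4 by rewrite exprn_even_ge0.
by lra.
Qed.

End Symbols.

(** * Amplitudes and their majorants *)

Section Amplitudes.
Variable R : realType.
Variables eps bet mw gam : R.
Hypotheses (eps0 : 0 < eps) (bet0 : 0 < bet) (mw0 : 0 < mw) (gam0 : 0 < gam).
(* Moduli and phases of the Fourier coefficients of the datum at the positive frequencies [m + 1]. *)
Variables rad ang : nat -> R.
Hypothesis rad0 : forall m, 0 <= rad m.
Local Notation mu := (@lebesgue_measure R).
Local Notation sym2 := (sym2 eps bet mw).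
Local Notation sym3 := (sym3 eps mw).
Local Notation sym4 := (sym4 eps mw).

Definition nu (a : tree) : R := (freq a)%:~R.

Fixpoint phase (a : tree) : R :=
  match a with
  | Leaf s m => if s then ang m else - ang m
  | Node2 b c => phase b + phase c
  | Node3 b c d => phase b + phase c + phase d
  | Node4 b c d e => phase b + phase c + phase d + phase e
  end.

Definition lam (n : R) : R := n ^+ 2 + gam * n ^+ 4.
(* The strip widens at rate [gam / 2]; the extra [gam / 64] gives the exponential decay. *)
Definition sig : R := 33 / 64 * gam.
Definition kap (n : R) : R := 31 / 64 * gam * n ^+ 4.

(* The [k]-th iterate is the sum of [amp a t * cos (freq a * x + phase a)] over [forest k]. *)
Fixpoint amp (a : tree) : R -> R :=
  match a with
  | Leaf s m => fun t => rad m * expR (- lam (nu a) * t)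
  | Node2 b c => duhamel (lam (nu a)) (fun s => sym2 (nu a) (nu c) * (amp b s * amp c s))
  | Node3 b c d => duhamel (lam (nu a))
      (fun s => sym3 (nu a) (nu d) * (amp b s * amp c s * amp d s))
  | Node4 b c d e => duhamel (lam (nu a))
      (fun s => sym4 (nu a) (nu e) * (amp b s * amp c s * amp d s * amp e s))
  end.

Definition force (a : tree) (s : R) : R :=
  match a with
  | Leaf _ _ => 0
  | Node2 b c => sym2 (nu a) (nu c) * (amp b s * amp c s)
  | Node3 b c d => sym3 (nu a) (nu d) * (amp b s * amp c s * amp d s)
  | Node4 b c d e => sym4 (nu a) (nu e) * (amp b s * amp c s * amp d s * amp e s)
  end.

Fixpoint maj (a : tree) : R -> R :=
  match a with
  | Leaf s m => fun t => rad m * expR (- kap (nu a) * t)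
  | Node2 b c => duhamel (kap (nu a)) (fun s => `|sym2 (nu a) (nu c)| * (maj b s * maj c s))
  | Node3 b c d => duhamel (kap (nu a))
      (fun s => `|sym3 (nu a) (nu d)| * (maj b s * maj c s * maj d s))
  | Node4 b c d e => duhamel (kap (nu a))
      (fun s => `|sym4 (nu a) (nu e)| * (maj b s * maj c s * maj d s * maj e s))
  end.

Definition majforce (a : tree) (s : R) : R :=
  match a with
  | Leaf _ _ => 0
  | Node2 b c => `|sym2 (nu a) (nu c)| * (maj b s * maj c s)
  | Node3 b c d => `|sym3 (nu a) (nu d)| * (maj b s * maj c s * maj d s)
  | Node4 b c d e => `|sym4 (nu a) (nu e)| * (maj b s * maj c s * maj d s * maj e s)
  end.

Lemma amp_cont a : continuous (amp a).
Proof.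
elim: a => [s m|b IHb c IHc|b IHb c IHc d IHd|b IHb c IHc d IHd e IHe] /=.
- by apply: cont_scale; exact: expRM_cont.
- by apply/duhamel_cont/cont_scale; apply: cont_mul.
- by apply/duhamel_cont/cont_scale; do 2 apply: cont_mul => //.
- by apply/duhamel_cont/cont_scale; do 3 apply: cont_mul => //.
Qed.

Lemma force_cont a : continuous (force a).
Proof.
case: a => [s m|b c|b c d|b c d e] /=; first by move=> x; exact: cvg_cst.
- by apply: cont_scale; apply: cont_mul; exact: amp_cont.
- by apply: cont_scale; do 2 (apply: cont_mul; last exact: amp_cont); exact: amp_cont.
- by apply: cont_scale; do 3 (apply: cont_mul; last exact: amp_cont); exact: amp_cont.
Qed.

Lemma maj_cont a : continuous (maj a).
Proof.
elim: a => [s m|b IHb c IHc|b IHb c IHc d IHd|b IHb c IHc d IHd e IHe] /=.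
- by apply: cont_scale; exact: expRM_cont.
- by apply/duhamel_cont/cont_scale; apply: cont_mul.
- by apply/duhamel_cont/cont_scale; do 2 apply: cont_mul => //.
- by apply/duhamel_cont/cont_scale; do 3 apply: cont_mul => //.
Qed.

Lemma majforce_cont a : continuous (majforce a).
Proof.
case: a => [s m|b c|b c d|b c d e] /=; first by move=> x; exact: cvg_cst.
- by apply: cont_scale; apply: cont_mul; exact: maj_cont.
- by apply: cont_scale; do 2 (apply: cont_mul; last exact: maj_cont); exact: maj_cont.
- by apply: cont_scale; do 3 (apply: cont_mul; last exact: maj_cont); exact: maj_cont.
Qed.

Lemma maj_ge0 a t : 0 <= t -> 0 <= maj a t.
Proof.
elim: a t => [s m|b IHb c IHc|b IHb c IHc d IHd|b IHb c IHc d IHd e IHe] t t0.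
- by rewrite /= mulr_ge0 ?expR_ge0.
- by apply: duhamel_ge0 => s s0; rewrite !mulr_ge0 ?IHb ?IHc.
- by apply: duhamel_ge0 => s s0; rewrite !mulr_ge0 ?IHb ?IHc ?IHd.
- by apply: duhamel_ge0 => s s0; rewrite !mulr_ge0 ?IHb ?IHc ?IHd ?IHe.
Qed.

(** Here 31/64 + 33/64 = 1: the weight costs [sig |n|], which integrality of n bounds by
    [sig n^4]. *)
Lemma kap_le_lam a : kap (nu a) <= lam (nu a) - sig * `|nu a|.
Proof.
rewrite /kap /lam /sig.
have h : `|nu a| <= nu a ^+ 4 by exact: intr_norm_le4.
have := sqr_ge0 (nu a); have := ler_wpM2l (ltW gam0) h; lra.
Qed.

Lemma sig_ge0 : 0 <= sig. Proof. by rewrite /sig mulr_ge0// ltW. Qed.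

Lemma weightM (x y t : R) : 0 <= t ->
  expR (sig * `|x + y| * t) <= expR (sig * `|x| * t) * expR (sig * `|y| * t).
Proof.
move=> t0; rewrite -expRD ler_expR -mulrDl ler_wpM2r// -mulrDr ler_wpM2l ?sig_ge0//.
exact: ler_normD.
Qed.

Lemma weight_prod (x y p q P Q t : R) : 0 <= t ->
  `|p| * expR (sig * `|x| * t) <= P -> `|q| * expR (sig * `|y| * t) <= Q ->
  `|p * q| * expR (sig * `|x + y| * t) <= P * Q.
Proof.
move=> t0 pP qQ; rewrite normrM.
apply: (@le_trans _ _ (`|p| * `|q| * (expR (sig * `|x| * t) * expR (sig * `|y| * t)))).
  by rewrite ler_wpM2l ?mulr_ge0// weightM.
rewrite mulrACA; apply: ler_pM => //; by rewrite mulr_ge0 ?expR_ge0.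
Qed.

(** The frequency of a node is the sum of those of its children and the weight is submultiplicative,
    so it spreads over the product; the Duhamel estimate pays for it with the gap between [lam] and
    [kap]. *)
Lemma amp_le_maj a t : 0 <= t -> `|amp a t| * expR (sig * `|nu a| * t) <= maj a t.
Proof.
elim: a t => [s m|b IHb c IHc|b IHb c IHc d IHd|b IHb c IHc d IHd e IHe] t t0.
- rewrite /= normrM (ger0_norm (rad0 _)) (ger0_norm (expR_ge0 _)) -[leLHS]mulrA -expRD.
  rewrite ler_wpM2l// ler_expR -mulrDl ler_wpM2r//.
  by have := kap_le_lam (Leaf s m); lra.
- apply: duhamel_le => //; [| |exact: kap_le_lam|].
  + exact: (@force_cont (Node2 b c)).
  + exact: (@majforce_cont (Node2 b c)).
  + move=> s s0; rewrite normrM -[leLHS]mulrA ler_wpM2l// /nu /= intrD.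
    by apply: weight_prod; [|exact: IHb|exact: IHc].
- apply: duhamel_le => //; [| |exact: kap_le_lam|].
  + exact: (@force_cont (Node3 b c d)).
  + exact: (@majforce_cont (Node3 b c d)).
  + move=> s s0; rewrite normrM -[leLHS]mulrA ler_wpM2l// /nu /= !intrD.
    apply: weight_prod; [by []| |exact: IHd].
    by apply: weight_prod; [|exact: IHb|exact: IHc].
- apply: duhamel_le => //; [| |exact: kap_le_lam|].
  + exact: (@force_cont (Node4 b c d e)).
  + exact: (@majforce_cont (Node4 b c d e)).
  + move=> s s0; rewrite normrM -[leLHS]mulrA ler_wpM2l// /nu /= !intrD.
    apply: weight_prod; [by []| |exact: IHe].
    apply: weight_prod; [by []| |exact: IHd].
    by apply: weight_prod; [|exact: IHb|exact: IHc].
Qed.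

Lemma amp_le_maj1 a t : 0 <= t -> `|amp a t| <= maj a t.
Proof.
move=> t0; apply: le_trans (amp_le_maj a t0).
apply: ler_peMr => //; rewrite -[leLHS]expR0 ler_expR.
by apply: mulr_ge0 => //; apply: mulr_ge0 => //; exact: sig_ge0.
Qed.

(** Every multiplier contains the output frequency as a factor, the trace of the divergence form,
    and leaves never have frequency 0: zero mean is preserved tree by tree. *)
Lemma nu_eq0 a : nu a = 0 -> forall t, amp a t = 0 /\ maj a t = 0.
Proof.
case: a => [s m|b c|b c d|b c d e] n0 t.
- by move/eqP: n0; rewrite /nu intr_eq0 /=; case: s; rewrite ?oppr_eq0.
- by split; apply: duhamel_eq0 => s; rewrite /sym2 n0 expr0n /= !(mul0r, mulr0, oppr0, subr0, addr0, normr0).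
- by split; apply: duhamel_eq0 => s; rewrite /sym3 n0 expr0n /= !(mul0r, mulr0, normr0).
- by split; apply: duhamel_eq0 => s; rewrite /sym4 n0 expr0n /= !(mul0r, mulr0, normr0).
Qed.

Definition init (a : tree) : R := if a is Leaf _ m then rad m else 0.

(** Time integral of [maj' = - kap maj + majforce]; only leaves carry an initial value. *)
Lemma maj_balance a t : 0 <= t ->
  maj a t + kap (nu a) * prim (maj a) t = init a + prim (majforce a) t.
Proof.
move=> t0; case: a => [s m|b c|b c d|b c d e].
- rewrite /= prim0 addr0 -primZ; last by apply: cont_scale; exact: expRM_cont.
  set k := kap _.
  have -> : prim (fun s => k * (rad m * expR (- k * s))) t =
      - (rad m * expR (- k * t)) - - (rad m * expR (- k * 0)).
    apply: (@Rint_FTC _ (fun x => - (rad m * expR (- k * x)))) => //.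
    + by apply/cont_scale/cont_scale; exact: expRM_cont.
    + by move=> x; apply: cvgN; move: x; apply: cont_scale; exact: expRM_cont.
    + move=> x _ _; have d := expRM_derive (- k) x.
      have d2 := is_deriveZ (rad m) d.
      apply: (is_derive_eq (is_deriveN d2)).
      rewrite /GRing.scale /=; ring.
  by rewrite mulr0 expR0; ring.
- by rewrite add0r; apply: duhamel_balance => //; exact: (@majforce_cont (Node2 b c)).
- by rewrite add0r; apply: duhamel_balance => //; exact: (@majforce_cont (Node3 b c d)).
- by rewrite add0r; apply: duhamel_balance => //; exact: (@majforce_cont (Node4 b c d e)).
Qed.

Lemma amp_derive a (t : R) : 0 < t ->
  is_derive t 1 (amp a) (- lam (nu a) * amp a t + force a t).
Proof.
move=> t0; case: a => [s m|b c|b c d|b c d e].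
- have d2 := is_deriveZ (rad m) (expRM_derive (- lam (nu (Leaf s m))) t).
  apply: (is_derive_eq d2); rewrite /GRing.scale /= addr0; ring.
- by apply: duhamel_derive => //; exact: (@force_cont (Node2 b c)).
- by apply: duhamel_derive => //; exact: (@force_cont (Node3 b c d)).
- by apply: duhamel_derive => //; exact: (@force_cont (Node4 b c d e)).
Qed.

(** * Symmetry under conjugation *)

Lemma nu_conjt a : nu (conjt a) = - nu a.
Proof. by rewrite /nu freq_conjt intrN. Qed.

Lemma phase_conjt a : phase (conjt a) = - phase a.
Proof.
by elim: a => [[] m|b IHb c IHc|b IHb c IHc d IHd|b IHb c IHc d IHd e IHe] /=;
  rewrite ?opprK ?IHb ?IHc ?IHd ?IHe ?opprD.
Qed.

Lemma lamN n : lam (- n) = lam n.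
Proof. by rewrite /lam; ring. Qed.

Lemma sym2N n p : sym2 (- n) (- p) = sym2 n p. Proof. by rewrite /sym2; ring. Qed.
Lemma sym3N n p : sym3 (- n) (- p) = sym3 n p. Proof. by rewrite /sym3; ring. Qed.
Lemma sym4N n p : sym4 (- n) (- p) = sym4 n p. Proof. by rewrite /sym4; ring. Qed.

(** The multipliers are even under a simultaneous change of sign of both frequencies. *)
Lemma amp_conjt a : amp (conjt a) = amp a.
Proof.
elim: a => [s m|b IHb c IHc|b IHb c IHc d IHd|b IHb c IHc d IHd e IHe].
- by rewrite /= -[Leaf _ m]/(conjt (Leaf s m)) nu_conjt lamN.
- rewrite /= IHb IHc -[Node2 _ _]/(conjt (Node2 b c)) !nu_conjt lamN.
  by under eq_fun do rewrite sym2N.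
- rewrite /= IHb IHc IHd -[Node3 _ _ _]/(conjt (Node3 b c d)) !nu_conjt lamN.
  by under eq_fun do rewrite sym3N.
- rewrite /= IHb IHc IHd IHe -[Node4 _ _ _ _]/(conjt (Node4 b c d e)) !nu_conjt lamN.
  by under eq_fun do rewrite sym4N.
Qed.

(** * Energy estimate for the majorants *)

Lemma sum_weight1 (f : seq tree) (m x : tree -> R) (y w : R) :
  \sum_(c <- f) (y + x c) * (w * m c) =
  w * (y * (\sum_(c <- f) m c) + \sum_(c <- f) x c * m c).
Proof.
rewrite mulrDr !mulr_sumr -big_split /=; apply: eq_bigr => c _; ring.
Qed.

(** An additive weight on a product of j factors gives [j S^(j-1) X], with S the plain and X the
    weighted sum. The parameters y and w stand for the outer summation variables, so that each case
    follows from the previous one. *)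
Lemma sum_weight2 (f : seq tree) (m x : tree -> R) (y w : R) :
  \sum_(b <- f) \sum_(c <- f) (y + x b + x c) * (w * m b * m c) =
  w * (y * (\sum_(c <- f) m c) ^+ 2 + 2 * (\sum_(c <- f) m c) * \sum_(c <- f) x c * m c).
Proof.
set S := \sum_(c <- f) m c; set X := \sum_(c <- f) x c * m c.
transitivity (\sum_(b <- f) ((y * S + X) * (w * m b) + w * S * (x b * m b))).
  by apply: eq_bigr => b _; rewrite sum_weight1 -/S -/X; ring.
rewrite big_split /= -mulr_sumr -[in X in _ + X]mulr_sumr -/X -mulr_sumr -/S; ring.
Qed.

Lemma sum_weight3 (f : seq tree) (m x : tree -> R) (y w : R) :
  \sum_(a <- f) \sum_(b <- f) \sum_(c <- f) (y + x a + x b + x c) * (w * m a * m b * m c) =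
  w * (y * (\sum_(c <- f) m c) ^+ 3 + 3 * (\sum_(c <- f) m c) ^+ 2 * \sum_(c <- f) x c * m c).
Proof.
set S := \sum_(c <- f) m c; set X := \sum_(c <- f) x c * m c.
transitivity (\sum_(b <- f) ((y * S ^+ 2 + 2 * S * X) * (w * m b) + w * S ^+ 2 * (x b * m b))).
  by apply: eq_bigr => b _; rewrite sum_weight2 -/S -/X; ring.
rewrite big_split /= -mulr_sumr -[in X in _ + X]mulr_sumr -/X -mulr_sumr -/S; ring.
Qed.

Lemma sum_weight4 (f : seq tree) (m x : tree -> R) :
  \sum_(a <- f) \sum_(b <- f) \sum_(c <- f) \sum_(d <- f)
     (x a + x b + x c + x d) * (m a * m b * m c * m d) =
  4 * (\sum_(c <- f) m c) ^+ 3 * \sum_(c <- f) x c * m c.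
Proof.
set S := \sum_(c <- f) m c; set X := \sum_(c <- f) x c * m c.
transitivity (\sum_(b <- f) ((3 * S ^+ 2 * X) * m b + S ^+ 3 * (x b * m b))).
  by apply: eq_bigr => b _; rewrite sum_weight3 -/S -/X; ring.
rewrite big_split /= -mulr_sumr -[in X in _ + X]mulr_sumr -/X -/S; ring.
Qed.

(* Majorants of the norms [A^0] and [A^4] of the [k]-th iterate, in the widening strip. *)
Definition SA k t : R := \sum_(a <- forest k) maj a t.
Definition SJ k t : R := \sum_(a <- forest k) nu a ^+ 4 * maj a t.

(** The coefficient of [x^(j-1)] is the constant of the j-wave symbol bound times j, the number of
    factors on which the weight can fall. *)
Definition theta (x : R) : R :=
  eps * (4 + 4 * bet + 8 * mw) * x + 18 * eps ^+ 2 * mw * x ^+ 2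
  + 40 / 3 * eps ^+ 3 * mw * x ^+ 3.

Lemma theta_ge0 x : 0 <= x -> 0 <= theta x.
Proof.
move=> x0; rewrite /theta; apply: addr_ge0; [apply: addr_ge0|];
  (apply: mulr_ge0; last by rewrite ?exprn_ge0).
- by rewrite ltW// mulr_gt0// !addr_gt0 ?mulr_gt0.
- by rewrite ltW// !mulr_gt0 ?exprn_gt0.
- by rewrite ltW// !mulr_gt0 ?exprn_gt0 ?invr_gt0.
Qed.

Lemma nu4_ge0 a : 0 <= nu a ^+ 4. Proof. by rewrite exprn_even_ge0. Qed.

Lemma SA_ge0 k t : 0 <= t -> 0 <= SA k t.
Proof. by move=> t0; apply: sumr_ge0 => a _; exact: maj_ge0. Qed.

Lemma SJ_ge0 k t : 0 <= t -> 0 <= SJ k t.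
Proof. by move=> t0; apply: sumr_ge0 => a _; rewrite mulr_ge0 ?nu4_ge0 ?maj_ge0. Qed.

Lemma SJ_cont k : continuous (SJ k).
Proof. by apply: continuous_bigsum => a; apply: cont_scale; exact: maj_cont. Qed.

Lemma SJ_le k l t : 0 <= t -> (k <= l)%N -> SJ k t <= SJ l t.
Proof.
move=> t0 kl; have [s ps] := forest_perm kl.
rewrite /SJ (perm_big _ ps) big_cat /= lerDl sumr_ge0// => a _.
by rewrite mulr_ge0 ?nu4_ge0 ?maj_ge0.
Qed.

Lemma SA_le k l t : 0 <= t -> (k <= l)%N -> SA k t <= SA l t.
Proof.
move=> t0 kl; have [s ps] := forest_perm kl.
by rewrite /SA (perm_big _ ps) big_cat /= lerDl sumr_ge0// => a _; exact: maj_ge0.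
Qed.

Lemma sum_majforce_le k s : 0 <= s ->
  \sum_(a <- forest k.+1) majforce a s <= theta (SA k s) * SJ k s.
Proof.
move=> s0; rewrite sum_forestS big1_seq ?add0r; last first.
  by move=> a /=; rewrite mem_leaves; case: a.
have m0 a : 0 <= maj a s by exact: maj_ge0.
have -> : theta (SA k s) * SJ k s =
    eps * (2 + 2 * bet + 4 * mw) * (2 * SA k s * SJ k s)
    + 6 * eps ^+ 2 * mw * (3 * SA k s ^+ 2 * SJ k s)
    + 10 / 3 * eps ^+ 3 * mw * (4 * SA k s ^+ 3 * SJ k s) by rewrite /theta; field.
apply: lerD; first apply: lerD.
- have := sum_weight2 (forest k) (maj ^~ s) (fun a => nu a ^+ 4) 0 1.
  rewrite !mul1r mul0r add0r -/(SA k s) -/(SJ k s) => <-.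
  rewrite mulr_sumr; apply: ler_sum => a _; rewrite mulr_sumr; apply: ler_sum => b _.
  rewrite /= add0r mul1r [leRHS]mulrA ler_wpM2r ?mulr_ge0//.
  by rewrite /nu /= intrD; exact: sym2_le.
- have := sum_weight3 (forest k) (maj ^~ s) (fun a => nu a ^+ 4) 0 1.
  rewrite !mul1r mul0r add0r -/(SA k s) -/(SJ k s) => <-.
  rewrite mulr_sumr; apply: ler_sum => a _; rewrite mulr_sumr; apply: ler_sum => b _.
  rewrite mulr_sumr; apply: ler_sum => c _.
  rewrite /= add0r mul1r [leRHS]mulrA ler_wpM2r ?mulr_ge0//.
  by rewrite /nu /= !intrD; exact: sym3_le.
- rewrite -(sum_weight4 (forest k) (maj ^~ s) (fun a => nu a ^+ 4)).
  rewrite mulr_sumr; apply: ler_sum => a _; rewrite mulr_sumr; apply: ler_sum => b _.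
  rewrite mulr_sumr; apply: ler_sum => c _; rewrite mulr_sumr; apply: ler_sum => d _.
  rewrite /= [leRHS]mulrA ler_wpM2r ?mulr_ge0//.
  by rewrite /nu /= !intrD; exact: sym4_le.
Qed.

Variable Z : R.
Hypothesis radZ : forall k, \sum_(0 <= m < k) (rad m + rad m) <= Z.
Hypothesis gamE : gam = bet - mw / 3.
Hypothesis Zsmall : 128 * eps * (bet + 55 / 6 * mw + 1) * Z <= gam.

Lemma gam_bet : gam <= bet.
Proof. by rewrite gamE gerBl divr_ge0 ?ltW. Qed.

Lemma Z_ge0 : 0 <= Z.
Proof. by have := radZ 0; rewrite big_geq. Qed.

(** The value 15/64 is what can be spared: of the 31/64 in [kap] it leaves a quarter. With y = eps
    x, the smallness of Z controls y, [bet y] and [mw y], and the higher powers are of lower order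
    once y <= 1/128. *)
Lemma theta_le x : 0 <= x -> x <= Z -> theta x <= 15 / 64 * gam.
Proof.
move=> x0 xZ; have [y ey] : exists y, y = eps * x by exists (eps * x).
have y0 : 0 <= y by rewrite ey; apply: mulr_ge0 => //; exact: ltW.
have yk : 128 * (bet * y) + 128 * 55 / 6 * (mw * y) + 128 * y <= gam.
  apply: le_trans Zsmall.
  have -> : 128 * (bet * y) + 128 * 55 / 6 * (mw * y) + 128 * y = (128 * eps * (bet + 55 / 6 * mw + 1)) * x by rewrite ey; ring.
  by apply: ler_wpM2l => //; rewrite !mulr_ge0 ?ltW// !addr_gt0 ?mulr_gt0.
have by0 : 0 <= bet * y by apply: mulr_ge0 => //; exact: ltW.
have my0 : 0 <= mw * y by apply: mulr_ge0 => //; exact: ltW.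
(* As gam <= bet, a larger y would make [128 bet y] alone exceed gam. *)
have y1 : y <= 1 / 128.
  rewrite leNgt; apply/negP => y1.
  have yb : bet * (1 / 128) < bet * y by rewrite ltr_pM2l.
  have yb' : bet < 128 * (bet * y) by lra.
  have : bet < gam.
    apply: lt_le_trans yk; apply: (lt_le_trans yb').
    by rewrite -addrA lerDl addr_ge0// mulr_ge0// divr_ge0.
  by rewrite ltNge gam_bet.
have y2 : mw * y * y <= mw * y * (1 / 128) by rewrite ler_wpM2l.
have y3 : mw * y * y * y <= mw * y * (1 / 128) * 1.
  by apply: ler_pM => //; [rewrite mulr_ge0|lra].
have -> : theta x = (4 * y + 4 * (bet * y) + 8 * (mw * y)) + 18 * (mw * y * y) + 40 / 3 * (mw * y * y * y).
  by rewrite /theta ey; ring.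
by lra.
Qed.

Lemma dissip_ge0 k t : 0 <= gam / 4 * prim (SJ k) t.
Proof.
apply: mulr_ge0; first by rewrite divr_ge0 ?ltW.
by apply: prim_ge0 => u; exact: SJ_ge0.
Qed.

(* Of the dissipation [31/64 gam] kept by the majorants, the nonlinearity
   consumes at most [15/64 gam]; a quarter of [gam] is left. *)
Lemma energy k t : 0 <= t -> SA k t + gam / 4 * prim (SJ k) t <= Z.
Proof.
elim: k t => [|k IH] t t0.
  rewrite /SA big_nil add0r (_ : SJ 0 = fun=> 0) ?prim0 ?mulr0 ?Z_ge0//.
  by apply/funext => s; rewrite /SJ big_nil.
(* The forcing of iterate k + 1 involves iterate k alone, whose size is known by induction. *)
have SAZ s : 0 <= s -> SA k s <= Z.
  move=> s0; apply: le_trans (IH s s0); by rewrite lerDl dissip_ge0.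
have E : SA k.+1 t + 31 / 64 * gam * prim (SJ k.+1) t =
    \sum_(a <- forest k.+1) init a + prim (fun s => \sum_(a <- forest k.+1) majforce a s) t.
  rewrite /SJ !prim_sum; last 2 first.
    by move=> a; apply: cont_scale; exact: maj_cont.
    by move=> a; exact: majforce_cont.
  rewrite mulr_sumr /SA -!big_split /=; apply: eq_bigr => a _.
  rewrite -maj_balance// primZ /kap; last exact: maj_cont.
  by ring.
have I : \sum_(a <- forest k.+1) init a <= Z.
  rewrite sum_forestS sum_leaves /= -[leRHS]addr0 -[leRHS]addr0 -[leRHS]addr0.
  apply: lerD; [apply: lerD; [apply: lerD; first exact: radZ|]|].
  - by rewrite big1// => a _; rewrite big1.
  - by rewrite big1// => a _; rewrite big1// => b _; rewrite big1.
  - by rewrite big1// => a _; rewrite big1// => b _; rewrite big1// => c _; rewrite big1.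
(* The forcing is measured with [SJ k], then enlarged to [SJ k.+1] so that the dissipation of
   iterate k + 1 absorbs it. *)
have F : prim (fun s => \sum_(a <- forest k.+1) majforce a s) t <= 15 / 64 * gam * prim (SJ k.+1) t.
  rewrite -primZ; last exact: SJ_cont.
  apply: prim_le.
  - by apply: continuous_bigsum => a; exact: majforce_cont.
  - by apply: cont_scale; exact: SJ_cont.
  move=> s s0 _; apply: le_trans (sum_majforce_le k s0) _.
  apply: ler_pM; [|exact: SJ_ge0| |exact: SJ_le].
  - by apply: theta_ge0; exact: SA_ge0.
  - by apply: theta_le; [exact: SA_ge0|exact: SAZ].
by lra.
Qed.

Lemma SA_bound k t : 0 <= t -> SA k t <= Z.
Proof.
move=> t0; apply: le_trans (energy k t0); by rewrite lerDl dissip_ge0.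
Qed.

(** * Weak formulation of the iterates *)

Definition arg (a : tree) (x : R) : R := nu a * x + phase a.

(* [ptrig j] is the [j]-th derivative of the cosine. *)
Definition ptrig (j : nat) (y : R) : R := cos (y + j%:R * (pi / 2)).

Lemma ptrig0 y : ptrig 0 y = cos y.
Proof. by rewrite /ptrig mul0r addr0. Qed.
Lemma ptrigS j y : ptrig j.+1 y = - sin (y + j%:R * (pi / 2)).
Proof. by rewrite /ptrig -natr1 mulrDl mul1r addrA cosDpihalf. Qed.
Lemma ptrig1 y : ptrig 1 y = - sin y.
Proof. by rewrite ptrigS mul0r addr0. Qed.
Lemma ptrig2 y : ptrig 2 y = - cos y.
Proof. by rewrite ptrigS mul1r sinDpihalf. Qed.
Lemma ptrig3 y : ptrig 3 y = sin y.
Proof.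
rewrite ptrigS (_ : 2%:R * (pi / 2) = pi :> R); last by field.
by rewrite sinDpi opprK.
Qed.

Lemma ptrig_le1 j y : `|ptrig j y| <= 1.
Proof. by rewrite ler_norml cos_geN1 cos_le1. Qed.

Lemma arg_derive a (x : R) : is_derive x 1 (arg a) (nu a).
Proof.
have d := is_deriveD (is_deriveZ (nu a) (is_derive_id x 1)) (is_derive_cst (phase a) x 1).
by apply: (is_derive_eq d); rewrite addr0 /GRing.scale /= mulr1.
Qed.

Lemma ptrig_derive j a (x : R) :
  is_derive x 1 (fun x => ptrig j (arg a x)) (nu a * ptrig j.+1 (arg a x)).
Proof.
have d := is_deriveD (arg_derive a x) (is_derive_cst (j%:R * (pi / 2)) x 1).
rewrite ptrigS.
have dc := is_derive_cos (arg a x + j%:R * (pi / 2)).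
by apply: (is_derive_eq (@is_derive1_comp _ cos _ x _ _ dc d)); rewrite addr0 mulrC.
Qed.

Lemma arg_cont a : continuous (arg a).
Proof.
apply: (@cont_add _ (fun x => nu a * x) (fun=> phase a)); last by move=> x; exact: cvg_cst.
exact: mulrl_continuous.
Qed.

Lemma cos_arg_cont a : continuous (fun x => cos (arg a x)).
Proof. by move=> x; apply: continuous_comp; [exact: arg_cont|exact: continuous_cos]. Qed.

Lemma sin_arg_cont a : continuous (fun x => sin (arg a x)).
Proof. by move=> x; apply: continuous_comp; [exact: arg_cont|exact: continuous_sin]. Qed.

Definition term (j : nat) (a : tree) (t x : R) : R :=
  amp a t * nu a ^+ j * ptrig j (arg a x).

Definition part (k j : nat) (t x : R) : R := \sum_(a <- forest k) term j a t x.

Lemma term_le j a t x : 0 <= t -> (j <= 4)%N -> `|term j a t x| <= nu a ^+ 4 * maj a t.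
Proof.
move=> t0 j4; rewrite /term normrM; apply: (@le_trans _ _ (`|amp a t * nu a ^+ j| * 1)).
  by rewrite ler_wpM2l// ptrig_le1.
rewrite mulr1 normrM mulrC.
have [n0|n0] := eqVneq (freq a) 0.
  have [-> ->] := nu_eq0 (a := a) (etrans (congr1 intr n0) (mulr0z 1)) t.
  by rewrite normr0 !mulr0.
apply: ler_pM => //; last exact: amp_le_maj1.
rewrite normrX -(ger0_norm (nu4_ge0 a)) normrX.
by apply: ler_weXn2l => //; exact: intr_ge1.
Qed.

Lemma term0_le a t x : 0 <= t -> `|term 0 a t x| <= maj a t.
Proof.
move=> t0; rewrite /term mulr1 normrM; apply: le_trans (amp_le_maj1 a t0).
by rewrite ler_piMr// ptrig_le1.
Qed.

Lemma part_le k j t x : 0 <= t -> (j <= 4)%N -> `|part k j t x| <= SJ k t.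
Proof.
by move=> t0 j4; rewrite (le_trans (ler_norm_sum _ _ _))// ler_sum// => a _; exact: term_le.
Qed.

Lemma part0_le k t x : 0 <= t -> `|part k 0 t x| <= SA k t.
Proof.
by move=> t0; rewrite (le_trans (ler_norm_sum _ _ _))// ler_sum// => a _; exact: term0_le.
Qed.

Lemma part_dist k l j t x : 0 <= t -> (j <= 4)%N -> (k <= l)%N ->
  `|part l j t x - part k j t x| <= SJ l t - SJ k t.
Proof. by move=> t0 j4; apply: sum_forest_dist => a; exact: term_le. Qed.

Lemma part0_dist k l t x : 0 <= t -> (k <= l)%N ->
  `|part l 0 t x - part k 0 t x| <= SA l t - SA k t.
Proof. by move=> t0; apply: sum_forest_dist => a; exact: term0_le. Qed.

(* The sine series vanishes by conjugation, so that a sum over trees of shifted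
   cosines factorises: this turns interactions back into products of iterates. *)
Lemma sum_forest_odd (G : tree -> R) k :
  (forall a, G (conjt a) = - G a) -> \sum_(a <- forest k) G a = 0.
Proof.
move=> GN; have := sum_forest_conjt G k.
rewrite (eq_bigr (fun a => - G a)) => [|a _]; last exact: GN.
by rewrite sumrN; lra.
Qed.

Lemma arg_conjt a x : arg (conjt a) x = - arg a x.
Proof. by rewrite /arg nu_conjt phase_conjt mulNr opprD. Qed.

Lemma sum_shift_cos k t x y :
  \sum_(b <- forest k) amp b t * cos (arg b x + y) = part k 0 t x * cos y.
Proof.
transitivity (\sum_(b <- forest k) amp b t * cos (arg b x) * cos y
   - (\sum_(b <- forest k) amp b t * sin (arg b x)) * sin y).
  rewrite mulr_suml -sumrB; apply: eq_bigr => b _.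
  by rewrite cosD; ring.
rewrite [X in _ - X * _]sum_forest_odd ?mul0r ?subr0; last first.
  by move=> a; rewrite amp_conjt arg_conjt sinN mulrN.
rewrite /part mulr_suml; apply: eq_bigr => b _.
by rewrite /term ptrig0 expr0 mulr1.
Qed.

Lemma sum_shift_sin k t x y :
  \sum_(b <- forest k) amp b t * sin (arg b x + y) = part k 0 t x * sin y.
Proof.
transitivity ((\sum_(b <- forest k) amp b t * sin (arg b x)) * cos y +
   \sum_(b <- forest k) amp b t * cos (arg b x) * sin y).
  rewrite mulr_suml -big_split /=; apply: eq_bigr => b _.
  by rewrite sinD; ring.
rewrite [X in X * _ + _]sum_forest_odd ?mul0r ?add0r; last first.
  by move=> a; rewrite amp_conjt arg_conjt sinN mulrN.
rewrite /part mulr_suml; apply: eq_bigr => b _.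
by rewrite /term ptrig0 expr0 mulr1.
Qed.

(** * From interactions of trees to products of iterates *)

Section Flux.
Variables (g1 g2 : R -> R) (t : R).

(** What one interaction contributes to the integrand of the weak form, g1 and g2 standing for the
    first and second space derivatives of the test function. The factors mw, mw, mw / 3 come from
    [(1 + eps z)^3 / 3] beyond its constant term. *)
Definition flux (a : tree) (x : R) : R :=
  match a with
  | Leaf _ _ => 0
  | Node2 b c => eps * (amp b t * amp c t) *
      ((nu c + bet * nu c ^+ 3) * sin (arg a x) * g1 x - mw * nu c ^+ 2 * cos (arg a x) * g2 x)
  | Node3 b c d => - (eps ^+ 2 * mw * (amp b t * amp c t * amp d t)) *
      (nu d ^+ 2 * cos (arg a x) * g2 x)
  | Node4 b c d e => - (eps ^+ 3 * (mw / 3) * (amp b t * amp c t * amp d t * amp e t)) *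
      (nu e ^+ 2 * cos (arg a x) * g2 x)
  end.

(** Summing over one undifferentiated child at a time extracts a factor [part k 0] and removes that
    child from the argument; the last child, alone, sums to a derivative of the iterate. *)
Lemma sum_flux k x : \sum_(a <- forest k.+1) flux a x =
  eps * part k 0 t x * (- part k 1 t x + bet * part k 3 t x) * g1 x
  + mw * (eps * part k 0 t x + eps ^+ 2 * part k 0 t x ^+ 2
           + eps ^+ 3 / 3 * part k 0 t x ^+ 3) * part k 2 t x * g2 x.
Proof.
rewrite sum_forestS big1_seq ?add0r; last by move=> a /=; rewrite mem_leaves; case: a.
have a2 b c : arg (Node2 b c) x = arg b x + arg c x by rewrite /arg /nu /= intrD; ring.
have a3 b c d : arg (Node3 b c d) x = arg b x + (arg c x + arg d x).
  by rewrite /arg /nu /= !intrD; ring.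
have a4 b c d e : arg (Node4 b c d e) x = arg b x + (arg c x + (arg d x + arg e x)).
  by rewrite /arg /nu /= !intrD; ring.
set P := part k 0 t x.
have E2 : \sum_(b <- forest k) \sum_(c <- forest k) flux (Node2 b c) x =
    P * (eps * (- part k 1 t x + bet * part k 3 t x) * g1 x + eps * mw * part k 2 t x * g2 x).
  rewrite exchange_big /=.
  transitivity (\sum_(c <- forest k) P * (amp c t * (eps *
     ((nu c + bet * nu c ^+ 3) * g1 x * sin (arg c x) - mw * nu c ^+ 2 * g2 x * cos (arg c x))))).
    apply: eq_bigr => c _.
    transitivity (\sum_(b <- forest k) ((eps * amp c t * ((nu c + bet * nu c ^+ 3) * g1 x))
       * (amp b t * sin (arg b x + arg c x)) -
       (eps * amp c t * (mw * nu c ^+ 2 * g2 x)) * (amp b t * cos (arg b x + arg c x)))).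
      by apply: eq_bigr => b _; rewrite a2; ring.
    rewrite sumrB -!mulr_sumr sum_shift_sin sum_shift_cos -/P; ring.
  rewrite -mulr_sumr; congr (_ * _).
  rewrite /part -sumrN !mulr_sumr -big_split /= !mulr_sumr !mulr_suml -big_split /=.
  apply: eq_bigr => c _; rewrite /term ptrig1 ptrig2 ptrig3; ring.
have E3 : \sum_(b <- forest k) \sum_(c <- forest k) \sum_(d <- forest k) flux (Node3 b c d) x =
    P * (P * (eps ^+ 2 * mw * part k 2 t x * g2 x)).
  transitivity (\sum_(c <- forest k) \sum_(d <- forest k)
     P * (amp c t * (amp d t * (- (eps ^+ 2 * mw) * (nu d ^+ 2 * g2 x)) * cos (arg c x + arg d x)))).
    rewrite exchange_big /=; apply: eq_bigr => c _.
    rewrite exchange_big /=; apply: eq_bigr => d _.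
    transitivity (\sum_(b <- forest k) (- (eps ^+ 2 * mw * amp c t * amp d t * (nu d ^+ 2 * g2 x)))
       * (amp b t * cos (arg b x + (arg c x + arg d x)))).
      by apply: eq_bigr => b _; rewrite a3; ring.
    rewrite -mulr_sumr sum_shift_cos -/P; ring.
  under eq_bigr do rewrite -mulr_sumr.
  rewrite -mulr_sumr; congr (_ * _).
  rewrite exchange_big /=.
  transitivity (\sum_(d <- forest k) P * (amp d t * (- (eps ^+ 2 * mw) * (nu d ^+ 2 * g2 x)) * cos (arg d x))).
    apply: eq_bigr => d _.
    transitivity (\sum_(c <- forest k) (amp d t * (- (eps ^+ 2 * mw) * (nu d ^+ 2 * g2 x)))
       * (amp c t * cos (arg c x + arg d x))).
      by apply: eq_bigr => c _; ring.
    rewrite -mulr_sumr sum_shift_cos -/P; ring.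
  rewrite -mulr_sumr; congr (_ * _).
  rewrite /part mulr_sumr mulr_suml.
  apply: eq_bigr => d _; rewrite /term ptrig2; ring.
have E4 : \sum_(b <- forest k) \sum_(c <- forest k) \sum_(d <- forest k) \sum_(e <- forest k)
    flux (Node4 b c d e) x = P * (P * (P * (eps ^+ 3 * (mw / 3) * part k 2 t x * g2 x))).
  transitivity (\sum_(c <- forest k) \sum_(d <- forest k) \sum_(e <- forest k)
     P * (amp c t * (amp d t * (amp e t * (- (eps ^+ 3 * (mw / 3)) * (nu e ^+ 2 * g2 x))
       * cos (arg c x + (arg d x + arg e x)))))).
    rewrite exchange_big /=; apply: eq_bigr => c _.
    rewrite exchange_big /=; apply: eq_bigr => d _.
    rewrite exchange_big /=; apply: eq_bigr => e _.
    transitivity (\sum_(b <- forest k)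
       (- (eps ^+ 3 * (mw / 3) * amp c t * amp d t * amp e t * (nu e ^+ 2 * g2 x)))
       * (amp b t * cos (arg b x + (arg c x + (arg d x + arg e x))))).
      by apply: eq_bigr => b _; rewrite a4; ring.
    rewrite -mulr_sumr sum_shift_cos -/P; ring.
  do 2 under eq_bigr do under eq_bigr do rewrite -mulr_sumr.
  under eq_bigr do rewrite -mulr_sumr.
  rewrite -mulr_sumr; congr (_ * _).
  transitivity (\sum_(d <- forest k) \sum_(e <- forest k)
     P * (amp d t * (amp e t * (- (eps ^+ 3 * (mw / 3)) * (nu e ^+ 2 * g2 x)) * cos (arg d x + arg e x)))).
    rewrite exchange_big /=; apply: eq_bigr => d _.
    under eq_bigr do rewrite mulr_sumr.
    rewrite exchange_big /=; apply: eq_bigr => e _.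
    transitivity (\sum_(c <- forest k) (amp d t * amp e t * (- (eps ^+ 3 * (mw / 3)) * (nu e ^+ 2 * g2 x)))
       * (amp c t * cos (arg c x + (arg d x + arg e x)))).
      by apply: eq_bigr => c _; ring.
    rewrite -mulr_sumr sum_shift_cos -/P; ring.
  under eq_bigr do rewrite -mulr_sumr.
  rewrite -mulr_sumr; congr (_ * _).
  rewrite exchange_big /=.
  transitivity (\sum_(e <- forest k) P * (amp e t * (- (eps ^+ 3 * (mw / 3)) * (nu e ^+ 2 * g2 x)) * cos (arg e x))).
    apply: eq_bigr => e _.
    transitivity (\sum_(d <- forest k) (amp e t * (- (eps ^+ 3 * (mw / 3)) * (nu e ^+ 2 * g2 x)))
       * (amp d t * cos (arg d x + arg e x))).
      by apply: eq_bigr => d _; ring.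
    rewrite -mulr_sumr sum_shift_cos -/P; ring.
  rewrite -mulr_sumr; congr (_ * _).
  rewrite /part mulr_sumr mulr_suml.
  apply: eq_bigr => d _; rewrite /term ptrig2; ring.
by rewrite E2 E3 E4; field.
Qed.

End Flux.

Lemma derive_periodic (f g : R -> R) : (forall x : R, is_derive x 1 f (g x)) ->
  periodic2pi f -> periodic2pi g.
Proof.
move=> df pf x.
have ds : is_derive x 1 (fun y => y + 2 * pi : R) 1.
  have d := is_deriveD (is_derive_id x 1) (is_derive_cst (2 * pi) x 1).
  by apply: (is_derive_eq d); rewrite addr0.
have := @is_derive1_comp _ f (fun y => y + 2 * pi) x _ _ (df _) ds.
rewrite (_ : f \o _ = f) ?mulr1; last by apply/funext => y /=; exact: pf.
by move=> [_ <-]; have [_ ->] := df x.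
Qed.

Lemma ptrig_periodic j a : periodic2pi (fun x => ptrig j (arg a x)).
Proof.
move=> x; rewrite /ptrig /arg -[RHS](cosD_int2pi (freq a)); congr cos.
by rewrite /nu; ring.
Qed.

Lemma ptrig_cont j a : continuous (fun x => ptrig j (arg a x)).
Proof. exact: derive_cont (ptrig_derive j a). Qed.

Lemma intT_ptrig j a (f f1 : R -> R) : (forall x : R, is_derive x 1 f (f1 x)) ->
  continuous f1 -> periodic2pi f ->
  intT (fun x => ptrig j (arg a x) * f1 x) = - nu a * intT (fun x => ptrig j.+1 (arg a x) * f x).
Proof.
move=> df cf1 pf.
rewrite (intT_ibp (ptrig_derive j a) df) //; last exact: ptrig_periodic.
  rewrite mulNr !intT_prim -primZ; last first.
    by apply: cont_mul; [exact: ptrig_cont|exact: derive_cont df].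
  by congr (- prim _ _); apply/funext => x; rewrite mulrA.
by apply: cont_scale; exact: ptrig_cont.
Qed.

Lemma part0E k t x : part k 0 t x = \sum_(a <- forest k) amp a t * cos (arg a x).
Proof. by apply: eq_bigr => a _; rewrite /term ptrig0 expr0 mulr1. Qed.

Lemma intT_part_mul k t (g : R -> R) : continuous g ->
  intT (fun x => part k 0 t x * g x) =
  \sum_(a <- forest k) amp a t * intT (fun x => cos (arg a x) * g x).
Proof.
move=> cg.
have c a : continuous (fun x => cos (arg a x) * g x) by apply: cont_mul => //; exact: cos_arg_cont.
transitivity (intT (fun x => \sum_(a <- forest k) amp a t * (cos (arg a x) * g x))).
  congr intT; apply/funext => x; rewrite part0E mulr_suml.
  by apply: eq_bigr => a _; rewrite mulrA.
rewrite intT_prim prim_sum; last by move=> a; exact: cont_scale.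
by apply: eq_bigr => a _; rewrite primZ.
Qed.

(** * Pairing with a test function in space *)

Section SpaceTest.
Variables f f1 f2 : R -> R.
Hypotheses (df : forall x : R, is_derive x 1 f (f1 x))
  (df1 : forall x : R, is_derive x 1 f1 (f2 x))
  (cf2 : continuous f2) (pf : periodic2pi f).

Definition coef a : R := intT (fun x => cos (arg a x) * f x).

Lemma intT_sin_derive a : intT (fun x => sin (arg a x) * f1 x) = - nu a * coef a.
Proof.
rewrite /coef; under eq_fun do rewrite -ptrig3.
rewrite (intT_ptrig _ _ df) //; last exact: derive_cont df1.
congr (_ * _); congr intT; apply/funext => x; congr (_ * _).
rewrite ptrigS (_ : arg a x + 3%:R * (pi / 2) = arg a x + pi + pi / 2); last by field.
by rewrite sinDpihalf cosDpi opprK.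
Qed.

Lemma intT_cos_derive2 a : intT (fun x => cos (arg a x) * f2 x) = - nu a ^+ 2 * coef a.
Proof.
under eq_fun do rewrite -ptrig0.
rewrite (intT_ptrig _ _ df1) //; last exact: derive_periodic pf.
rewrite (intT_ptrig _ _ df) //; last exact: derive_cont df1.
rewrite mulrA mulrNN -expr2 mulNr -mulrN; congr (_ * _).
rewrite /coef !intT_prim -mulN1r -primZ.
  by congr prim; apply/funext => x; rewrite ptrig2 mulNr mulN1r.
by apply: cont_mul; [exact: cos_arg_cont|exact: derive_cont df].
Qed.

Lemma intT_comb a (A B : R) :
  intT (fun x => A * (sin (arg a x) * f1 x) + B * (cos (arg a x) * f2 x)) =
  (- A * nu a - B * nu a ^+ 2) * coef a.
Proof.
have c1 : continuous (fun x => sin (arg a x) * f1 x).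
  by apply: cont_mul; [exact: sin_arg_cont|exact: derive_cont df1].
have c2 : continuous (fun x => cos (arg a x) * f2 x).
  by apply: cont_mul => //; exact: cos_arg_cont.
rewrite intT_prim primD; [|exact: cont_scale..].
rewrite !primZ// -!intT_prim intT_sin_derive intT_cos_derive2; ring.
Qed.

(** Integration by parts moves the derivatives from the test function to the mode and so produces
    the output frequency of the multiplier. *)
Lemma intT_flux a t : intT (flux f1 f2 t a) = force a t * coef a.
Proof.
case: a => [s m|b c|b c d|b c d e].
- by rewrite intT_prim prim0 mul0r.
- pose k := eps * (amp b t * amp c t); pose n := nu (Node2 b c).
  transitivity (intT (fun x => (k * (nu c + bet * nu c ^+ 3)) * (sin (arg (Node2 b c) x) * f1 x)
      + (- (k * mw * nu c ^+ 2)) * (cos (arg (Node2 b c) x) * f2 x))).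
    by congr intT; apply/funext => x; rewrite /= -/k; ring.
  by rewrite intT_comb; congr (_ * _); rewrite /= -/n /sym2 /k; ring.
- pose k := eps ^+ 2 * mw * (amp b t * amp c t * amp d t); pose n := nu (Node3 b c d).
  transitivity (intT (fun x => 0 * (sin (arg (Node3 b c d) x) * f1 x)
      + (- (k * nu d ^+ 2)) * (cos (arg (Node3 b c d) x) * f2 x))).
    by congr intT; apply/funext => x; rewrite /= -/k; ring.
  by rewrite intT_comb; congr (_ * _); rewrite /= -/n /sym3 /k; ring.
- pose k := eps ^+ 3 * (mw / 3) * (amp b t * amp c t * amp d t * amp e t).
  pose n := nu (Node4 b c d e).
  transitivity (intT (fun x => 0 * (sin (arg (Node4 b c d e) x) * f1 x)
      + (- (k * nu e ^+ 2)) * (cos (arg (Node4 b c d e) x) * f2 x))).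
    by congr intT; apply/funext => x; rewrite /= -/k; ring.
  by rewrite intT_comb; congr (_ * _); rewrite /= -/n /sym4 /k; ring.
Qed.

Lemma flux_cont a t : continuous (flux f1 f2 t a).
Proof.
have cf1 := derive_cont df1.
case: a => [s m|b c|b c d|b c d e]; rewrite /flux; first by move=> x; exact: cvg_cst.
- apply: cont_scale => x; apply: cvgB; move: x.
  + apply: cont_mul => //; apply: cont_scale; exact: sin_arg_cont.
  + apply: cont_mul => //; apply: cont_scale; exact: cos_arg_cont.
- by apply/cont_scale/cont_mul => //; apply: cont_scale; exact: cos_arg_cont.
- by apply/cont_scale/cont_mul => //; apply: cont_scale; exact: cos_arg_cont.
Qed.

Definition linflux (t : R) (a : tree) (x : R) : R :=
  amp a t * (nu a + bet * nu a ^+ 3) * (sin (arg a x) * f1 x)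
  + - (mw / 3 * amp a t * nu a ^+ 2) * (cos (arg a x) * f2 x).

Lemma linflux_cont a t : continuous (linflux t a).
Proof.
have cf1 := derive_cont df1.
apply: cont_add; apply: cont_scale; apply: cont_mul => //;
  [exact: sin_arg_cont|exact: cos_arg_cont].
Qed.

(** The term in bet damps at rate [bet n^4], the one in mw amplifies at rate [mw / 3 n^4]; their
    difference is the [gam n^4] of [lam]. *)
Lemma intT_linflux a t : intT (linflux t a) = - lam (nu a) * amp a t * coef a.
Proof. by rewrite intT_comb; congr (_ * _); rewrite /lam gamE; field. Qed.

Lemma sum_linflux k t x : \sum_(a <- forest k) linflux t a x =
  (- part k 1 t x + bet * part k 3 t x) * f1 x + mw / 3 * part k 2 t x * f2 x.
Proof.
rewrite /part -sumrN !mulr_sumr -!big_split /= !mulr_suml -big_split /=.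
apply: eq_bigr => a _; rewrite /linflux /term ptrig1 ptrig2 ptrig3; ring.
Qed.

Definition rhs (k : nat) (t x : R) : R :=
  ((- part k.+1 1 t x + bet * part k.+1 3 t x) * f1 x + mw / 3 * part k.+1 2 t x * f2 x)
  + (eps * part k 0 t x * (- part k 1 t x + bet * part k 3 t x) * f1 x
     + mw * (eps * part k 0 t x + eps ^+ 2 * part k 0 t x ^+ 2
           + eps ^+ 3 / 3 * part k 0 t x ^+ 3) * part k 2 t x * f2 x).

Lemma intT_rhs k t : intT (rhs k t) =
  \sum_(a <- forest k.+1) (- lam (nu a) * amp a t + force a t) * coef a.
Proof.
have -> : rhs k t = fun x => \sum_(a <- forest k.+1) (linflux t a x + flux f1 f2 t a x).
  by apply/funext => x; rewrite big_split /= sum_linflux sum_flux.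
rewrite intT_prim prim_sum; last first.
  by move=> a; apply: cont_add; [exact: linflux_cont|exact: flux_cont].
apply: eq_bigr => a _; rewrite primD; [|exact: linflux_cont|exact: flux_cont].
by rewrite -!intT_prim intT_linflux intT_flux mulrDl.
Qed.

End SpaceTest.

(** * Pairing with a test function in space and time *)

Section SpaceTimeTest.
Variable phi : R -> R -> R.
Hypotheses (sphi : smooth2 phi) (pphi : forall t x, phi t (x + 2 * pi) = phi t x).

Lemma phi_cont : cont2 phi. Proof. by have [] := sphi [::]. Qed.
Lemma pdt_cont : cont2 (pdt phi). Proof. by have [] := sphi [:: true]. Qed.
Lemma pdx_cont : cont2 (pdx phi). Proof. by have [] := sphi [:: false]. Qed.
Lemma pdxx_cont : cont2 (pdx (pdx phi)). Proof. by have [] := sphi [:: false; false]. Qed.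

Lemma phi_dt (t x : R) : is_derive t 1 (phi ^~ x) (pdt phi t x).
Proof.
have [_ /(_ t x)[d _]] := sphi [::].
by apply: DeriveDef => //; rewrite /pdt derive1E.
Qed.

Lemma phi_dx (t x : R) : is_derive x 1 (phi t) (pdx phi t x).
Proof.
have [_ /(_ t x)[_ d]] := sphi [::].
by apply: DeriveDef => //; rewrite /pdx derive1E.
Qed.

Lemma phi_dxx (t x : R) : is_derive x 1 (pdx phi t) (pdx (pdx phi) t x).
Proof.
have [_ /(_ t x)[_ d]] := sphi [:: false].
apply: DeriveDef; first exact: d.
by rewrite -derive1E.
Qed.

Definition ct a s : R := coef (phi s) a.
Definition ct' a s : R := coef (pdt phi s) a.

Lemma ct_derive a (s : R) : is_derive s 1 (ct a) (ct' a s).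
Proof.
apply: (@intT_derive _ (fun s x => cos (arg a x) * phi s x)
                       (fun s x => cos (arg a x) * pdt phi s x)).
- by apply: cont2_mul; [apply: cont2_snd; exact: cos_arg_cont|exact: phi_cont].
- by apply: cont2_mul; [apply: cont2_snd; exact: cos_arg_cont|exact: pdt_cont].
- move=> t x; exact: (is_deriveZ (cos (arg a x)) (phi_dt t x)).
Qed.

Lemma ct'_cont a : continuous (ct' a).
Proof.
apply: (@intT_cont _ (fun s x => cos (arg a x) * pdt phi s x)).
by apply: cont2_mul; [apply: cont2_snd; exact: cos_arg_cont|exact: pdt_cont].
Qed.

Lemma time_ibp a t : 0 <= t ->
  prim (fun s => (- lam (nu a) * amp a s + force a s) * ct a s + amp a s * ct' a s) t =
  amp a t * ct a t - amp a 0 * ct a 0.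
Proof.
move=> t0.
have cc : continuous (ct a) := derive_cont (ct_derive a).
have c1 : continuous (fun s => - lam (nu a) * amp a s + force a s).
  by apply: cont_add; [apply: cont_scale; exact: amp_cont|exact: force_cont].
apply: (@Rint_FTC _ (fun s => amp a s * ct a s)) => //.
- by apply: cont_add; apply: cont_mul => //; [exact: amp_cont|exact: ct'_cont].
- by apply: cont_mul => //; exact: amp_cont.
- move=> s s0 _; have d := is_deriveM (amp_derive a s0) (ct_derive a s).
  by apply: (is_derive_eq d); rewrite /GRing.scale /=; ring.
Qed.

(** Tree by tree this is the product rule in time for amplitude times coefficient; the forces of the
    nodes at level k + 1 recombine into the nonlinear terms of level k. *)
Lemma weak_part k t : 0 <= t ->
  intT (fun x => part k.+1 0 t x * phi t x) - intT (fun x => part k.+1 0 0 x * phi 0 x)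
  - prim (fun s => intT (fun x => part k.+1 0 s x * pdt phi s x)) t =
  prim (fun s => intT (rhs (pdx phi s) (pdx (pdx phi) s) k s)) t.
Proof.
move=> t0.
have cc a : continuous (ct a) := derive_cont (ct_derive a).
have c1 a : continuous (fun s => (- lam (nu a) * amp a s + force a s) * ct a s).
  apply: cont_mul => //.
  by apply: cont_add; [apply: cont_scale; exact: amp_cont|exact: force_cont].
have c2 a : continuous (fun s => amp a s * ct' a s).
  by apply: cont_mul; [exact: amp_cont|exact: ct'_cont].
have -> : (fun s => intT (rhs (pdx phi s) (pdx (pdx phi) s) k s)) =
    (fun s => \sum_(a <- forest k.+1) (- lam (nu a) * amp a s + force a s) * ct a s).
  apply/funext => s; rewrite (intT_rhs (phi_dx s) (phi_dxx s))//.
  exact: cont2_row pdxx_cont.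
have -> : (fun s => intT (fun x => part k.+1 0 s x * pdt phi s x)) =
    (fun s => \sum_(a <- forest k.+1) amp a s * ct' a s).
  by apply/funext => s; rewrite intT_part_mul//; exact: cont2_row pdt_cont.
have cphi s : continuous (phi s) := cont2_row phi_cont.
rewrite !intT_part_mul// !prim_sum//.
apply/eqP; rewrite subr_eq -big_split -sumrB /=; apply/eqP; apply: eq_bigr => a _.
by rewrite -primD// time_ibp.
Qed.

End SpaceTimeTest.

(** * The limit of the iterates *)

Lemma SJ_homo t : 0 <= t -> {homo (fun k => (SJ k t)%:E) : m n / (m <= n)%N >-> (m <= n)%E}.
Proof. by move=> t0 m n mn; rewrite lee_fin; exact: SJ_le. Qed.

Lemma SA_homo t : 0 <= t -> {homo (fun k => SA k t) : m n / (m <= n)%N >-> m <= n}.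
Proof. by move=> t0 m n mn; exact: SA_le. Qed.

Lemma prim_SJ_homo t : 0 <= t -> {homo (fun k => prim (SJ k) t) : m n / (m <= n)%N >-> m <= n}.
Proof.
by move=> t0 m n mn; apply: prim_le; [exact: SJ_cont..|move=> s s0 _; exact: SJ_le].
Qed.

(** An upper limit is measurable in t without any convergence; for t >= 0 it is the limit, possibly
    infinite. *)
Definition Joo (t : R) : \bar R := limn_esup (fun k => (SJ k t)%:E).
Definition SAoo (t : R) : R := limn (fun k => SA k t).
Definition Poo (t : R) : R := limn (fun k => prim (SJ k) t).

Lemma JooE t : 0 <= t -> Joo t = limn (fun k => (SJ k t)%:E).
Proof.
by move=> t0; apply: is_cvg_limn_esupE; apply: ereal_nondecreasing_is_cvgn; exact: SJ_homo.
Qed.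

Lemma Joo_meas : measurable_fun setT Joo.
Proof.
apply: measurable_fun_limn_esup => k; apply/measurable_EFinP.
by apply: continuous_measurable_fun; exact: SJ_cont.
Qed.

Lemma SJ_le_Joo k t : 0 <= t -> ((SJ k t)%:E <= Joo t)%E.
Proof.
move=> t0; rewrite JooE// (cvg_lim _ (ereal_nondecreasing_cvgn (SJ_homo t0)))//.
by apply: ereal_sup_ubound; exists k.
Qed.

Lemma Joo_ge0 t : 0 <= t -> (0 <= Joo t)%E.
Proof. by move=> t0; apply: le_trans (SJ_le_Joo 0 t0); rewrite lee_fin SJ_ge0. Qed.

Lemma SA_cvg t : 0 <= t -> SA k t @[k --> \oo] --> SAoo t.
Proof.
move=> t0; apply: nondecreasing_is_cvgn; first exact: SA_homo.
by exists Z => _ [k _ <-]; exact: SA_bound.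
Qed.

Lemma prim_SJ_cvg t : 0 <= t -> prim (SJ k) t @[k --> \oo] --> Poo t.
Proof.
move=> t0; apply: nondecreasing_is_cvgn; first exact: prim_SJ_homo.
exists (Z / (gam / 4)) => _ [k _ <-]; rewrite ler_pdivlMr ?divr_gt0// mulrC.
by apply: le_trans (energy k t0); rewrite lerDr SA_ge0.
Qed.

Lemma energy_oo t : 0 <= t -> SAoo t + gam / 4 * Poo t <= Z.
Proof.
move=> t0.
have c : SA k t + gam / 4 * prim (SJ k) t @[k --> \oo] --> SAoo t + gam / 4 * Poo t.
  by apply: cvgD; [exact: SA_cvg|apply: cvgM; [exact: cvg_cst|exact: prim_SJ_cvg]].
rewrite -(cvg_lim _ c)//; apply: limr_le; first by apply/cvg_ex; eexists; exact: c.
by apply: nearW => k; exact: energy.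
Qed.

(** Monotone convergence. The right side is finite by the energy bound, hence [Joo] is finite at
    almost every time. *)
Lemma Joo_int (t : R) : 0 <= t -> (\int[mu]_(s in `[0%R, t]) Joo s)%E = (Poo t)%:E.
Proof.
move=> t0.
have -> : (\int[mu]_(s in `[0%R, t]) Joo s =
    \int[mu]_(s in `[0%R, t]) (fun s => limn (fun k => (SJ k s)%:E)) s)%E.
  by apply: eq_integral => s; rewrite inE/= in_itv/= => /andP[s0 _]; exact: JooE.
rewrite (@monotone_convergence _ _ _ mu `[0%R, t] _ (fun k s => (SJ k s)%:E))//.
- apply/cvg_lim => //.
  have -> : (fun n => \int[mu]_(x in `[0%R, t]) (SJ n x)%:E)%E = EFin \o (fun k => prim (SJ k) t).
    apply/funext => k /=; rewrite /prim /Rintegral fineK//.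
    by apply: integrable_fin_num => //; apply: cont_integrable; exact: SJ_cont.
  by apply: cvg_EFin; [exact: nearW|exact: prim_SJ_cvg].
- move=> k; apply/measurable_EFinP; apply: measurable_funTS.
  by apply: continuous_measurable_fun; exact: SJ_cont.
- by move=> k s /=; rewrite in_itv/= => /andP[s0 _]; rewrite lee_fin SJ_ge0.
- by move=> s /=; rewrite in_itv/= => /andP[s0 _]; exact: SJ_homo.
Qed.

Definition good (t : R) : bool := (0 <= t) && (Joo t < +oo)%E.
Definition Bd (t : R) : R := fine (Joo t).

Lemma Bd_ge0 t : 0 <= t -> 0 <= Bd t.
Proof. by move=> t0; rewrite /Bd fine_ge0// Joo_ge0. Qed.

Lemma good_ge0 t : good t -> 0 <= t. Proof. by case/andP. Qed.

Lemma SJ_le_Bd k t : good t -> SJ k t <= Bd t.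
Proof.
case/andP => t0 Jt; rewrite -lee_fin fineK ?SJ_le_Joo//.
by rewrite ge0_fin_numE// Joo_ge0.
Qed.

Lemma Joo_integrable (t : R) : mu.-integrable `[0, t] Joo.
Proof.
have [t0|t0] := leP 0 t; last first.
  by rewrite set_itv_ge ?bnd_simp -?ltNge//; exact: integrable_set0.
apply/integrableP; split; first by apply: measurable_funTS; exact: Joo_meas.
rewrite [X in (X < _)%E](_ : _ = (Poo t)%:E) ?ltry// -Joo_int//.
by apply: eq_integral => s; rewrite inE/= in_itv/= => /andP[s0 _]; rewrite gee0_abs// Joo_ge0.
Qed.

Lemma ae_good (t : R) : {ae mu, forall s, s \in `[0, t] -> good s}.
Proof.
have mI : measurable (`[0, t]%classic : set (measurableTypeR R)) by [].
have := integrable_ae mI (Joo_integrable t).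
apply: (@filterS _ _ (ae_filter_ringOfSetsType mu)) => s h st.
move: (st); rewrite in_itv/= => /andP[s0 _].
by rewrite /good s0 -ge0_fin_numE ?Joo_ge0//; exact: h.
Qed.

Lemma Bd_integrable (t : R) : mu.-integrable `[0, t] (EFin \o Bd).
Proof.
apply: (le_integrable _ _ _ (Joo_integrable t)) => //.
  apply/measurable_EFinP; apply: measurable_funTS.
  by apply: measurableT_comp => //; exact: Joo_meas.
move=> s /=; rewrite in_itv/= => /andP[s0 _].
rewrite (gee0_abs (Joo_ge0 s0)) ger0_norm ?Bd_ge0// /Bd.
by have [e|e] := boolP (Joo s \is a fin_num); [rewrite fineK|
  move: e (Joo_ge0 s0); rewrite fin_numE; case: (Joo s)].
Qed.

(* The derivatives of the solution are set to [0] at the exceptional times,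
   of measure zero, at which their series may diverge. *)
Definition dom (j : nat) (t : R) : bool := if j is 0 then 0 <= t else good t.

Lemma dom_ge0 j t : dom j t -> 0 <= t.
Proof. by case: j => // j; exact: good_ge0. Qed.

Lemma good_dom j t : good t -> dom j t.
Proof. by case: j => //= /good_ge0. Qed.

Definition dpart (k j : nat) (t x : R) : R := (dom j t)%:R * part k j t x.
Definition D (j : nat) (t x : R) : R := limn (fun k => dpart k j t x).

(** The increments are dominated by those of [SA] for j = 0 and of [SJ] for j > 0; the former is
    bounded at every t >= 0, the latter only at good times. *)
Lemma dpart_cvg j t x : (j <= 4)%N -> dpart k j t x @[k --> \oo] --> D j t x.
Proof.
move=> j4; rewrite /D /dpart; case: (boolP (dom j t)) => [d|_]; last first.
  by under eq_fun do rewrite mul0r; exact: is_cvg_cst.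
under eq_fun do rewrite mul1r.
case: j j4 d => [_ /= t0|j j4 gt].
  apply: (@cvgn_dist _ _ (SA ^~ t)) => [k l kl|]; first exact: part0_dist.
  by apply/cvg_ex; eexists; exact: SA_cvg.
have t0 := good_ge0 gt.
apply: (@cvgn_dist _ _ (SJ ^~ t)) => [k l kl|]; first exact: part_dist.
apply: nondecreasing_is_cvgn => [k l kl|]; first exact: SJ_le.
by exists (Bd t) => _ [k _ <-]; exact: SJ_le_Bd.
Qed.

Lemma D_periodic j t x : D j t (x + 2 * pi) = D j t x.
Proof.
rewrite /D; congr (lim (_ @ \oo)); apply/funext => k; congr (_ * _).
apply: eq_bigr => a _; congr (_ * _); exact: (ptrig_periodic j a x).
Qed.

Lemma good_meas : measurable_fun setT (fun t => (good t)%:R : R).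
Proof.
have m : measurable [set t | good t].
  rewrite (_ : [set t | good t] = `[0, +oo[ `&` (Joo @^-1` `]-oo, +oo%E[)).
    apply: measurableI => //; rewrite -[X in measurable X]setTI; apply: Joo_meas => //; exact: emeasurable_itv.
  by apply/seteqP; split => t /=; rewrite !in_itv/= andbT /good; [move=> /andP[-> ->]|move=> [-> ->]].
rewrite (_ : (fun t => _) = \1_[set t | good t]); first exact: measurable_indic.
by apply/funext => t; rewrite indicE mem_setE.
Qed.

Lemma dom_meas j : measurable_fun setT (fun t => (dom j t)%:R : R).
Proof.
case: j => [|j]; last exact: good_meas.
rewrite (_ : (fun t => _) = \1_(`[0, +oo[%classic : set R)); first exact: measurable_indic.
by apply/funext => t; rewrite indicE mem_setE in_itv/= andbT.
Qed.

Lemma D_meas j : (j <= 4)%N -> measurable_fun setT (fun p : R * R => D j p.1 p.2).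
Proof.
move=> j4; apply: (@measurable_fun_cvg _ _ _ _ (fun k (p : R * R) => dpart k j p.1 p.2)); last first.
  by move=> p _; exact: dpart_cvg.
move=> k; apply: measurable_funM.
  exact: (measurableT_comp (dom_meas j) measurable_fst).
rewrite /part; apply: measurable_sum => a.
apply: measurable_funM; first apply: measurable_funM => //.
  exact: (measurableT_comp (continuous_measurable_fun (@amp_cont a)) measurable_fst).
exact: (measurableT_comp (continuous_measurable_fun (@ptrig_cont j a)) measurable_snd).
Qed.

Lemma part0_bound n s x : 0 <= s -> `|part n 0 s x| <= Z.
Proof. by move=> s0; rewrite (le_trans (part0_le _ _ s0)) ?SA_bound. Qed.

Lemma dpart0_le k t x : `|dpart k 0 t x| <= Z.
Proof.
rewrite /dpart /=; case: (leP 0 t) => t0; last by rewrite mul0r normr0 Z_ge0.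
by rewrite mul1r part0_bound.
Qed.

Lemma part_bound k j t x : (j <= 4)%N -> good t -> `|part k j t x| <= Bd t.
Proof. by move=> j4 g; apply: le_trans (SJ_le_Bd k g); apply: part_le => //; exact: good_ge0. Qed.

Lemma dpart_le k j t x : (j <= 4)%N -> good t -> `|dpart k j t x| <= Bd t.
Proof.
by move=> j4 gt; rewrite /dpart good_dom// mul1r part_bound.
Qed.

Lemma normr_lim_le (u : R ^nat) (l M : R) : u n @[n --> \oo] --> l ->
  (forall n, `|u n| <= M) -> `|l| <= M.
Proof.
move=> ul uM; have c : (fun n => `|u n|) n @[n --> \oo] --> `|l| by exact: cvg_norm.
rewrite -(cvg_lim _ c)//; apply: limr_le; first by apply/cvg_ex; eexists; exact: c.
exact: nearW.
Qed.

Lemma D0_le t x : `|D 0 t x| <= Z.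
Proof.
apply: (normr_lim_le (u := fun k => dpart k 0 t x)); first exact: dpart_cvg.
by move=> k; exact: dpart0_le.
Qed.

Lemma D_le j t x : (j <= 4)%N -> good t -> `|D j t x| <= Bd t.
Proof.
move=> j4 gt; apply: (normr_lim_le (u := fun k => dpart k j t x)); first exact: dpart_cvg.
by move=> k; exact: dpart_le.
Qed.

Lemma cont2_add (H K : R -> R -> R) : cont2 H -> cont2 K -> cont2 (fun s x => H s x + K s x).
Proof. by move=> cH cK p; apply: cvgD; [exact: cH|exact: cK]. Qed.

Lemma cont2_scale (c : R) (H : R -> R -> R) : cont2 H -> cont2 (fun s x => c * H s x).
Proof. by move=> cH; apply: cont2_mul => // p; exact: cvg_cst. Qed.

Lemma term_cont2 j a : cont2 (term j a).
Proof.
apply: cont2_mul; last exact: cont2_snd (@ptrig_cont j a).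
apply: cont2_fst; apply: cont_mul; first exact: amp_cont.
by move=> x; exact: cvg_cst.
Qed.

Lemma part_cont2 k j : cont2 (part k j).
Proof.
rewrite /part; elim: (forest k) => [|a f IH].
  by move=> p; under eq_fun do rewrite big_nil; exact: cvg_cst.
rewrite (_ : (fun t x => _) = (fun t x => term j a t x + \sum_(b <- f) term j b t x)).
  by apply: cont2_add => //; exact: term_cont2.
by apply/funext => t; apply/funext => x; rewrite big_cons.
Qed.

Lemma part_cont k j t : continuous (part k j t).
Proof. exact: (cont2_row (@part_cont2 k j)). Qed.

Lemma dpart_cont k j t : continuous (dpart k j t).
Proof. by apply: cont_scale; exact: part_cont. Qed.

(** The iterates satisfy their equation without the cut-off [dom], whereas the limit carries it. The
    excluded times are negligible, so the factor can be inserted before dominated convergence. *)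
Lemma dblint_lim j t (E : nat -> R -> R -> R) (F : R -> R -> R) (G : R -> R) :
  (forall n, cont2 (E n)) ->
  (forall s x, (dom j s)%:R * E n s x @[n --> \oo] --> F s x) ->
  mu.-integrable `[0, t] (EFin \o G) -> (forall s, 0 <= s -> 0 <= G s) ->
  (forall n s x, dom j s -> s <= t -> 0 <= x <= 2 * pi -> `|E n s x| <= G s) ->
  prim (fun s => intT (E n s)) t @[n --> \oo] --> dblint t F.
Proof.
move=> cE EF iG G0 EG.
have I n s : intT (fun x => (dom j s)%:R * E n s x) = (dom j s)%:R * intT (E n s).
  by rewrite !intT_prim primZ//; exact: cont2_row.
have mI n : measurable_fun setT (fun s => intT (E n s)).
  by apply: continuous_measurable_fun; exact: intT_cont.
have mJ n : measurable_fun setT (fun s => intT (fun x => (dom j s)%:R * E n s x)).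
  under eq_fun do rewrite I.
  by apply: measurable_funM => //; exact: dom_meas.
have -> : (fun n => prim (fun s => intT (E n s)) t) =
          (fun n => dblint t (fun s x => (dom j s)%:R * E n s x)).
  apply/funext => n; apply: prim_ae => //.
  apply: (@filterS _ _ (ae_filter_ringOfSetsType mu) _ _ _ (ae_good t)) => s g st.
  by rewrite I good_dom ?mul1r ?g.
apply: (@dblint_cvg _ _ _ _ G) => //.
- by move=> n s; apply: cont_scale; exact: cont2_row.
- move=> n s x /andP[s0 st] xI; case: (boolP (dom j s)) => d.
    by rewrite mul1r; exact: EG.
  by rewrite mul0r normr0 G0.
Qed.

Lemma dpart0E k t : 0 <= t -> dpart k 0 t = part k 0 t.
Proof. by move=> t0; apply/funext => x; rewrite /dpart /= t0 mul1r. Qed.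

Lemma dpart_cvgS j t x : (j <= 4)%N -> dpart k.+1 j t x @[k --> \oo] --> D j t x.
Proof. by move=> j4; rewrite (cvg_shiftS (fun k => dpart k j t x)); exact: dpart_cvg. Qed.

(** For the iterates this is integration by parts mode by mode; both sides converge by domination,
    as [Bd t] bounds all the series at a good time. *)
Lemma weak_deriv_D j t : (j < 4)%N -> good t -> weak_deriv (D j t) (D j.+1 t).
Proof.
move=> j4 gt phi sphi pphi.
have [c0 d0] := sphi 0; have [c1 _] := sphi 1.
have dphi (x : R) : is_derive x 1 phi (derive1 phi x).
  by apply: DeriveDef; [exact: d0|rewrite derive1E].
have [M0 M00 M0P] := cont_bounded c0; have [M1 M10 M1P] := cont_bounded c1.
have B0 := Bd_ge0 (good_ge0 gt).
have A : intT (fun x => dpart k j t x * derive1 phi x) @[k --> \oo] -->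
         intT (fun x => D j t x * derive1 phi x).
  apply: (@intT_cvg _ _ _ (Bd t * M1)).
  - by move=> n; apply: cont_mul => //; exact: dpart_cont.
  - by move=> x; apply: cvgM; [apply: dpart_cvg; exact: ltnW|exact: cvg_cst].
  - move=> n x xI; rewrite normrM ler_pM//; [exact: (dpart_le _ _ (ltnW j4))|exact: M1P].
have C : - intT (fun x => dpart k j.+1 t x * phi x) @[k --> \oo] -->
         - intT (fun x => D j.+1 t x * phi x).
  apply: cvgN; apply: (@intT_cvg _ _ _ (Bd t * M0)).
  - by move=> n; apply: cont_mul => //; exact: dpart_cont.
  - by move=> x; apply: cvgM; [exact: dpart_cvg|exact: cvg_cst].
  - move=> n x xI; rewrite normrM ler_pM//; [exact: dpart_le|exact: M0P].
have E : (fun k => intT (fun x => dpart k j t x * derive1 phi x)) =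
         (fun k => - intT (fun x => dpart k j.+1 t x * phi x)).
  apply/funext => k; rewrite /dpart !good_dom//.
  have cp i a (g : R -> R) : continuous g -> continuous (fun x => ptrig i (arg a x) * g x).
    by move=> cg; apply: cont_mul => //; exact: ptrig_cont.
  have H i (g : R -> R) : continuous g -> intT (fun x => true%:R * part k i t x * g x) =
      \sum_(a <- forest k) amp a t * nu a ^+ i * intT (fun x => ptrig i (arg a x) * g x).
    move=> cg.
    transitivity (intT (fun x => \sum_(a <- forest k) amp a t * nu a ^+ i * (ptrig i (arg a x) * g x))).
      congr intT; apply/funext => x; rewrite mul1r mulr_suml.
      by apply: eq_bigr => a _; rewrite /term mulrA.
    rewrite intT_prim prim_sum; last by move=> a; apply: cont_scale; exact: cp.
    by apply: eq_bigr => a _; rewrite primZ//; exact: cp.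
  rewrite !H// -sumrN; apply: eq_bigr => a _.
  by rewrite (intT_ptrig _ _ dphi)// exprS; ring.
by move: A; rewrite E => A; apply: (cvg_unique _ A C).
Qed.

Lemma prim_comb (a b c t : R) (f g h : R -> R) :
  continuous f -> continuous g -> continuous h ->
  prim (fun s => a * f s + b * g s + c * h s) t = a * prim f t + b * prim g t + c * prim h t.
Proof.
move=> cf cg ch; rewrite primD; [|by apply: cont_add; exact: cont_scale|exact: cont_scale].
by rewrite primD ?primZ//; exact: cont_scale.
Qed.

(** * Passage to the limit in the equation *)

Section WeakLimit.
Variable phi : R -> R -> R.
Hypotheses (sphi : smooth2 phi) (pphi : forall t x, phi t (x + 2 * pi) = phi t x).

(* The equation satisfied by the iterates couples the linear part of iterate [n + 1]
   with the nonlinear part of iterate [n]. *)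
Definition E1 (j : nat) (n : nat) (s x : R) : R :=
  (part n.+1 j s x + eps * part n 0 s x * part n j s x) * pdx phi s x.
Definition E2 (n : nat) (s x : R) : R :=
  (part n.+1 2 s x + (3 * eps * part n 0 s x + 3 * eps ^+ 2 * part n 0 s x ^+ 2
     + eps ^+ 3 * part n 0 s x ^+ 3) * part n 2 s x) * pdx (pdx phi) s x.

Lemma E1_cont2 j n : cont2 (E1 j n).
Proof.
apply: cont2_mul; last exact: pdx_cont.
apply: cont2_add; first exact: part_cont2.
by apply: cont2_mul; [apply: cont2_scale|]; exact: part_cont2.
Qed.

Lemma E2_cont2 n : cont2 (E2 n).
Proof.
have p0 := @part_cont2 n 0.
apply: cont2_mul; last exact: pdxx_cont.
apply: cont2_add; first exact: part_cont2.
apply: cont2_mul; last exact: part_cont2.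
apply: cont2_add; first apply: cont2_add; apply: cont2_scale => //.
- exact: (cont2_mul p0 p0).
- exact: (cont2_mul p0 (cont2_mul p0 p0)).
Qed.

Lemma Bd_scale_integrable (c t : R) : mu.-integrable `[0, t] (EFin \o (fun s => Bd s * c)).
Proof.
rewrite (_ : EFin \o _ = fun s => (c%:E * (EFin \o Bd) s)%E).
  by apply: integrableZl => //; exact: Bd_integrable.
by apply/funext => s; rewrite /= EFinM muleC.
Qed.

(** The differentiated factor is bounded by [Bd s] and the others by Z, so a multiple of the
    integrable [Bd] dominates. *)
Lemma E1_lim j t : (0 < j <= 4)%N ->
  prim (fun s => intT (E1 j n s)) t @[n --> \oo] -->
  dblint t (fun s x => (1 + eps * D 0 s x) * D j s x * pdx phi s x).
Proof.
move=> /andP[j0 j4]; have [M M0 MP] := cont2_bounded 0 t (pdx_cont sphi).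
apply: (@dblint_lim j _ _ _ (fun s => Bd s * ((1 + eps * Z) * M))).
- by move=> n; exact: E1_cont2.
- move=> s x.
  have -> : (fun n => (dom j s)%:R * E1 j n s x) =
     (fun n => (dpart n.+1 j s x + eps * dpart n 0 s x * dpart n j s x) * pdx phi s x).
    apply/funext => n; rewrite /E1 /dpart; case: (boolP (dom j s)) => d.
      by rewrite /= (dom_ge0 d) !mul1r.
    by rewrite !mul0r mulr0 addr0 mul0r.
  rewrite (_ : (1 + _) * _ * _ = (D j s x + eps * D 0 s x * D j s x) * pdx phi s x); last by ring.
  apply: cvgM; last exact: cvg_cst.
  apply: cvgD; first exact: dpart_cvgS.
  apply: cvgM; last exact: dpart_cvg.
  by apply: cvgM; [exact: cvg_cst|exact: dpart_cvg].
- exact: Bd_scale_integrable.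
- move=> s s0; apply: mulr_ge0; first exact: Bd_ge0.
  by apply: mulr_ge0 => //; rewrite addr_ge0// mulr_ge0 ?Z_ge0// ltW.
- move=> n s x; case: j j0 j4 => // j _ j4 g st xI.
  have s0 := good_ge0 g.
  rewrite mulrA normrM; apply: ler_pM => //; last by apply: MP; rewrite ?s0.
  rewrite mulrDr mulr1; apply: (le_trans (ler_normD _ _)); apply: lerD; first exact: part_bound.
  rewrite normrM mulrC; apply: ler_pM => //; first exact: part_bound.
  by rewrite normrM (gtr0_norm eps0) ler_pM2l// part0_bound.
Qed.

Lemma E2_lim t : prim (fun s => intT (E2 n s)) t @[n --> \oo] -->
  dblint t (fun s x => (1 + eps * D 0 s x) ^+ 3 * D 2 s x * pdx (pdx phi) s x).
Proof.
have [M M0 MP] := cont2_bounded 0 t (pdxx_cont sphi).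
(* C bounds [(1 + eps z)^3 - 1] for [|z| <= Z]. *)
pose C := 3 * eps * Z + 3 * eps ^+ 2 * Z ^+ 2 + eps ^+ 3 * Z ^+ 3.
have e0 := ltW eps0; have z0 := Z_ge0.
have C0 : 0 <= C by rewrite /C !addr_ge0// !mulr_ge0 ?exprn_ge0.
apply: (@dblint_lim 2 _ _ _ (fun s => Bd s * ((1 + C) * M))).
- by move=> n; exact: E2_cont2.
- move=> s x.
  have -> : (fun n => (dom 2 s)%:R * E2 n s x) =
     (fun n => (dpart n.+1 2 s x + (3 * eps * dpart n 0 s x
        + 3 * eps ^+ 2 * (dpart n 0 s x * dpart n 0 s x)
        + eps ^+ 3 * (dpart n 0 s x * (dpart n 0 s x * dpart n 0 s x))) * dpart n 2 s x) * pdx (pdx phi) s x).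
    apply/funext => n; rewrite /E2 /dpart; case: (boolP (dom 2 s)) => d.
      by rewrite /= (dom_ge0 d) !mul1r; ring.
    by rewrite !mul0r mulr0 addr0 mul0r.
  rewrite (_ : (1 + _) ^+ 3 * _ * _ = (D 2 s x + (3 * eps * D 0 s x
     + 3 * eps ^+ 2 * (D 0 s x * D 0 s x)
     + eps ^+ 3 * (D 0 s x * (D 0 s x * D 0 s x))) * D 2 s x) * pdx (pdx phi) s x); last by ring.
  have c0 : dpart k 0 s x @[k --> \oo] --> D 0 s x by exact: dpart_cvg.
  apply: cvgM; last exact: cvg_cst.
  apply: cvgD; first exact: dpart_cvgS.
  apply: cvgM; last exact: dpart_cvg.
  apply: cvgD; first apply: cvgD; (apply: cvgM; first exact: cvg_cst) => //.
    exact: cvgM.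
  by apply: cvgM => //; exact: cvgM.
- exact: Bd_scale_integrable.
- move=> s s0; apply: mulr_ge0; first exact: Bd_ge0.
  by apply: mulr_ge0 => //; rewrite addr_ge0.
- move=> n s x /= g st xI.
  have s0 := good_ge0 g.
  rewrite mulrA normrM; apply: ler_pM => //; last by apply: MP; rewrite ?s0.
  rewrite mulrDr mulr1; apply: (le_trans (ler_normD _ _)); apply: lerD; first exact: part_bound.
  rewrite normrM mulrC; apply: ler_pM => //; first exact: part_bound.
  have p0 := part0_bound n x s0.
  rewrite /C; apply: (le_trans (ler_normD _ _)); apply: lerD.
    apply: (le_trans (ler_normD _ _)); apply: lerD.
      by rewrite normrM (ger0_norm (mulr_ge0 _ e0))// ler_wpM2l// mulr_ge0.
    rewrite normrM ger0_norm ?mulr_ge0 ?exprn_ge0// ler_wpM2l ?mulr_ge0 ?exprn_ge0//.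
    by rewrite normrX lerXn2r// nnegrE.
  rewrite normrM ger0_norm ?exprn_ge0// ler_wpM2l ?exprn_ge0//.
  by rewrite normrX lerXn2r// nnegrE.
Qed.

Lemma prim_rhs n t : prim (fun s => intT (rhs (pdx phi s) (pdx (pdx phi) s) n s)) t =
  - prim (fun s => intT (E1 1 n s)) t + bet * prim (fun s => intT (E1 3 n s)) t
  + mw / 3 * prim (fun s => intT (E2 n s)) t.
Proof.
have c j : continuous (fun s => intT (E1 j n s)) by apply: intT_cont; exact: E1_cont2.
have c2 : continuous (fun s => intT (E2 n s)) by apply: intT_cont; exact: E2_cont2.
have r j s : continuous (E1 j n s) by apply: cont2_row; exact: E1_cont2.
have r2 s : continuous (E2 n s) by apply: cont2_row; exact: E2_cont2.
have -> : (fun s => intT (rhs (pdx phi s) (pdx (pdx phi) s) n s)) =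
   (fun s => (-1 * intT (E1 1 n s) + bet * intT (E1 3 n s)) + mw / 3 * intT (E2 n s)).
  apply/funext => s; rewrite !intT_prim -!primZ// -!primD//.
  - congr prim; apply/funext => x; by rewrite /rhs /E1 /E2; field.
  - by apply: cont_add; exact: cont_scale.
  - exact: cont_scale.
  - exact: cont_scale.
  - exact: cont_scale.
by rewrite (prim_comb (-1) bet (mw / 3) t (c 1%N) (c 3%N) c2) mulN1r.
Qed.

(** Two limits of one sequence: through the weak form of the iterates, and through the flux terms
    separately. *)
Lemma weak_limit t : 0 <= t ->
  intT (fun x => D 0 t x * phi t x) - intT (fun x => D 0 0 x * phi 0 x)
  - dblint t (fun s x => D 0 s x * pdt phi s x) =
  - dblint t (fun s x => (1 + eps * D 0 s x) * D 1 s x * pdx phi s x)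
  + bet * dblint t (fun s x => (1 + eps * D 0 s x) * D 3 s x * pdx phi s x)
  + mw / 3 * dblint t (fun s x => (1 + eps * D 0 s x) ^+ 3 * D 2 s x * pdx (pdx phi) s x).
Proof.
move=> t0.
have L s : 0 <= s -> intT (fun x => part n.+1 0 s x * phi s x) @[n --> \oo] -->
    intT (fun x => D 0 s x * phi s x).
  move=> s0; have cs := cont2_row (s := s) (phi_cont sphi).
  have [M M0 MP] := cont_bounded cs.
  apply: (@intT_cvg _ _ _ (Z * M)).
  - by move=> n; apply: cont_mul => //; exact: part_cont.
  - move=> x; apply: cvgM; last exact: cvg_cst.
    by under eq_fun do rewrite -dpart0E//; exact: dpart_cvgS.
  - by move=> n x xI; rewrite normrM ler_pM ?part0_bound ?MP.
have L2 : prim (fun s => intT (fun x => part n.+1 0 s x * pdt phi s x)) t @[n --> \oo] -->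
    dblint t (fun s x => D 0 s x * pdt phi s x).
  have [M M0 MP] := cont2_bounded 0 t (pdt_cont sphi).
  apply: (@dblint_lim 0 _ (fun n s x => part n.+1 0 s x * pdt phi s x) _ (fun=> Z * M)).
  - by move=> n; apply: cont2_mul; [exact: part_cont2|exact: pdt_cont].
  - move=> s x; under eq_fun do rewrite mulrA.
    by apply: cvgM; [exact: dpart_cvgS|exact: cvg_cst].
  - by apply: cont_integrable => x; exact: cvg_cst.
  - by move=> s _; rewrite mulr_ge0 ?Z_ge0.
  - move=> n s x /= s0 st xI; rewrite normrM ler_pM ?part0_bound// MP//.
    by rewrite s0.
have LL : (- prim (fun s => intT (E1 1 n s)) t + bet * prim (fun s => intT (E1 3 n s)) t
  + mw / 3 * prim (fun s => intT (E2 n s)) t) @[n --> \oo] -->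
  (intT (fun x => D 0 t x * phi t x) - intT (fun x => D 0 0 x * phi 0 x)
    - dblint t (fun s x => D 0 s x * pdt phi s x)).
  under eq_fun do rewrite -prim_rhs -(weak_part sphi pphi _ t0).
  by apply: cvgB; [apply: cvgB; exact: L|exact: L2].
have RR : (- prim (fun s => intT (E1 1 n s)) t + bet * prim (fun s => intT (E1 3 n s)) t
  + mw / 3 * prim (fun s => intT (E2 n s)) t) @[n --> \oo] -->
  (- dblint t (fun s x => (1 + eps * D 0 s x) * D 1 s x * pdx phi s x)
  + bet * dblint t (fun s x => (1 + eps * D 0 s x) * D 3 s x * pdx phi s x)
  + mw / 3 * dblint t (fun s x => (1 + eps * D 0 s x) ^+ 3 * D 2 s x * pdx (pdx phi) s x)).
  apply: cvgD; first apply: cvgD.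
  - by apply: cvgN; exact: E1_lim.
  - by apply: cvgM; [exact: cvg_cst|exact: E1_lim].
  - by apply: cvgM; [exact: cvg_cst|exact: E2_lim].
exact: (cvg_unique _ LL RR).
Qed.

End WeakLimit.

(** * Norms of the limit *)

(** The modulus of [x + i y]. *)
Definition pnorm (x y : R) : R := Num.sqrt (x ^+ 2 + y ^+ 2).

Lemma pnorm_ge0 x y : 0 <= pnorm x y. Proof. exact: sqrtr_ge0. Qed.

Lemma sqr_pnorm x y : pnorm x y ^+ 2 = x ^+ 2 + y ^+ 2.
Proof. by rewrite /pnorm sqr_sqrtr// addr_ge0 ?sqr_ge0. Qed.

Lemma pnorm_le x y (m : R) : 0 <= m -> x ^+ 2 + y ^+ 2 <= m ^+ 2 -> pnorm x y <= m.
Proof. by move=> m0 h; rewrite -(@ler_pXn2r _ 2) ?nnegrE ?pnorm_ge0// sqr_pnorm. Qed.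

Lemma pnormD x y x' y' : pnorm (x + x') (y + y') <= pnorm x y + pnorm x' y'.
Proof.
apply: pnorm_le; first by rewrite addr_ge0 ?pnorm_ge0.
have cs : x * x' + y * y' <= pnorm x y * pnorm x' y'.
  have [n|p] := leP (x * x' + y * y') 0.
    by apply: le_trans n _; rewrite mulr_ge0 ?pnorm_ge0.
  rewrite -(@ler_pXn2r _ 2) ?nnegrE ?mulr_ge0 ?pnorm_ge0 ?(ltW p)//.
  rewrite exprMn !sqr_pnorm; have := sqr_ge0 (x * y' - y * x'); nra.
have -> : (pnorm x y + pnorm x' y') ^+ 2 =
    (x ^+ 2 + y ^+ 2) + 2 * (pnorm x y * pnorm x' y') + (x' ^+ 2 + y' ^+ 2).
  by rewrite -!sqr_pnorm; ring.
by nra.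
Qed.

Lemma pnormZ (c x y : R) : pnorm (c * x) (c * y) = `|c| * pnorm x y.
Proof. by rewrite /pnorm !exprMn -mulrDr sqrtrM ?sqr_ge0// sqrtr_sqr. Qed.

Lemma pnorm_sum (I : Type) (r : seq I) (X Y : I -> R) :
  pnorm (\sum_(i <- r) X i) (\sum_(i <- r) Y i) <= \sum_(i <- r) pnorm (X i) (Y i).
Proof.
elim: r => [|i r IH]; first by rewrite !big_nil /pnorm expr0n addr0 sqrtr0.
by rewrite !big_cons (le_trans (pnormD _ _ _ _))// lerD2l.
Qed.

Lemma intT_cos_cos (m n : int) (h : R) :
  intT (fun x => cos (m%:~R * x + h) * cos (n%:~R * x)) =
  pi * ((m == n)%:R + (m == - n)%:R) * cos h.
Proof.
transitivity (intT (fun x => 2^-1 * (cos ((m - n)%:~R * x + h) + cos ((m + n)%:~R * x + h)))).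
  congr intT; apply/funext => x.
  have -> : (m - n)%:~R * x + h = (m%:~R * x + h) - n%:~R * x :> R by rewrite intrB; ring.
  have -> : (m + n)%:~R * x + h = (m%:~R * x + h) + n%:~R * x :> R by rewrite intrD; ring.
  by rewrite (cosB (m%:~R * x + h)) (cosD (m%:~R * x + h)); field.
rewrite intT_prim primZ; last by apply: cont_add; exact: mode_cont.
rewrite primD; [|exact: mode_cont..].
by rewrite -!intT_prim !intT_cos_mode subr_eq0 addr_eq0; field.
Qed.

Lemma intT_cos_sin (m n : int) (h : R) :
  intT (fun x => cos (m%:~R * x + h) * sin (n%:~R * x)) =
  pi * ((m == - n)%:R - (m == n)%:R) * sin h.
Proof.
transitivity (intT (fun x => 2^-1 * (sin ((m + n)%:~R * x + h) + -1 * sin ((m - n)%:~R * x + h)))).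
  congr intT; apply/funext => x.
  have -> : (m - n)%:~R * x + h = (m%:~R * x + h) - n%:~R * x :> R by rewrite intrB; ring.
  have -> : (m + n)%:~R * x + h = (m%:~R * x + h) + n%:~R * x :> R by rewrite intrD; ring.
  by rewrite (sinB (m%:~R * x + h)) (sinD (m%:~R * x + h)); field.
rewrite intT_prim primZ; last by apply: cont_add; [|apply: cont_scale]; exact: smode_cont.
rewrite primD; [|exact: smode_cont|apply: cont_scale; exact: smode_cont].
rewrite primZ; last exact: smode_cont.
by rewrite -!intT_prim !intT_sin_mode subr_eq0 addr_eq0; field.
Qed.

(** With [mim], the real and imaginary parts of the n-th Fourier coefficient of
    [cos (freq a x + phase a)]. *)
Definition mre (a : tree) (n : int) : R :=
  2^-1 * ((freq a == n)%:R + (freq a == - n)%:R) * cos (phase a).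
Definition mim (a : tree) (n : int) : R :=
  2^-1 * ((freq a == n)%:R - (freq a == - n)%:R) * sin (phase a).

Lemma fcoef_re_part k t n :
  fcoef_re (part k 0 t) n = \sum_(a <- forest k) amp a t * mre a n.
Proof.
rewrite /fcoef_re intT_part_mul; last exact: cosn_cont.
rewrite mulr_sumr; apply: eq_bigr => a _; rewrite intT_cos_cos /mre.
have := lt0r_neq0 (pi_gt0 R).
by move: (pi : R) => p p0; field.
Qed.

Lemma fcoef_im_part k t n :
  fcoef_im (part k 0 t) n = \sum_(a <- forest k) amp a t * mim a n.
Proof.
rewrite /fcoef_im intT_part_mul; last exact: sinn_cont.
rewrite mulr_sumr -sumrN; apply: eq_bigr => a _; rewrite intT_cos_sin /mim.
have := lt0r_neq0 (pi_gt0 R).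
by move: (pi : R) => p p0; field.
Qed.

Lemma pnorm_mode a n :
  pnorm (mre a n) (mim a n) <= 2^-1 * ((freq a == n)%:R + (freq a == - n)%:R).
Proof.
apply: pnorm_le; first by rewrite mulr_ge0// addr_ge0.
rewrite /mre /mim; set p := (freq a == n)%:R; set q := (freq a == - n)%:R.
have p0 : 0 <= p by rewrite /p. have q0 : 0 <= q by rewrite /q.
have := cos2Dsin2 (phase a).
have -> : (2^-1 * (p + q) * cos (phase a)) ^+ 2 + (2^-1 * (p - q) * sin (phase a)) ^+ 2 =
  (2^-1 * (p + q)) ^+ 2 * (cos (phase a) ^+ 2 + sin (phase a) ^+ 2) - p * q * sin (phase a) ^+ 2 by field.
by move=> ->; rewrite mulr1 gerBl; apply: mulr_ge0; [exact: mulr_ge0|exact: sqr_ge0].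
Qed.

Lemma fcoef_abs_part k t n : fcoef_abs (part k 0 t) n <=
  \sum_(a <- forest k) `|amp a t| * (2^-1 * ((freq a == n)%:R + (freq a == - n)%:R)).
Proof.
rewrite /fcoef_abs fcoef_re_part fcoef_im_part -/(pnorm _ _).
apply: (le_trans (pnorm_sum _ _ _)); apply: ler_sum => a _.
by rewrite pnormZ ler_wpM2l// pnorm_mode.
Qed.

Lemma intT_D0_cvg t (g : R -> R) : 0 <= t -> continuous g ->
  intT (fun x => part k 0 t x * g x) @[k --> \oo] --> intT (fun x => D 0 t x * g x).
Proof.
move=> t0 cg; have [M M0 MP] := cont_bounded cg.
apply: (@intT_cvg _ _ _ (Z * M)).
- by move=> n; apply: cont_mul => //; exact: part_cont.
- move=> x; apply: cvgM; last exact: cvg_cst.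
  by under eq_fun do rewrite -dpart0E//; exact: dpart_cvg.
- by move=> n x xI; rewrite normrM ler_pM ?part0_bound ?MP.
Qed.

Lemma fcoef_re_D0_cvg t n : 0 <= t -> fcoef_re (part k 0 t) n @[k --> \oo] --> fcoef_re (D 0 t) n.
Proof.
by move=> t0; apply: cvgM; [exact: cvg_cst|apply: intT_D0_cvg => //; exact: cosn_cont].
Qed.

Lemma fcoef_im_D0_cvg t n : 0 <= t -> fcoef_im (part k 0 t) n @[k --> \oo] --> fcoef_im (D 0 t) n.
Proof.
by move=> t0; apply: cvgN; apply: cvgM; [exact: cvg_cst|apply: intT_D0_cvg => //; exact: sinn_cont].
Qed.

Lemma fcoef_abs_cvg t n : 0 <= t ->
  fcoef_abs (part k 0 t) n @[k --> \oo] --> fcoef_abs (D 0 t) n.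
Proof.
move=> t0; have cre := @fcoef_re_D0_cvg t n t0; have cim := @fcoef_im_D0_cvg t n t0.
rewrite /fcoef_abs; apply: continuous_cvg; first exact: sqrt_continuous.
by apply: cvgD; rewrite !expr2; exact: cvgM.
Qed.

Definition weight (s : nat) (lb : R) (n : int) : R := (1 + `|n|%:~R) ^+ s * expR (lb * `|n|%:~R).

Lemma weight_ge0 s lb n : 0 <= weight s lb n.
Proof. by rewrite mulr_ge0 ?expR_ge0// exprn_ge0// addr_ge0// ler0z. Qed.

Lemma sum_pick (r : seq int) (w : int -> R) (c : int) : uniq r -> (forall n, 0 <= w n) ->
  \sum_(n <- r) w n * (c == n)%:R <= w c.
Proof.
move=> ur w0; have [cr|cr] := boolP (c \in r).
  rewrite (bigD1_seq c)//= eqxx mulr1 big1 ?addr0// => n nc.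
  by rewrite eq_sym (negbTE nc) mulr0.
rewrite big_seq big1 ?w0// => n nr.
by case: eqP => [e|]; [rewrite e nr in cr|rewrite mulr0].
Qed.

(** The norm is a supremum over finite sets of frequencies, on which the coefficients of the
    iterates converge. Each tree contributes at most half of its amplitude at [freq a] and half at
    [- freq a], where the weight is the same. *)
Lemma wnorm_D0_le s lb t (L : R) : 0 <= t ->
  (forall k, \sum_(a <- forest k) `|amp a t| * weight s lb (freq a) <= L) ->
  (wnorm s lb (D 0 t) <= L%:E)%E.
Proof.
move=> t0 HL; apply: ub_ereal_sup => _ [X [fX _] <-].
rewrite fsbig_finite//= sumEFin lee_fin.
have ur := finmap.fset_uniq (fset_set X); move: (finmap.enum_fset (fset_set X)) ur => r ur.
have c : \sum_(n <- r) weight s lb n * fcoef_abs (part k 0 t) n @[k --> \oo] -->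
    \sum_(n <- r) weight s lb n * fcoef_abs (D 0 t) n.
  apply: cvg_big => [|n _]; first exact: add_continuous.
  by apply: cvgM; [exact: cvg_cst|exact: fcoef_abs_cvg].
rewrite -(cvg_lim _ c)//; apply: limr_le; first by apply/cvg_ex; eexists; exact: c.
apply: nearW => k; apply: le_trans (HL k).
apply: (@le_trans _ _ (\sum_(n <- r) \sum_(a <- forest k)
   `|amp a t| * (2^-1 * (weight s lb n * (freq a == n)%:R + weight s lb n * (- freq a == n)%:R)))).
  apply: ler_sum => n _.
  apply: (le_trans (ler_wpM2l (weight_ge0 s lb n) (fcoef_abs_part k t n))).
  rewrite mulr_sumr; apply: ler_sum => a _.
  by rewrite eqr_oppLR le_eqVlt; apply/orP; left; apply/eqP; ring.
rewrite exchange_big /=; apply: ler_sum => a _.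
rewrite -mulr_sumr ler_wpM2l// -mulr_sumr big_split /=.
have -> : weight s lb (freq a) = 2^-1 * (weight s lb (freq a) + weight s lb (- freq a)).
  by rewrite /weight normrN; field.
by rewrite ler_wpM2l// lerD// sum_pick// => n; exact: weight_ge0.
Qed.

Lemma SA_le_SAoo k t : 0 <= t -> SA k t <= SAoo t.
Proof.
move=> t0; apply: nondecreasing_cvgn_le; first exact: SA_homo.
by apply/cvg_ex; eexists; exact: SA_cvg.
Qed.

Lemma freq0_amp a t : freq a = 0 -> amp a t = 0 /\ maj a t = 0.
Proof. by move=> n0; apply: nu_eq0; rewrite /nu n0. Qed.

Section Decay.
Variable v : R.
Hypothesis vgam : v <= gam / 2.

(** The strip uses v <= 32/64 gam out of the 33/64 in [sig]; as nonzero frequencies have modulus at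
    least 1, the last gam / 64 gives the exponential decay. *)
Lemma wnorm0_le t : 0 <= t ->
  (wnorm 0 (v * t) (D 0 t) <= (expR (- (t / 64 * gam)) * SAoo t)%:E)%E.
Proof.
move=> t0; apply: wnorm_D0_le => // k.
apply: (@le_trans _ _ (expR (- (t / 64 * gam)) * SA k t)); last first.
  by rewrite ler_wpM2l ?expR_ge0 ?SA_le_SAoo.
rewrite /SA mulr_sumr; apply: ler_sum => a _; rewrite /weight expr0 mul1r.
have [n0|n0] := eqVneq (freq a) 0.
  by have [-> ->] := freq0_amp t n0; rewrite normr0 mul0r mulr0.
apply: (@le_trans _ _ (expR (- (t / 64 * gam)) * (`|amp a t| * expR (sig * `|nu a| * t)))); last first.
  by rewrite ler_wpM2l ?expR_ge0 ?amp_le_maj.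
rewrite mulrCA ler_wpM2l// -expRD ler_expR intr_norm -/(nu a).
have n1 : 1 <= `|nu a| by exact: intr_ge1.
have h1 : v * `|nu a| <= gam / 2 * `|nu a| by rewrite ler_wpM2r.
have h2 : gam * 1 <= gam * `|nu a| by rewrite ler_pM2l.
have h : v * `|nu a| <= sig * `|nu a| - gam / 64 by rewrite /sig; lra.
have := ler_wpM2r t0 h; lra.
Qed.

(** For [|n| >= 1] one has [1 + |n| <= 2 |n|], whence 16 = 2^4. If [Joo t] is infinite there is
    nothing to prove. *)
Lemma wnorm4_le t : 0 <= t -> (wnorm 4 (v * t) (D 0 t) <= 16%:E * Joo t)%E.
Proof.
move=> t0; have [Jt|] := boolP (Joo t < +oo)%E; last first.
  by rewrite -leNgt leye_eq => /eqP ->; rewrite gt0_muley ?leey// lte_fin.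
have gt : good t by rewrite /good t0.
have -> : Joo t = (Bd t)%:E by rewrite /Bd fineK// ge0_fin_numE// Joo_ge0.
rewrite -EFinM; apply: wnorm_D0_le => // k.
apply: (@le_trans _ _ (16 * SJ k t)); last by rewrite ler_wpM2l ?SJ_le_Bd.
rewrite /SJ mulr_sumr; apply: ler_sum => a _; rewrite /weight.
have [n0|n0] := eqVneq (freq a) 0.
  by have [-> ->] := freq0_amp t n0; rewrite normr0 mul0r !mulr0.
rewrite intr_norm -/(nu a).
have n1 : 1 <= `|nu a| by exact: intr_ge1.
have p4 : (1 + `|nu a|) ^+ 4 <= 16 * nu a ^+ 4.
  have -> : 16 * nu a ^+ 4 = (2 * `|nu a|) ^+ 4.
    by rewrite exprMn -normrX (ger0_norm (nu4_ge0 a)); congr (_ * _); rewrite -natrX.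
  by apply: lerXn2r; rewrite ?nnegrE ?addr_ge0 ?mulr_ge0//; lra.
rewrite mulrCA [leRHS]mulrA; apply: ler_pM; rewrite ?exprn_ge0 ?addr_ge0 ?mulr_ge0 ?expR_ge0//.
apply: le_trans (amp_le_maj a t0); rewrite ler_wpM2l// ler_expR.
have h1 : v * `|nu a| <= sig * `|nu a|.
  rewrite ler_wpM2r//; apply: (le_trans vgam).
  by rewrite /sig (mulrC gam) ler_pM2r//; lra.
by have := ler_wpM2r t0 h1; lra.
Qed.

Lemma wnorm_ge0 s lb (g : R -> R) : (0 <= wnorm s lb g)%E.
Proof.
apply: esum_ge0 => n _; rewrite lee_fin; apply: mulr_ge0; last exact: sqrtr_ge0.
by rewrite mulr_ge0 ?expR_ge0// exprn_ge0// addr_ge0// ler0z.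
Qed.

Lemma wnorm4_int (t : R) : 0 <= t ->
  (\int[mu]_(s in `[0%R, t]) wnorm 4 (v * s) (D 0 s) <= (16 * Poo t)%:E)%E.
Proof.
move=> t0.
apply: (@le_trans _ _ (\int[mu]_(s in `[0%R, t]) (16%:E * Joo s))%E).
  apply: ge0_le_integral_nm => s /=; rewrite in_itv/= => /andP[s0 _].
    exact: wnorm_ge0.
  exact: wnorm4_le.
by rewrite integralZl//; [rewrite Joo_int// -EFinM|exact: Joo_integrable].
Qed.

(** The quarter of gam left by the energy estimate is 16 gam / 64, and 16 is the price of passing
    from [n^4] to [(1 + |n|)^4]. *)
Lemma final_energy (t : R) : 0 <= t ->
  (wnorm 0 (v * t) (D 0 t) +
   (gam / 64)%:E * \int[mu]_(s in `[0%R, t]) wnorm 4 (v * s) (D 0 s) <= Z%:E)%E.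
Proof.
move=> t0; have A0 : 0 <= SAoo t by apply: le_trans (SA_le_SAoo 0 t0); exact: SA_ge0.
apply: (@le_trans _ _ ((SAoo t)%:E + (gam / 64)%:E * (16 * Poo t)%:E)%E).
  apply: leeD.
    apply: le_trans (wnorm0_le t0) _; rewrite lee_fin ler_piMl//.
    rewrite -expR0 ler_expR oppr_le0; apply: mulr_ge0; last exact: ltW.
    by rewrite divr_ge0.
  by apply: lee_wpmul2l; [rewrite lee_fin divr_ge0// ltW|exact: wnorm4_int].
rewrite -EFinM -EFinD lee_fin; apply: le_trans (energy_oo t0).
by rewrite lerD2l; lra.
Qed.

Lemma SAoo_le t : 0 <= t -> SAoo t <= Z.
Proof.
move=> t0; apply: limr_le; first by apply/cvg_ex; eexists; exact: SA_cvg.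
by apply: nearW => k; exact: SA_bound.
Qed.

Lemma final_decay (t : R) : 0 <= t ->
  (wnorm 0 (v * t) (D 0 t) <= Z%:E * (expR (- (t / 64 * gam)))%:E)%E.
Proof.
move=> t0; apply: le_trans (wnorm0_le t0) _.
by rewrite -EFinM lee_fin mulrC ler_wpM2r ?expR_ge0 ?SAoo_le.
Qed.

End Decay.

(** * The limit at time zero *)

Lemma amp0_node a : (if a is Leaf _ _ then false else true) -> amp a 0 = 0.
Proof. by case: a => // *; exact: duhamel_at0. Qed.

Lemma sum_amp0 k (w : tree -> R) : \sum_(a <- forest k) amp a 0 * w a =
  \sum_(0 <= m < k) rad m * (w (Leaf true m) + w (Leaf false m)).
Proof.
case: k => [|k]; first by rewrite !big_nil.
rewrite sum_forestS sum_leaves.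
rewrite [X in _ + X + _ + _]big1 ?addr0; last first.
  by move=> a _; rewrite big1// => b _; rewrite amp0_node// mul0r.
rewrite [X in _ + X + _]big1 ?addr0; last first.
  by move=> a _; rewrite big1// => b _; rewrite big1// => c _; rewrite amp0_node// mul0r.
rewrite [X in _ + X]big1 ?addr0; last first.
  move=> a _; rewrite big1// => b _; rewrite big1// => c _; rewrite big1// => d _.
  by rewrite amp0_node// mul0r.
by apply: eq_bigr => m _; rewrite /= !mulr0 expR0 !mulr1 mulrDr.
Qed.

(** The sequence is constant from index p + 1 on. *)
Lemma eventually_sum_pick (p : nat) (u : nat -> R) (l : nat -> R) :
  (forall k, u k = \sum_(0 <= m < k) (m == p)%:R * l m) ->
  forall L, u k @[k --> \oo] --> L -> L = l p.
Proof.
move=> uE L uL; have : u k @[k --> \oo] --> l p.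
  apply: cvg_near_cst; exists p.+1 => // k /= pk; rewrite uE.
  rewrite (bigD1_seq p)/= ?iota_uniq ?mem_index_iota ?pk// eqxx mul1r big1 ?addr0// => m mp.
  by rewrite (negbTE mp) mul0r.
exact: cvg_unique.
Qed.

(** The two conjugate leaves at frequencies p + 1 and - (p + 1) contribute one half each. *)
Lemma fcoef_re_D00 (p : nat) : fcoef_re (D 0 0) p.+1%:Z = rad p * cos (ang p).
Proof.
apply: (@eventually_sum_pick p (fun k => fcoef_re (part k 0 0) p.+1%:Z)
  (fun m => rad m * cos (ang m))); last exact: fcoef_re_D0_cvg.
move=> k; rewrite fcoef_re_part sum_amp0; apply: eq_bigr => m _.
rewrite /mre /= cosN !eqr_opp.
rewrite eqz_nat eqSS; by case: (m == p) => /=; field.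
Qed.

Lemma fcoef_im_D00 (p : nat) : fcoef_im (D 0 0) p.+1%:Z = rad p * sin (ang p).
Proof.
apply: (@eventually_sum_pick p (fun k => fcoef_im (part k 0 0) p.+1%:Z)
  (fun m => rad m * sin (ang m))); last exact: fcoef_im_D0_cvg.
move=> k; rewrite fcoef_im_part sum_amp0; apply: eq_bigr => m _.
rewrite /mim /= sinN !eqr_opp.
rewrite eqz_nat eqSS; by case: (m == p) => /=; field.
Qed.

Lemma fcoef_re_D00_0 : fcoef_re (D 0 0) 0 = 0.
Proof.
have c := @fcoef_re_D0_cvg 0 0 (lexx 0).
have E : (fun k => fcoef_re (part k 0 0) 0) = fun=> 0.
  apply/funext => k; rewrite fcoef_re_part sum_amp0 big1// => m _.
  have e1 : (freq (Leaf true m) == 0) = false by [].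
  have e2 : (freq (Leaf false m) == 0) = false by [].
  by rewrite /mre oppr0 e1 e2 !(addr0, mulr0, mul0r).
by rewrite E in c; exact: (cvg_unique _ c (cvg_cst 0)).
Qed.

End Amplitudes.

Theorem theorem6p12 (R : realType) (eps bo mu0 : R) (zeta0 : R -> R) :
  0 < eps -> eps <= 1 -> 0 < bo -> 0 < mu0 -> mu0 < 1 ->
  0 < Num.sqrt mu0 / bo - mu0 / 3 ->
  inA 0 0 zeta0 ->
  intT zeta0 = 0 ->
  (wnorm 0 0 zeta0 <
     ((Num.sqrt mu0 / bo - mu0 / 3) /
      (128 * eps * (Num.sqrt mu0 / bo + 55 / 6 * mu0 + 1)))%:E)%E ->
  exists zeta : R -> R -> R,
    (forall t x, zeta t (x + 2 * pi) = zeta t x) /\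
    forall T : R, 0 < T ->
      weak_solution eps mu0 bo zeta0 T zeta /\
      forall nu : R, 0 <= nu -> nu < (Num.sqrt mu0 / bo - mu0 / 3) / 2 ->
        [/\ exists M : R, forall t, t \in `[0, T] ->
              (wnorm 0 (nu * t) (zeta t) <= M%:E)%E,
            (\int[lebesgue_measure]_(t in `[0%R, T]) wnorm 4 (nu * t) (zeta t)
               < +oo)%E
          & forall t, t \in `[0, T] ->
            (wnorm 0 (nu * t) (zeta t)
             + ((Num.sqrt mu0 / bo - mu0 / 3) / 64)%:E *
               \int[lebesgue_measure]_(s in `[0%R, t]) wnorm 4 (nu * s) (zeta s)
             <= wnorm 0 0 zeta0)%E /\
            (wnorm 0 (nu * t) (zeta t)
             <= wnorm 0 0 zeta0 *
                (expR (- (t / 64 * (Num.sqrt mu0 / bo - mu0 / 3))))%:E)%E].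
Proof.
move=> eps0 _ bo0 mu00 _ gam0 [_ [i0 w0]] m0 small.
set bet := Num.sqrt mu0 / bo in gam0 small *; set gam := bet - mu0 / 3 in gam0 small *.
have bet0 : 0 < bet by rewrite /bet divr_gt0// sqrtr_gt0.
have wfin : wnorm 0 0 zeta0 \is a fin_num by rewrite ge0_fin_numE// wnorm_ge0.
pose Z := fine (wnorm 0 0 zeta0).
have ZE : wnorm 0 0 zeta0 = Z%:E by rewrite fineK.
rewrite ZE in small *.
have Zsmall : 128 * eps * (bet + 55 / 6 * mu0 + 1) * Z <= gam.
  move: small; rewrite lte_fin ltr_pdivlMr; first by move=> /ltW; rewrite mulrC.
  by rewrite !mulr_gt0// !addr_gt0// mulr_gt0// divr_gt0.
(* Moduli and phases are chosen at positive frequencies only: conjugate leaves supply the negative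
   ones, and zero mean removes the mode zero. *)
have [ang angP] := choice (fun m : nat =>
  polar_form (fcoef_re zeta0 m.+1%:Z) (fcoef_im zeta0 m.+1%:Z)).
pose rad m := fcoef_abs zeta0 m.+1%:Z.
have rad0 m : 0 <= rad m by exact: sqrtr_ge0.
have radZ k : \sum_(0 <= m < k) (rad m + rad m) <= Z.
  by apply: sum_fcoef_abs_le => //; rewrite ZE.
have gamE : gam = bet - mu0 / 3 by [].
pose zeta := D eps bet mu0 gam rad ang.
have le_zeta := D0_le eps0 bet0 mu00 gam0 ang rad0 radZ gamE Zsmall.
have mz := D_meas eps0 bet0 mu00 gam0 ang rad0 radZ gamE Zsmall.
(* Measurability and the bound Z make the limit at time 0 integrable, so that its coefficients can
   be compared with those of the datum. *)
have z00 : lebesgue_measure.-integrable `[0, 2 * pi] (EFin \o zeta 0 0).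
  apply: (@le_integrable _ _ _ lebesgue_measure _ _ _ (EFin \o fun=> Z)) => //.
  - apply/measurable_EFinP; apply: measurable_funTS.
    exact: (measurableT_comp (mz 0 isT) (measurable_pair1 _)).
  - move=> x _ /=; rewrite lee_fin; apply: le_trans (le_zeta 0 x) _; exact: ler_norm.
  - by apply: cont_integrable => x; exact: cvg_cst.
exists (zeta 0); split; first exact: D_periodic.
move=> T T0; split; last first.
  (* The function was fixed before nu and T; nu enters only as a strip rate of at most gam / 2. *)
  move=> nu nu0 /ltW nug; split.
  - exists Z => t; rewrite in_itv/= => /andP[t0 _].
    apply: le_trans (final_energy eps0 bet0 mu00 gam0 ang rad0 radZ gamE Zsmall nug t0).
    rewrite leeDl//; apply: mule_ge0; first by rewrite lee_fin ltW// divr_gt0.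
    by apply: integral_ge0 => s _; exact: wnorm_ge0.
  - apply: le_lt_trans (wnorm4_int eps0 bet0 mu00 gam0 ang rad0 radZ gamE Zsmall nug (ltW T0)) _.
    exact: ltry.
  - move=> t; rewrite in_itv/= => /andP[t0 _]; split.
    + exact: (final_energy eps0 bet0 mu00 gam0 ang rad0 radZ gamE Zsmall nug t0).
    + exact: (final_decay eps0 bet0 mu00 gam0 ang rad0 radZ gamE Zsmall nug t0).
exists zeta, Z, (Bd eps bet mu0 gam rad); split => //; split.
  by move=> k k3; apply: mz; exact: leqW.
split; first by apply: aeW => t _; apply: aeW => x _; exact: le_zeta.
split; first exact: (Bd_integrable eps0 bet0 mu00 gam0 rad0 radZ gamE Zsmall).
split.
  have ag := ae_good eps0 bet0 mu00 gam0 rad0 radZ gamE Zsmall T.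
  apply: (@filterS _ _ (ae_filter_ringOfSetsType lebesgue_measure) _ _ _ ag) => t gt tT.
  split=> k k3.
    apply: aeW => x _; apply: (D_le eps0 bet0 mu00 gam0 ang rad0 radZ gamE Zsmall); last exact: gt.
    exact: leqW.
  apply: (weak_deriv_D eps0 bet0 mu00 gam0 ang rad0 radZ gamE Zsmall); last exact: gt.
  exact: leqW.
move=> phi sphi pphi t; rewrite in_itv/= => /andP[t0 _].
(* [zeta0] and the limit at time 0 share their Fourier coefficients, hence agree against smooth
   periodic functions, which is all that the weak form asks of the datum. *)
have -> : intT (fun x => zeta0 x * phi 0 x) = intT (fun x => zeta 0 0 x * phi 0 x).
  apply: (@intT_coef_eq _ _ _ (phi 0) (pdx phi 0)) => //.
  - case=> [|n]; last first.
      by rewrite (fcoef_re_D00 eps0 bet0 mu00 gam0 ang rad0 radZ gamE Zsmall) (angP n).1.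
    rewrite (fcoef_re_D00_0 eps0 bet0 mu00 gam0 ang rad0 radZ gamE Zsmall).
    rewrite /fcoef_re; under eq_fun do rewrite mul0r cos0 mulr1.
    by rewrite m0 mulr0.
  - by move=> n; rewrite (fcoef_im_D00 eps0 bet0 mu00 gam0 ang rad0 radZ gamE Zsmall) (angP n).2.
  - exact: phi_dx.
  - exact: (cont2_row (pdx_cont sphi)).
exact: (weak_limit eps0 bet0 mu00 gam0 ang rad0 radZ gamE Zsmall sphi pphi t0).
Qed.
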